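(* Let $K$ be a Lie group modeled on a locally convex space and let $M$ be a finite-dimensional connected manifold with corners. Then each continuous principal $K$-bundle over $M$ is continuously equivalent to a smooth principal $K$-bundle over $M$. Moreover, two smooth principal $K$-bundles over $M$ are smoothly equivalent if and only if they are continuously equivalent.
   Context: Calculus. Locally convex spaces are real and Hausdorff. For $E,F$ locally convex and $U\subseteq E$ open, a map $f:U\to F$ is $C^1$ if it is continuous, $df(x).v:=\lim_{h\to 0}\frac1h(f(x+hv)-f(x))$ exists for all $x\in U$, $v\in E$, and $df:U\times E\to F$ is continuous. Recursively, $d^{n}f(x).(v_1,\dots,v_n):=\lim_{h\to0}\frac1h\big(d^{n-1}f(x+hv_n).(v_1,\dots,v_{n-1})-d^{n-1}f(x).(v_1,\dots,v_{n-1})\big)$; $f$ is $C^n$ if $d^kf:U\times E^k\to F$ exists and is continuous for $k=1,\dots,n$, and smooth if it is $C^n$ for all $n$. A Lie group modeled on a locally convex space is a group that is a smooth manifold modeled on a locally convex space with smooth group operations. Manifolds with corners. A map $f:A\to E$ from a (not necessarily open) subset $A\subseteq\mathbb{R}^n$ is smooth if each $x\in A$ has an open neighborhood $U_x$ in $\mathbb{R}^n$ and a smooth map $f_x:U_x\to E$ agreeing with $f$ on $A\cap U_x$. A $d$-dimensional manifold with corners is a paracompact Hausdorff space in which each point has a neighborhood homeomorphic to an open subset of $\mathbb{R}^d_+=\{x\in\mathbb{R}^d:x_i\ge0 \text{ for all } i\}$, with smooth coordinate changes. Bundles. A continuous principal $K$-bundle over $M$ is a topological space $P$ with a continuous right action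 $P\times K\to P$ and a map $\eta:P\to M$ such that there are an open cover $(U_i)_{i\in I}$ of $M$ (a locally trivial cover) and homeomorphisms (local trivializations) $\Omega_i:\eta^{-1}(U_i)\to U_i\times K$ with $\mathrm{pr}_1\circ\Omega_i=\eta|_{\eta^{-1}(U_i)}$ and $\Omega_i(p\cdot k)=\Omega_i(p)\cdot k$, where $K$ acts on $U_i\times K$ by right multiplication on the second factor. The transition functions $k_{ij}:U_i\cap U_j\to K$ are the continuous maps given by $\Omega_i^{-1}(x,e)\cdot k_{ij}(x)=\Omega_j^{-1}(x,e)$. The bundle is smooth if the transition functions are smooth for some choice of local trivializations; then $P$ carries the smooth structure for which these $\Omega_i$ are diffeomorphisms. A continuous bundle map $\Omega:P\to P'$ is a continuous map with $\Omega(p\cdot k)=\Omega(p)\cdot k$; it is a continuous bundle equivalence if it is an isomorphism inducing $\mathrm{id}_M$ on $M$. Two bundles are continuously equivalent if there is a continuous bundle equivalence between them; two smooth bundles are smoothly equivalent if there is a bundle equivalence between them that is smooth for the smooth structures just described. *)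

(* Defs.v *)
From HB Require Import structures.
From mathcomp Require Import all_boot all_order all_algebra.
From mathcomp Require Import all_classical all_reals all_analysis.

Set Implicit Arguments.
Unset Strict Implicit.
Unset Printing Implicit Defensive.

Import Order.TTheory GRing.Theory Num.Theory numFieldNormedType.Exports.

Local Open Scope classical_set_scope.
Local Open Scope ring_scope.

Section Calculus.
Context {R : realType} {E F : tvsType R}.
Implicit Types (f g : E -> F) (x v : E) (U V A : set E).

(* [derivable] and [derive] of the library require normed modules. *)
Definition ddir f x v : set F :=
  [set l | h^-1 *: (f (x + h *: v) - f x) @[h --> (0 : R)^'] --> l].

Definition tderivable f x v : Prop := ddir f x v !=set0.

Definition tderive f x v : F := xget 0 (ddir f x v).

(* [diffn f k (x, v)] is d^k f(x).(v_1, ..., v_k), the direction v_1 being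
   used first; E^k carries the product topology. *)
Definition diffn f (k : nat) (p : E * {ptws 'I_k -> E}) : F :=
  foldl (fun g v x => tderive g x v) f [seq p.2 i | i : 'I_k] p.1.

(* Meant for open U: then only the values of f on U matter. *)
Definition Cn (n : nat) U f : Prop :=
  (forall k : nat, (k < n)%N -> forall (x v : E) (w : {ptws 'I_k -> E}),
     U x -> tderivable (fun y => diffn f (y, w)) x v) /\
  (forall k : nat, (k <= n)%N ->
     {within U `*` [set: {ptws 'I_k -> E}],
       continuous (fun p => diffn f p : F)}).

Definition Csmooth U f : Prop := forall n : nat, Cn n U f.

(* Smoothness on an arbitrary subset of E: local extendability to smooth maps
   on open sets. Besides subsets of R^d, it applies to subsets of R^d * E where
   only the first factor has corners. *)
Definition smooth_on A f : Prop :=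
  forall x, A x -> exists (U : set E) (g : E -> F),
    [/\ open U, U x, Csmooth U g & forall y, A y -> U y -> f y = g y].

Lemma ddir_local V f g x v :
  open V -> (forall y, V y -> f y = g y) -> V x -> ddir f x v `<=` ddir g x v.
Proof.
move=> oV fg Vx l; rewrite /ddir /=; apply: cvg_trans.
apply: near_eq_cvg.
have c : (x + h *: v) @[h --> (0 : R)^'] --> x.
  have h0 : (x + h *: v) @[h --> (0 : R)] --> x.
    rewrite -[X in _ --> X]addr0 -[X in x + X](scale0r v).
    apply: (@cvg_comp _ _ _ (fun h : R => (x, h *: v)) (fun z => z.1 + z.2)
      _ (nbhs (x, (0 : R) *: v))); last first.
      exact: (@tvs.add_continuous E (x, (0 : R) *: v)).
    apply: cvg_pair; first exact: cvg_cst.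
    apply: (@cvg_comp _ _ _ (fun h : R => (h : R^o, v)) (fun z => z.1 *: z.2)
      _ (nbhs (0 : R^o, v))); last first.
      exact: (@tvs.scale_continuous R E ((0 : R^o), v)).
    apply: (@cvg_pair R R^o E _ (nbhs (0 : R^o)) (nbhs v)).
      exact: cvg_id.
    exact: cvg_cst.
  by apply: cvg_trans h0; apply: cvg_app; exact: cvg_within.
have nV : \forall h \near (0 : R)^', V (x + h *: v).
  by apply: c; apply: open_nbhs_nbhs.
by apply: filterS nV => h Vh /=; rewrite (fg _ Vh) (fg _ Vx).
Qed.

Lemma diffn_local V f g (k : nat) (p : E * {ptws 'I_k -> E}) :
  open V -> (forall y, V y -> f y = g y) -> V p.1 -> diffn f p = diffn g p.
Proof.
move=> oV fg; rewrite /diffn.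
move: p.1; elim: [seq p.2 i | i : 'I_k] f g fg => [|v s IH] f g fg x Vx /=.
  exact: fg.
apply: IH => // y Vy; rewrite /tderive; congr (xget _ _).
apply/seteqP; split; apply: (@ddir_local V) => // z Vz; rewrite fg//.
Qed.

(* On an open set, [smooth_on] is the usual smoothness. *)
Lemma smooth_on_open U f : open U -> smooth_on U f <-> Csmooth U f.
Proof.
move=> oU; split=> [sf n|sf x Ux]; last by exists U, f; split.
split=> [k kn x v w Ux|k kn].
  have [V [g [oV Vx sg fg]]] := sf _ Ux.
  have oUV : open (U `&` V) by exact: openI.
  have [l lP] := (sg n).1 k kn x v w Vx.
  exists l; apply: (@ddir_local (U `&` V)) lP => // y [Uy Vy].
  by apply: (@diffn_local (U `&` V)) => // z [Uz Vz]; rewrite fg.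
have oP (W : set E) : open W -> open (W `*` [set: {ptws 'I_k -> E}]).
  move=> oW; rewrite (_ : _ `*` _ = fst @^-1` W).
    by apply: open_comp => // z _; exact: cvg_fst.
  by apply/seteqP; split=> z //= [].
rewrite continuous_open_subspace; last exact: oP.
move=> p; rewrite inE => -[/= Up _].
have [V [g [oV Vp sg fg]]] := sf _ Up.
have := (sg n).2 k kn; rewrite continuous_open_subspace; last exact: oP.
move=> /(_ p); rewrite inE => /(_ (conj Vp I)) gp.
have fgq (q : E * {ptws 'I_k -> E}) : (U `&` V) q.1 -> diffn f q = diffn g q.
  apply: diffn_local; [exact: openI|by move=> y [Uy Vy]; exact: fg].
rewrite /continuous_at fgq //; apply: cvg_trans gp; apply: near_eq_cvg.
have : nbhs p ((U `&` V) `*` [set: {ptws 'I_k -> E}]).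
  by apply: open_nbhs_nbhs; split=> //; apply: oP; exact: openI.
by apply: filterS => q [/fgq ->].
Qed.

End Calculus.

(* A partial bijection between X and Y. The total functions [fwd] and [bwd]
   are meaningful on [dom] and [img] only. *)
Record pbij (X Y : Type) := Pbij {
  dom : set X;
  img : set Y;
  fwd : X -> Y;
  bwd : Y -> X }.

Record is_phomeo (X Y : topologicalType) (c : pbij X Y) : Prop := {
  phomeo_fwd : forall x, dom c x -> img c (fwd c x);
  phomeo_bwd : forall y, img c y -> dom c (bwd c y);
  phomeo_fwdK : forall x, dom c x -> bwd c (fwd c x) = x;
  phomeo_bwdK : forall y, img c y -> fwd c (bwd c y) = y;
  phomeo_fwd_continuous : {within dom c, continuous (fwd c)};
  phomeo_bwd_continuous : {within img c, continuous (bwd c)} }.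

Definition prod_pbij (X Y X' Y' : Type) (c : pbij X Y) (c' : pbij X' Y') :
    pbij (X * X') (Y * Y') :=
  {| dom := dom c `*` dom c';
     img := img c `*` img c';
     fwd := fun x => (fwd c x.1, fwd c' x.2);
     bwd := fun y => (bwd c y.1, bwd c' y.2) |}.

Definition comp_pbij (X Y Z : Type) (t : pbij X Y) (c : pbij Y Z) : pbij X Z :=
  {| dom := dom t `&` fwd t @^-1` dom c;
     img := img c `&` bwd c @^-1` img t;
     fwd := fwd c \o fwd t;
     bwd := bwd t \o bwd c |}.

(* Charts take values in relatively open subsets of a model set A: the whole
   space for manifolds without boundary, [orthant] for manifolds with
   corners. *)
Record is_atlas (R : realType) (X : topologicalType) (E : tvsType R)
    (A : set E) (C : set (pbij X E)) : Prop := {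
  atlas_phomeo : forall c, C c -> is_phomeo c;
  atlas_dom_open : forall c, C c -> open (dom c);
  atlas_img_open : forall c, C c -> exists2 W, open W & img c = A `&` W;
  atlas_cover : forall x, exists2 c, C c & dom c x;
  atlas_compatible : forall c c', C c -> C c' ->
    smooth_on (img c `&` bwd c @^-1` dom c') (fwd c' \o bwd c) }.

Definition prod_atlas (R : realType) (X Y : Type) (E F : tvsType R)
    (C : set (pbij X E)) (D : set (pbij Y F)) : set (pbij (X * Y) (E * F)) :=
  [set prod_pbij c d | c in C & d in D].

(* Smoothness of f on an open set U, with respect to the atlases C and D. *)
Definition smooth_map (R : realType) (X Y : topologicalType) (E F : tvsType R)
    (C : set (pbij X E)) (D : set (pbij Y F)) (U : set X) (f : X -> Y) : Prop :=
  {within U, continuous f} /\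
  forall c d, C c -> D d ->
    smooth_on (img c `&` bwd c @^-1` (U `&` f @^-1` dom d))
              (fwd d \o f \o bwd c).

Definition locally_finite (X : topologicalType) (D : set (set X)) : Prop :=
  forall x : X, exists2 N, nbhs x N & finite_set [set V | D V /\ V `&` N !=set0].

Definition open_cover (X : topologicalType) (C : set (set X)) : Prop :=
  (forall U, C U -> open U) /\ forall x, exists2 U, C U & U x.

Definition paracompact (X : topologicalType) : Prop :=
  forall C : set (set X), open_cover C -> exists D : set (set X),
    [/\ open_cover D,
        forall V, D V -> exists2 U, C U & V `<=` U
      & locally_finite D].

Definition orthant (R : realType) (d : nat) : set 'rV[R]_d :=
  [set x | forall i, 0 <= x ord0 i].

Record cornerManifold (R : realType) (d : nat) := CornerManifold {
  cm_space :> topologicalType;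
  cm_atlas : set (pbij cm_space 'rV[R]_d);
  cm_hausdorff : hausdorff_space cm_space;
  cm_paracompact : paracompact cm_space;
  cm_atlasP : is_atlas (@orthant R d) cm_atlas }.
Arguments cm_atlas {R d} c.

#[short(type="preTopologicalGroupType")]
HB.structure Definition PreTopologicalGroup :=
  {K of Group K & Topological K}.

Record lieGroup (R : realType) (E : tvsType R) := LieGroup {
  lg_group :> preTopologicalGroupType;
  lg_atlas : set (pbij lg_group E);
  lg_hausdorff : hausdorff_space lg_group;
  lg_atlasP : is_atlas [set: E] lg_atlas;
  lg_mul_smooth : smooth_map (prod_atlas lg_atlas lg_atlas) lg_atlas setT
    (fun x : lg_group * lg_group => (x.1 * x.2)%g);
  lg_inv_smooth : smooth_map lg_atlas lg_atlas setT
    (fun x : lg_group => (x^-1)%g) }.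
Arguments lg_atlas {R E} l.

Record is_trivialization (K : preTopologicalGroupType) (M P : topologicalType)
    (act : P -> K -> P) (proj : P -> M) (U : set M) (t : pbij P (M * K)) :
    Prop := {
  triv_open : open U;
  triv_dom : dom t = proj @^-1` U;
  triv_img : img t = U `*` [set: K];
  triv_phomeo : is_phomeo t;
  triv_fst : forall p, dom t p -> (fwd t p).1 = proj p;
  triv_act : forall p k, dom t p ->
    dom t (act p k) /\ fwd t (act p k) = ((fwd t p).1, ((fwd t p).2 * k)%g) }.

(* In the two structures below a locally trivial cover, with its local
   trivializations, is a set of pairs (U, t). *)
Definition is_trivializing (K : preTopologicalGroupType)
    (M P : topologicalType) (act : P -> K -> P) (proj : P -> M)
    (T : set (set M * pbij P (M * K))) : Prop :=
  (forall t, T t -> is_trivialization act proj t.1 t.2) /\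
  forall x, exists2 t, T t & t.1 x.

Record principalBundle (K : preTopologicalGroupType) (M : topologicalType) :=
    PrincipalBundle {
  pb_space :> topologicalType;
  pb_act : pb_space -> K -> pb_space;
  pb_proj : pb_space -> M;
  pb_act1 : forall p, pb_act p 1%g = p;
  pb_actM : forall p k l, pb_act p (k * l)%g = pb_act (pb_act p k) l;
  pb_act_continuous :
    continuous (fun pk : pb_space * K => pb_act pk.1 pk.2);
  pb_proj_continuous : continuous pb_proj;
  pb_locally_trivial : exists T, is_trivializing pb_act pb_proj T }.
Arguments pb_act {K M p} _ _ : rename.
Arguments pb_proj {K M p} _ : rename.

(* [k] is the transition function k_{ij} from t_i = (U_i, Omega_i) to
   t_j = (U_j, Omega_j); only its values on the overlap matter. *)
Definition is_transition (K : preTopologicalGroupType) (M : topologicalType)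
    (P : principalBundle K M) (ti tj : set M * pbij P (M * K)) (k : M -> K) :
    Prop :=
  forall x, (ti.1 `&` tj.1) x ->
    pb_act (bwd ti.2 (x, 1%g)) (k x) = bwd tj.2 (x, 1%g).

(* A smooth bundle comes with the choice of local trivializations that makes
   its transition functions smooth: the smooth structure on the total space
   depends on it. *)
Record smoothBundle (R : realType) (d : nat) (E : tvsType R)
    (K : lieGroup E) (M : cornerManifold R d) := SmoothBundle {
  sb_bundle :> principalBundle K M;
  sb_triv : set (set M * pbij sb_bundle (M * K));
  sb_trivP : is_trivializing (@pb_act _ _ sb_bundle) (@pb_proj _ _ sb_bundle)
      sb_triv;
  sb_smooth : forall ti tj, sb_triv ti -> sb_triv tj ->
    exists k : M -> K, is_transition ti tj k /\
      smooth_map (cm_atlas M) (lg_atlas K) (ti.1 `&` tj.1) k }.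
Arguments sb_triv {R d E K M} s.

(* The smooth structure on the total space for which the chosen local
   trivializations are diffeomorphisms: charts of M * K are pulled back along
   them. *)
Definition sb_atlas (R : realType) (d : nat) (E : tvsType R)
    (K : lieGroup E) (M : cornerManifold R d) (P : smoothBundle K M) :
    set (pbij P ('rV[R]_d * E)) :=
  [set comp_pbij t.2 c
  | t in sb_triv P & c in prod_atlas (cm_atlas M) (lg_atlas K)].
Arguments sb_atlas {R d E K M} P _.

Section Equivalence.
Context {K : preTopologicalGroupType} {M : topologicalType}.

Definition is_bundle_map (P P' : principalBundle K M) (f : P -> P') : Prop :=
  continuous f /\ forall p k, f (pb_act p k) = pb_act (f p) k.

Definition is_bundle_equivalence (P P' : principalBundle K M) (f : P -> P') :
    Prop :=
  [/\ is_bundle_map f,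
      exists2 g : P' -> P, is_bundle_map g & cancel f g /\ cancel g f
    & forall p, pb_proj (f p) = pb_proj p].

Definition continuously_equivalent (P P' : principalBundle K M) : Prop :=
  exists f : P -> P', is_bundle_equivalence f.

End Equivalence.

Definition smoothly_equivalent (R : realType) (d : nat) (E : tvsType R)
    (K : lieGroup E) (M : cornerManifold R d) (P P' : smoothBundle K M) :
    Prop :=
  exists f : P -> P', is_bundle_equivalence f /\
    smooth_map (sb_atlas P) (sb_atlas P') setT f.

(* Main.v *)
Require Import Defs.
From HB Require Import structures.
From mathcomp Require Import all_boot all_order all_algebra.
From mathcomp Require Import all_classical all_reals all_analysis.

Set Implicit Arguments.
Unset Strict Implicit.
Unset Printing Implicit Defensive.

Import Order.TTheory GRing.Theory Num.Theory numFieldNormedType.Exports.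

Local Open Scope classical_set_scope.
Local Open Scope ring_scope.

(** A continuous map into K can be smoothed one small piece at a time, and on a
    small piece, read in a chart of K, it is a map psi into the locally convex
    space E, where convex combinations exist. If psi is smooth near a closed
    set C, cover the part of a compact set A on which psi is not yet smooth by
    finitely many small neighbourhoods and replace psi, one neighbourhood after
    the other, by (1 - chi) psi + chi c, with a cut-off function chi equal to 1
    near the centre and c the value of the original map at the centre. Where
    chi = 1 the new map is constant, and where psi was smooth it stays smooth.
    Every intermediate value is a convex combination of the original value and
    of constants close to it, so that the graph stays in a given neighbourhood
    of the original graph, however many steps are made ([smoothing_vector]).

    A vertical map, i.e. a bundle map f : P -> P' over the identity of M, is
    given over the overlap of two trivializations by a map into K. Hence f can
    be smoothed over a compact set which this map sends into one chart
    ([smoothing_in_chart]). An arbitrary compact set A is a finite union of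
    such pieces. Smoothing over one piece changes f over the other ones too,
    but the condition that f sends each piece into its chart is an open
    condition on the graph of f, and the previous lemma preserves it. So f can
    be made smooth near A without any change over a closed set near which it
    was smooth ([smoothing_near_compact]).

    As M is connected and paracompact, it is covered by the interiors of
    countably many compact sets A_n ([countable_compact_cover]). If P and P' are
    smooth and f is a continuous equivalence, smooth f near A_0, then near A_1
    without change over A_0, and so on: locally the resulting sequence is
    eventually constant, and its limit is a smooth equivalence
    ([smoothing_vertical_map]).

    If P is only continuous, a smooth structure is built on P itself, so that
    the identity is the equivalence. Suppose that trivializations with smooth
    transition functions are given over a neighbourhood of
    C = A_0 u ... u A_(n-1), and let t be a continuous trivialization over A_n.
    Both t and the given ones are smooth structures near the intersection of C
    and A_n. By [smoothing_near_compact] for f = id there is a continuous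
    automorphism of P that is smooth from the one to the other near this
    intersection; transporting t by it makes t smoothly compatible with the
    given trivializations ([smooth_family_extend], [exists_smooth_family]).

    The calculus needed is the chain rule for maps between locally convex
    spaces. It is proved for the recursive notion: f is C^(n+1) if it is
    continuous, its directional derivatives exist, and df is C^n. The chain
    rule for df rests on strict differentiability ([strict_deriv]), a
    consequence of a mean value theorem with values in convex sets
    ([mean_value]). The two notions of smoothness agree ([Csmooth_recCn],
    [recCn_Csmooth]) since the iterated derivatives are multilinear in the
    directions. *)

(** * Limits in locally convex spaces *)

Section TvsLimits.
Context {R : realType} {E : tvsType R} {T : Type} {F : set_system T}.
Context {FF : Filter F}.
Implicit Types (f g : T -> E) (k : T -> R).

Lemma tcvgD f g a b :
  f @ F --> a -> g @ F --> b -> (f x + g x) @[x --> F] --> a + b.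
Proof.
by move=> fa gb; apply: continuous2_cvg fa gb;
  exact: (@tvs.add_continuous E (a, b)).
Qed.

Lemma tcvgN f a : f @ F --> a -> (- f x) @[x --> F] --> - a.
Proof. by move=> fa; apply: continuous_cvg fa; exact: tvs.opp_continuous. Qed.

Lemma tcvgB f g a b :
  f @ F --> a -> g @ F --> b -> (f x - g x) @[x --> F] --> a - b.
Proof. by move=> fa gb; apply: tcvgD => //; exact: tcvgN. Qed.

Lemma tcvgZ k f (c : R) a :
  k @ F --> c -> f @ F --> a -> (k x *: f x) @[x --> F] --> c *: a.
Proof.
move=> kc fa.
apply: (@continuous2_cvg T R^o E E F FF k f (fun z : R => *:%R z) c a) => //.
exact: (@tvs.scale_continuous R E (c, a)).
Qed.

End TvsLimits.

Section Hausdorff.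

Lemma hausdorff_prod (X Y : topologicalType) :
  hausdorff_space X -> hausdorff_space Y -> hausdorff_space (X * Y)%type.
Proof.
move=> hX hY [x y] [x' y'] cl; congr pair.
  apply: hX => A B Ax Bx'.
  have [] := cl (A `*` setT) (B `*` setT).
  - by exists (A, setT) => //; split => //=; exact: filterT.
  - by exists (B, setT) => //; split => //=; exact: filterT.
  by move=> -[u v] [[/= Au _] [/= Bu _]]; exists u.
apply: hY => A B Ay By'.
have [] := cl (setT `*` A) (setT `*` B).
- by exists (setT, A) => //; split => //=; exact: filterT.
- by exists (setT, B) => //; split => //=; exact: filterT.
by move=> -[u v] [[/= _ Av] [/= _ Bv]]; exists v.
Qed.

End Hausdorff.

Section ConvexSets.
Context {R : realType} {E : tvsType R}.

Definition convex_subset (B : set E) : Prop := forall (a b : E) (t : R),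
  B a -> B b -> 0 <= t -> t <= 1 -> B (t *: a + (1 - t) *: b).

Lemma nbhs_convex_subset (x : E) (A : set E) : nbhs x A ->
  exists B : set E, [/\ convex_subset B, open B, B x & B `<=` A].
Proof.
move=> xA; have [Bs cB [oB bB]] := @locally_convex R E.
have [B [BsB Bx] BA] := bB x A xA.
exists B; split => //; last exact: oB.
move=> a b t Ba Bb t0 t1.
have := cB B (mem_set BsB) a b (@Itv01 _ t t0 t1) (mem_set Ba) (mem_set Bb).
by move/set_mem.
Qed.

End ConvexSets.

(** * A mean value theorem with values in convex sets *)

Section MeanValue.
Context {R : realType} {F : tvsType R}.

(** The set of the t for which the slope of c between 0 and t lies in B is
    closed under passing to its supremum s and beyond it: for a <= s <= b close
    to s, the slopes between a and s and between s and b are close to c' s, and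
    slopes over adjacent intervals combine convexly. *)
Lemma mean_value (c c' : R -> F) (B : set F) : convex_subset B ->
  (forall s, 0 <= s <= 1 ->
    (h^-1 *: (c (s + h) - c s)) @[h --> (0 : R)^'] --> c' s) ->
  (forall s, 0 <= s <= 1 -> nbhs (c' s) B) -> B (c 1 - c 0).
Proof.
move=> cB dc nB.
pose slope a b := (b - a)^-1 *: (c b - c a).
have slopeE a b : a != b -> slope a b = (a - b)^-1 *: (c a - c b).
  move=> ab; rewrite /slope -(opprB (c a)) -(opprB a b) invrN scalerN scaleNr.
  by rewrite opprK.
have loc s : 0 <= s <= 1 -> exists2 e : R, 0 < e &
    forall h, `|h| < e -> h != 0 -> B (slope s (s + h)).
  move=> s01; have := dc s s01 _ (nB s s01).
  move=> -[e /= e0 He]; exists e => // h he h0; rewrite /slope.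
  have -> : s + h - s = h by rewrite addrAC subrr add0r.
  by apply: He => //=; rewrite sub0r normrN.
pose S := [set t : R | 0 <= t <= 1 /\ (t = 0 \/ B (slope 0 t))].
have S0 : S 0 by split; [rewrite lexx ler01|left].
have ubS : ubound S 1 by move=> t [/andP[_ t1] _].
have hs : has_sup S by split; [exists 0|exists 1].
have s01 : 0 <= sup S <= 1.
  by rewrite (ub_le_sup hs.2 S0) ge_sup//; exists 0.
have [e e0 He] := loc _ s01.
have combine a b : 0 <= a -> a < b -> a = 0 \/ B (slope 0 a) ->
    B (slope a b) -> B (slope 0 b).
  move=> a0 ab [->//|Ba] Bb.
  have b0 : 0 < b by exact: le_lt_trans ab.
  have [a0'|a0'] := eqVneq a 0; first by rewrite -{1}a0'.
  have := cB _ _ (a / b) Ba Bb.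
  have ab1 : a / b <= 1 by rewrite ler_pdivrMr// mul1r ltW.
  have ab0 : 0 <= a / b by rewrite divr_ge0// ltW.
  move=> /(_ ab0 ab1); rewrite /slope !subr0 !scalerA.
  have -> : a / b / a = b^-1 by rewrite mulrAC divff// mul1r.
  have -> : (1 - a / b) / (b - a) = b^-1.
    have -> : 1 - a / b = (b - a) / b by rewrite mulrBl divff// gt_eqF.
    by rewrite mulrAC divff ?mul1r// subr_eq0 gt_eqF.
  by rewrite -scalerDr [X in _ *: X]addrC subrKA.
have Ss : S (sup S).
  split => //; have [a Sa ae] := sup_adherent e0 hs.
  have [/andP[a0 a1] Ba] := Sa.
  have as_ : a <= sup S by exact: (ub_le_sup hs.2).
  move: as_; rewrite le_eqVlt => /orP[/eqP<-//|as_].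
  right; apply: (combine a) => //.
  rewrite slopeE ?lt_eqF//.
  have -> : a = sup S + (a - sup S) by rewrite addrC subrK.
  apply: He; last by rewrite subr_eq0 lt_eqF.
  by rewrite distrC gtr0_norm ?subr_gt0// ltrBlDr -ltrBlDl.
have {Ss} [_ Bs] := Ss.
have : sup S = 1.
  apply/eqP; rewrite eq_le (andP s01).2/= leNgt; apply/negP => s1.
  pose h := Num.min (e / 2) (1 - sup S).
  have h0 : 0 < h by rewrite lt_min divr_gt0//= subr_gt0.
  have : S (sup S + h).
    split.
      rewrite addr_ge0 ?(andP s01).1 ?(ltW h0)//=.
      by rewrite -lerBrDl ge_min lexx orbT.
    right; apply: (combine (sup S)) => //; first exact: (andP s01).1.
      by rewrite ltrDl.
    apply: He; last by rewrite gt_eqF.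
    rewrite gtr0_norm// gt_min; apply/orP; left.
    by rewrite ltr_pdivrMr// ltr_pMr// ltr1n.
  by move/(ub_le_sup hs.2); rewrite leNgt ltrDl h0.
move=> s1; rewrite s1 in Bs; case: Bs => [/eqP|]; first by rewrite oner_eq0.
by rewrite /slope subr0 invr1 scale1r.
Qed.

End MeanValue.

(** * Strict differentiability *)

Section Strict.
Context {R : realType} {E F : tvsType R}.
Implicit Types (f : E -> F) (U : set E) (x v : E).

Lemma ddir_unique f x v l l' : hausdorff_space F ->
  ddir f x v l -> ddir f x v l' -> l = l'.
Proof. by move=> hF /= h1 h2; exact: (@cvg_unique _ hF _ _ _ _ h1 h2). Qed.

Lemma tderiveE f x v l : hausdorff_space F -> ddir f x v l ->
  tderive f x v = l.
Proof.
move=> hF h; apply: (ddir_unique hF _ h); rewrite /tderive.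
by case: xgetP => [y -> //|/(_ l)].
Qed.

Lemma tderivableP f x v : tderivable f x v -> ddir f x v (tderive f x v).
Proof. by move=> [l lP]; rewrite /tderive; case: xgetP => [y -> //|/(_ l)]. Qed.

(** The difference quotient is the increment over [0, 1] of the curve
    s |-> f (y + s t q) / t, whose derivative df (y + s t q, q) is close to
    df (x, v); by continuity of the latter, convexity gives the bound uniformly
    in y, q and t. *)
Lemma strict_deriv f U (G : E * E -> F) x v (B : set F) :
  open U -> U x -> (forall y w, U y -> ddir f y w (G (y, w))) ->
  {for (x, v), continuous G} -> nbhs (G (x, v)) B ->
  exists (N1 N2 : set E) (e : R), [/\ nbhs x N1, nbhs v N2, 0 < e &
    forall y q t, N1 y -> N2 q -> `|t| < e -> t != 0 ->
      B (t^-1 *: (f (y + t *: q) - f y))].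
Proof.
move=> oU Ux fG cG /nbhs_convex_subset[C [cC oC CG CB]].
have : nbhs (x, v) (G @^-1` C) by apply: cG; exact: open_nbhs_nbhs.
move=> -[[A1 A2] /= [xA1 vA2] A12].
have : (p.1.1 + p.2 *: p.1.2) @[p --> nbhs ((x, v), (0 : R^o))] --> x.
  rewrite -[X in _ --> X]addr0 -[X in _ + X](scale0r v).
  apply: tcvgD; first exact: (cvg_comp _ fst cvg_fst cvg_fst).
  apply: (@tcvgZ R E _ _ _ (fun p : E * E * R^o => p.2)); first exact: cvg_snd.
  exact: (cvg_comp _ snd cvg_fst cvg_snd).
have xA1U : nbhs x (A1 `&` U).
  by apply: filterI => //; exact: open_nbhs_nbhs.
move=> /(_ _ xA1U)[[N3 N4] /= [[[N1 N2] /= [xN1 vN2] N12] [e /= e0 eN4]] N34].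
exists N1, (N2 `&` A2), e; split => //; first exact: filterI.
move=> y q t N1y [N2q A2q] te t0; apply: CB.
have key s : 0 <= s <= 1 -> (A1 `&` U) (y + (s * t) *: q).
  move=> /andP[s0 s1]; apply: (N34 ((y, q), s * t)); split => /=.
    exact: (N12 (y, q)).
  apply: eN4 => /=; rewrite sub0r normrN normrM ger0_norm//.
  by apply: le_lt_trans te; rewrite ler_piMl.
pose c s := t^-1 *: f (y + (s * t) *: q).
have := @mean_value R F c (fun s => G (y + (s * t) *: q, q)) C cC.
rewrite /c mul1r mul0r scale0r addr0 -scalerBr; apply; last first.
  move=> s /key[A1s _]; apply: open_nbhs_nbhs; split => //.
  exact: (A12 (_, _)).
move=> s /key[_ Us].
have ht : (h * t) @[h --> (0 : R)^'] --> (0 : R)^'.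
  move=> A [r /= r0 rA]; exists (r / `|t|) => /=.
    by rewrite divr_gt0// normr_gt0.
  move=> h /=; rewrite sub0r normrN => hr h0; apply: rA.
    by rewrite /= sub0r normrN normrM -ltr_pdivlMr// normr_gt0.
  by rewrite mulf_neq0.
have := cvg_comp _ _ ht (fG _ q Us).
apply: cvg_trans; apply: near_eq_cvg.
near=> h.
rewrite /= invfM -scalerBr scalerA; congr (_ *: (f _ - _)).
by rewrite -addrA -scalerDl mulrDl.
Unshelve. all: by end_near. Qed.

Lemma strict_cvg f U (G : E * E -> F) x v (T : Type) (Q : set_system T)
    (y q : T -> E) (t : T -> R) : Filter Q ->
  open U -> U x -> (forall y w, U y -> ddir f y w (G (y, w))) ->
  {for (x, v), continuous G} ->
  y @ Q --> x -> q @ Q --> v -> t @ Q --> (0 : R)^' ->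
  ((t i)^-1 *: (f (y i + t i *: q i) - f (y i))) @[i --> Q] --> G (x, v).
Proof.
move=> FQ oU Ux fG cG yx qv t0 B nB.
have [N1 [N2 [e [xN1 vN2 e0 H]]]] := strict_deriv oU Ux fG cG nB.
have n1 : \forall i \near Q, N1 (y i) := yx _ xN1.
have n2 : \forall i \near Q, N2 (q i) := qv _ vN2.
have n3 : \forall i \near Q, `|t i| < e /\ t i != 0.
  apply: (t0 [set h | `|h| < e /\ h != 0]).
  by exists e => // h /=; rewrite sub0r normrN => he h0.
apply: (filterS _ (filterI n1 (filterI n2 n3))) => i [N1i [N2i [ti ti0]]].
exact: H.
Qed.

Lemma ddirZ f x v l (a : R) : ddir f x v l -> ddir f x (a *: v) (a *: l).
Proof.
have [->|a0] := eqVneq a 0.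
  rewrite !scale0r => _; rewrite /ddir /=.
  apply: cvg_near_cst; near=> h.
  by rewrite scaler0 addr0 subrr scaler0.
move=> h /=; rewrite /ddir /=.
have ha : (h * a) @[h --> (0 : R)^'] --> (0 : R)^'.
  move=> A [r /= r0 rA]; exists (r / `|a|) => /=.
    by rewrite divr_gt0// normr_gt0.
  move=> k /=; rewrite sub0r normrN => hr h0; apply: rA.
    by rewrite /= sub0r normrN normrM -ltr_pdivlMr// normr_gt0.
  by rewrite mulf_neq0.
have hc := cvg_comp _ _ ha h.
have ac : (fun=> a) @ (0 : R)^' --> (a : R) by exact: cvg_cst.
apply: cvg_trans (tcvgZ ac hc); apply: near_eq_cvg; near=> k.
by rewrite /= scalerA invfM mulrCA divff// mulr1 scalerA.
Unshelve. all: by end_near. Qed.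

Lemma cvg_dnbhs0 : (h : R) @[h --> (0 : R)^'] --> (0 : R).
Proof. exact: cvg_within. Qed.

Lemma cvg_line x v : (x + h *: v) @[h --> (0 : R)^'] --> x.
Proof.
rewrite -[X in _ --> X]addr0 -[X in _ + X](scale0r v).
apply: tcvgD; first exact: cvg_cst.
by apply: tcvgZ; [exact: cvg_dnbhs0|exact: cvg_cst].
Qed.

(** A continuous directional derivative is additive in the direction, since
    the increment along u + v splits into two increments whose base points
    both tend to x. *)
Lemma ddirD f U (G : E * E -> F) x u v : hausdorff_space F ->
  open U -> U x -> (forall y w, U y -> ddir f y w (G (y, w))) ->
  (forall p, U p.1 -> {for p, continuous G}) ->
  G (x, u + v) = G (x, u) + G (x, v).
Proof.
move=> hF oU Ux fG cG; apply: (ddir_unique hF (fG _ _ Ux)).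
rewrite /ddir /=.
have h1 := fG x u Ux.
have h2 : (h^-1 *: (f ((x + h *: u) + h *: v) - f (x + h *: u)))
     @[h --> (0 : R)^'] --> G (x, v).
  apply: (strict_cvg (y := fun h : R => x + h *: u) (q := fun=> v)
    (t := fun h => h) _ oU) => //; first exact: cG.
  - exact: cvg_line.
  - exact: cvg_cst.
apply: cvg_trans (tcvgD h1 h2); apply: near_eq_cvg; near=> h.
by rewrite /= -scalerDr addrC subrKA [h *: (u + v)]scalerDr addrA.
Unshelve. all: by end_near. Qed.

End Strict.

(** * The recursive notion of C^n maps *)

(** Compared with the continuity of the maps (x, v_1, ..., v_k) |->
    d^k f(x).(v_1, ..., v_k), this form makes composition easy: the derivative
    of f \o g is a composite of df with a map built from g and dg. *)
Fixpoint recCn {R : realType} (n : nat) {E F : tvsType R} (U : set E)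
  (f : E -> F)
    : Prop :=
  (forall x, U x -> {for x, continuous f}) /\
  if n is n'.+1 then
    (forall x v, U x -> tderivable f x v) /\
    recCn n' (U `*` setT) (fun p : E * E => tderive f p.1 p.2)
  else True.

Section RecursiveCn.
Context {R : realType}.
Implicit Types E F G : tvsType R.

Lemma openXT (X Y : topologicalType) (U : set X) :
  open U -> open (U `*` [set: Y]).
Proof.
move=> oU; rewrite (_ : _ `*` _ = fst @^-1` U).
  by apply: open_comp => // z _; exact: cvg_fst.
by apply/seteqP; split=> z //= [].
Qed.

Lemma near_eq_continuous (X Y : topologicalType) (f g : X -> Y) x :
  (\forall y \near x, f y = g y) -> {for x, continuous f} ->
  {for x, continuous g}.
Proof.
move=> fg cf; have fgx : f x = g x by apply: nbhs_singleton fg.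
rewrite /prop_for /continuous_at -fgx.
by apply: cvg_trans cf; apply: near_eq_cvg.
Qed.

Lemma open_eq_continuous (X Y : topologicalType) (U : set X) (f g : X -> Y) x :
  open U -> U x -> (forall y, U y -> f y = g y) ->
  {for x, continuous f} -> {for x, continuous g}.
Proof.
move=> oU Ux fg; apply: near_eq_continuous.
have : nbhs x U by apply: open_nbhs_nbhs.
by apply: filterS => y; exact: fg.
Qed.

Lemma recCn_continuous n E F (U : set E) (f : E -> F) x :
  recCn n U f -> U x -> {for x, continuous f}.
Proof. by case: n => [|n] [h _]; exact: h. Qed.

Lemma recCn_eq n E F (U : set E) (f g : E -> F) : open U ->
  (forall x, U x -> f x = g x) -> recCn n U f -> recCn n U g.
Proof.
elim: n E F U f g => [|n IH] E F U f g oU fg [cf df].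
  by split=> // x Ux; exact: (open_eq_continuous oU Ux fg) (cf _ Ux).
have fgl x v : U x -> ddir f x v = ddir g x v.
  move=> Ux; apply/seteqP; split; apply: (ddir_local oU) => // y Uy.
  by rewrite fg.
split=> [x Ux|]; first exact: (open_eq_continuous oU Ux fg) (cf _ Ux).
split=> [x v Ux|]; first by rewrite /tderivable -fgl//; exact: df.1.
apply: IH df.2; first exact: openXT.
by move=> [x v] [/= Ux _]; rewrite /tderive fgl.
Qed.

Lemma recCn_sub n E F (U V : set E) (f : E -> F) :
  V `<=` U -> recCn n U f -> recCn n V f.
Proof.
elim: n E F U V f => [|n IH] E F U V f VU [cf df].
  by split=> // x /VU; exact: cf.
split=> [x /VU|]; first exact: cf.
split=> [x v /VU|]; first exact: df.1.
by apply: IH df.2 => -[x v] [/= /VU].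
Qed.

Lemma recCn_Sn n E F (U : set E) (f : E -> F) : recCn n.+1 U f -> recCn n U f.
Proof.
elim: n E F U f => [|n IH] E F U f [cf df]; first by split.
by split=> //; split; [exact: df.1|exact: IH df.2].
Qed.

(** In an induction on n, a candidate G for the derivative is known by a
    formula, and tderive agrees with it on the open set only. *)
Lemma recCn_intro n E F (U : set E) (f : E -> F) (G : E * E -> F) :
  hausdorff_space F -> open U ->
  (forall x, U x -> {for x, continuous f}) ->
  (forall x v, U x -> ddir f x v (G (x, v))) ->
  recCn n (U `*` setT) G -> recCn n.+1 U f.
Proof.
move=> hF oU cf fG bG; split=> //; split=> [x v Ux|].
  by exists (G (x, v)); exact: fG.
apply: recCn_eq bG; first exact: openXT.
by move=> [x v] [/= Ux _]; rewrite (tderiveE hF (fG _ _ Ux)).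
Qed.

Lemma recCn_ddir n E F (U : set E) (f : E -> F) x : recCn n.+1 U f -> U x ->
  forall v, ddir f x v (tderive f x v).
Proof. by move=> [_ [df _]] Ux v; apply: tderivableP; exact: df. Qed.

Lemma recCn_deriv n E F (U : set E) (f : E -> F) : recCn n.+1 U f ->
  recCn n (U `*` setT) (fun p : E * E => tderive f p.1 p.2).
Proof. by case=> _ []. Qed.

Lemma recCn_cst n E F (U : set E) (c : F) : hausdorff_space F -> open U ->
  recCn n U (fun=> c).
Proof.
elim: n E U c => [|n IH] E U c hF oU.
  by split=> // x _; exact: cvg_cst.
apply: (@recCn_intro _ _ _ _ _ (fun=> 0)) => //.
- by move=> x _; exact: cvg_cst.
- move=> x v _; rewrite /ddir /=; under eq_fun do rewrite subrr scaler0.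
  exact: cvg_cst.
- by apply: IH => //; exact: openXT.
Qed.

Definition clinear E F (L : E -> F) : Prop :=
  (forall (a : R) x y, L (a *: x + y) = a *: L x + L y) /\ continuous L.

Lemma clinear0 E F (L : E -> F) : clinear L -> L 0 = 0.
Proof.
move=> [lin _]; have := lin (-1) 0 0.
by rewrite scaler0 addr0 scaleN1r addNr.
Qed.

Lemma clinearD E F (L : E -> F) x y : clinear L -> L (x + y) = L x + L y.
Proof. by move=> [lin _]; have := lin 1 x y; rewrite !scale1r. Qed.

Lemma clinearZ E F (L : E -> F) a x : clinear L -> L (a *: x) = a *: L x.
Proof.
by move=> cL; rewrite -[X in L X]addr0 cL.1 (clinear0 cL) addr0.
Qed.

Lemma recCn_lin n E F (U : set E) (L : E -> F) : hausdorff_space F -> open U ->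
  clinear L -> recCn n U L.
Proof.
elim: n E U L => [|n IH] E U L hF oU [lin cL].
  by split=> // x _; exact: cL.
apply: (@recCn_intro _ _ _ _ _ (L \o snd)) => //.
- by move=> x _; exact: cL.
- move=> x v _; rewrite /ddir /=; apply: cvg_near_cst; near=> h.
  rewrite [x + _]addrC lin addrK scalerA mulVf ?scale1r//.
  by near: h; exact: nbhs_dnbhs_neq.
- apply: IH => //; first exact: openXT.
  split=> [a x y|] /=; first by rewrite lin.
  move=> p; apply: (@continuous_comp _ _ _ snd L); first exact: cvg_snd.
  exact: cL.
Unshelve. all: by end_near. Qed.

Lemma clinear_fst E F : clinear (@fst E F).
Proof. by split=> // p; exact: cvg_fst. Qed.

Lemma clinear_snd E F : clinear (@snd E F).
Proof. by split=> // p; exact: cvg_snd. Qed.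

Lemma clinear_comp E F G (L : E -> F) (L' : F -> G) :
  clinear L -> clinear L' -> clinear (L' \o L).
Proof.
move=> [l c] [l' c']; split=> [a x y /=|x]; first by rewrite l l'.
by apply: continuous_comp; [exact: c|exact: c'].
Qed.

Lemma clinear_pair E F G (L : E -> F) (L' : E -> G) :
  clinear L -> clinear L' -> clinear (fun x => (L x, L' x)).
Proof.
move=> [l c] [l' c']; split=> [a x y /=|x]; first by rewrite l l'.
by apply: cvg_pair; [exact: c|exact: c'].
Qed.

Lemma clinear_id E : clinear (@id E).
Proof. by split=> // x; exact: cvg_id. Qed.

Lemma clinear_0 E F : clinear (fun _ : E => 0 : F).
Proof. by split=> [a x y|x]; [rewrite scaler0 addr0|exact: cvg_cst]. Qed.

Lemma recCn_add n E F (U : set E) (f g : E -> F) : hausdorff_space F ->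
  open U ->
  recCn n U f -> recCn n U g -> recCn n U (fun x => f x + g x).
Proof.
elim: n E U f g => [|n IH] E U f g hF oU bf bg.
  by split=> // x Ux; apply: tcvgD; [exact: bf.1|exact: bg.1].
apply: (@recCn_intro _ _ _ _ _
  (fun p : E * E => tderive f p.1 p.2 + tderive g p.1 p.2)) => //.
- by move=> x Ux; apply: tcvgD; [exact: bf.1|exact: bg.1].
- move=> x v Ux; rewrite /ddir /=.
  apply: cvg_trans (tcvgD (recCn_ddir bf Ux (v:=v)) (recCn_ddir bg Ux
    (v:=v))); apply: near_eq_cvg; near=> t.
  by rewrite /= -scalerDr opprD addrACA.
- by apply: IH => //; [exact: openXT|exact: recCn_deriv|exact: recCn_deriv].
Unshelve. all: by end_near. Qed.

Lemma recCn_pair n E F G (U : set E) (f : E -> F) (g : E -> G) :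
  hausdorff_space F -> hausdorff_space G -> open U ->
  recCn n U f -> recCn n U g -> recCn n U (fun x => (f x, g x)).
Proof.
elim: n E U f g => [|n IH] E U f g hF hG oU bf bg.
  by split=> // x Ux; apply: cvg_pair; [exact: bf.1|exact: bg.1].
apply: (@recCn_intro _ _ _ _ _
  (fun p : E * E => (tderive f p.1 p.2, tderive g p.1 p.2))) => //.
- exact: hausdorff_prod.
- by move=> x Ux; apply: cvg_pair; [exact: bf.1|exact: bg.1].
- move=> x v Ux.
  exact: (cvg_pair (recCn_ddir bf Ux (v:=v)) (recCn_ddir bg Ux (v:=v))).
- by apply: IH => //; [exact: openXT|exact: recCn_deriv|exact: recCn_deriv].
Qed.

(** The difference quotient of f \o g at x is the one of f along the moving
    direction (g (x + h v) - g x) / h, so strict differentiability of f gives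
    its limit. *)
Lemma ddir_comp E F G (V : set F) (g : E -> F) (f : F -> G) x v w
    (df : F * F -> G) :
  open V -> V (g x) -> {for x, continuous g} -> ddir g x v w ->
  (forall y w, V y -> ddir f y w (df (y, w))) ->
  {for (g x, w), continuous df} -> ddir (f \o g) x v (df (g x, w)).
Proof.
move=> oV Vx cg dg fd cdf.
have h := strict_cvg (y := fun=> g x)
  (q := fun h : R => h^-1 *: (g (x + h *: v) - g x))
  (t := fun h : R => h) (Q := (0 : R)^') _ oV Vx fd cdf.
rewrite /ddir /=; apply: cvg_trans (h _ (cvg_cst _) dg cvg_id);
  apply: near_eq_cvg; near=> t.
rewrite /= scalerA mulfV; last by near: t; exact: nbhs_dnbhs_neq.
by rewrite scale1r [g x + _]addrC subrK.
Unshelve. all: by end_near. Qed.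

(** The chain rule uses this case for the projection that occurs in
    d(f \o g) = df \o (g \o fst, dg). *)
Lemma recCn_comp_lin n E F G (U : set F) (L : E -> F) (f : F -> G) :
  hausdorff_space G -> open U -> clinear L ->
  recCn n U f -> recCn n (L @^-1` U) (f \o L).
Proof.
elim: n E F U L f => [|n IH] E F U L f hG oU cL bf.
  split=> // x Ux; apply: continuous_comp; first exact: cL.2.
  exact: bf.1.
have oL : open (L @^-1` U) by apply: open_comp => // x _; exact: cL.2.
apply: (@recCn_intro _ _ _ _ _ ((fun p : F * F => tderive f p.1 p.2) \o
   (fun p : E * E => (L p.1, L p.2)))) => //.
- move=> x Ux; apply: continuous_comp; first exact: cL.2.
  exact: bf.1.
- move=> x v Ux; rewrite /ddir /=; apply: cvg_trans (recCn_ddir bf Ux (v:=L v)).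
  apply: near_eq_cvg; near=> h.
  by rewrite /= (clinearD _ _ cL) (clinearZ _ _ cL).
- have -> : (L @^-1` U) `*` setT =
      (fun p : E * E => (L p.1, L p.2)) @^-1` (U `*` setT).
    by apply/seteqP; split=> -[x v] [].
  apply: IH => //; [exact: openXT| |exact: recCn_deriv].
  by apply: clinear_pair; apply: clinear_comp => //;
    [exact: clinear_fst|exact: clinear_snd].
Unshelve. all: by end_near. Qed.

Lemma recCn_comp n E F G (U : set E) (V : set F) (g : E -> F) (f : F -> G) :
  hausdorff_space F -> hausdorff_space G -> open U -> open V ->
  (forall x, U x -> V (g x)) -> recCn n V f -> recCn n U g ->
    recCn n U (f \o g).
Proof.
elim: n E F G U V g f => [|n IH] E F G U V g f hF hG oU oV UV bf bg.
  split=> // x Ux; apply: continuous_comp; first exact: bg.1.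
  by apply: bf.1; exact: UV.
have cdf x w : V x ->
    {for (x, w), continuous (fun p : F * F => tderive f p.1 p.2)}.
  by move=> Vx; apply: (recCn_continuous (recCn_deriv bf)).
apply: (@recCn_intro _ _ _ _ _
  ((fun p : F * F => tderive f p.1 p.2) \o
   (fun p : E * E => (g p.1, tderive g p.1 p.2)))) => //.
- move=> x Ux; apply: continuous_comp; first exact: bg.1.
  by apply: bf.1; exact: UV.
- move=> x v Ux; apply: (@ddir_comp E F G V g f x v (tderive g x v)
    (fun p => tderive f p.1 p.2)) => //.
  + exact: UV.
  + exact: bg.1.
  + exact: (recCn_ddir bg Ux).
  + by move=> y w Vy; exact: (recCn_ddir bf Vy).
  + by apply: cdf; exact: UV.
- apply: (IH _ _ _ (U `*` setT) (V `*` setT)) => //.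
  + exact: hausdorff_prod.
  + exact: openXT.
  + exact: openXT.
  + by move=> [x v] [/= Ux _]; split => //=; exact: UV.
  + exact: recCn_deriv.
  + apply: recCn_pair => //; first exact: openXT.
      have -> : U `*` [set: E] = fst @^-1` U.
        by apply/seteqP; split=> -[x v] //= [].
      apply: (@recCn_comp_lin n _ _ _ U fst g) => //; last exact: recCn_Sn.
      exact: clinear_fst.
    exact: recCn_deriv.
Qed.

End RecursiveCn.

(** * Products with scalar functions *)

Section Scale.
Context {R : realType}.
Implicit Types E F : tvsType R.

Lemma recCn_scale n E F (U : set E) (k : E -> R^o) (f : E -> F) :
  hausdorff_space F -> open U ->
  recCn n U k -> recCn n U f -> recCn n U (fun x => (k x : R) *: f x).
Proof.
elim: n E U k f => [|n IH] E U k f hF oU bk bf.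
  by split=> // x Ux; apply: tcvgZ; [exact: bk.1|exact: bf.1].
apply: (@recCn_intro _ _ _ _ _ _
  (fun p : E * E => (tderive k p.1 p.2 : R) *: f p.1 +
                    (k p.1 : R) *: tderive f p.1 p.2)) => //.
- by move=> x Ux; apply: tcvgZ; [exact: bk.1|exact: bf.1].
- move=> x v Ux; rewrite /ddir /=.
  have fl := cvg_comp _ _ (@cvg_line R E x v) (bf.1 _ Ux).
  have kx : (fun=> (k x : R)) @ (0 : R)^' --> (k x : R) by exact: cvg_cst.
  apply: cvg_trans (tcvgD (tcvgZ (recCn_ddir bk Ux (v:=v)) fl)
    (tcvgZ kx (recCn_ddir bf Ux (v:=v)))); apply: near_eq_cvg; near=> h.
  rewrite /= !scalerBr !scalerBl !scalerA.
  rewrite [_ *: k (x + h *: v)]/GRing.scale/= [_ *: k x]/GRing.scale/=.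
  by rewrite [k x / h]mulrC subrKA.
- have oU' := @openXT E E U oU.
  have e : U `*` [set: E] = fst @^-1` U.
    by apply/seteqP; split=> -[x v] //= [].
  apply: recCn_add => //; apply: IH => //; try exact: recCn_deriv.
    rewrite e; apply: (@recCn_comp_lin _ n _ _ _ U fst f) => //;
      last exact: recCn_Sn.
    exact: clinear_fst.
  rewrite e; apply: (@recCn_comp_lin _ n _ _ _ U fst k) => //;
    last exact: recCn_Sn.
  exact: clinear_fst.
Unshelve. all: by end_near. Qed.

End Scale.

(** * The locally convex space of sequences *)

(** Directions v_1, v_2, ... are kept in one space of sequences, so that all
    the iterated derivatives d^k f are maps on the same space E * seqs E. *)
Definition seqs {R : realType} (E : tvsType R) : Type := nat -> E.

Section Seqs.
Context {R : realType} (E : tvsType R).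

HB.instance Definition _ := Topological.copy (seqs E) {ptws nat -> E}.
HB.instance Definition _ := GRing.Lmodule.copy (seqs E) (nat -> E).

Lemma seqs_cvgP (F : set_system (seqs E)) (w : seqs E) : Filter F ->
  F --> w <-> forall i : nat, (fun u : seqs E => u i) @ F --> w i.
Proof. by move=> FF; exact: (@pointwise_cvgP nat E F w FF). Qed.

Lemma cvg_seqs (T : Type) (F : set_system T) (f : T -> seqs E) (w : seqs E) :
  Filter F -> (forall i, f x i @[x --> F] --> w i) -> f @ F --> w.
Proof. by move=> FF h; apply/seqs_cvgP. Qed.

Lemma continuous_coord (i : nat) : continuous (fun w : seqs E => w i).
Proof. exact: (@proj_continuous nat (fun=> E) i). Qed.

Let seqs_add : continuous (fun x : seqs E * seqs E => x.1 + x.2).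
Proof.
move=> [u v]; apply: cvg_seqs => i /=.
apply: tcvgD.
  exact: (cvg_comp fst (fun w : seqs E => w i) cvg_fst (@continuous_coord i u)).
exact: (cvg_comp snd (fun w : seqs E => w i) cvg_snd (@continuous_coord i v)).
Qed.

Let seqs_scale : continuous (fun z : R^o * seqs E => z.1 *: z.2).
Proof.
move=> [a v]; apply: cvg_seqs => i /=.
apply: tcvgZ; first exact: cvg_fst.
exact: (cvg_comp snd (fun w : seqs E => w i) cvg_snd (@continuous_coord i v)).
Qed.

(** The convex base of the product topology: finitely many coordinates are
    constrained, each by an open convex set. *)
Let cyl (n : nat) (b : nat -> set E) : set (seqs E) :=
  [set w | forall i, (i < n)%N -> b i (w i)].

Let cyl_open n b : (forall i, open (b i)) -> open (cyl n b).
Proof.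
move=> ob; elim: n => [|n IH].
  have -> : cyl 0 b = setT by apply/seteqP; split.
  exact: openT.
have -> : cyl n.+1 b = cyl n b `&` (fun w : seqs E => w n) @^-1` b n;
  last first.
  apply: openI => //; apply: open_comp => // w _; exact: continuous_coord.
apply/seteqP; split=> [w h|w [h hn] i].
  by split=> [i ni|]; apply: h => //; exact: ltnW.
by rewrite ltnS leq_eqVlt => /orP[/eqP->//|]; exact: h.
Qed.

Let seqs_convex : exists2 B : set_system (seqs E),
  (forall b, b \in B -> convex_set b) & basis B.
Proof.
exists [set S | exists n b, (forall i, open (b i) /\ convex_subset (b i)) /\
                            S = cyl n b].
  move=> S; rewrite inE => -[n [b [ob ->]]] x y l.
  rewrite !inE => Sx Sy i ni.
  have l0 : 0 <= l%:num by [].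
  have l1 : l%:num <= 1 by [].
  exact: (ob i).2 _ _ _ (Sx _ ni) (Sy _ ni) l0 l1.
split=> [S [n [b [ob ->]]]|w].
  by apply: cyl_open => i; case: (ob i).
have FF : Filter (filter_from [set U | (exists n b,
    (forall i, open (b i) /\ convex_subset (b i)) /\ U = cyl n b) /\ U w] id).
  apply: filter_from_filter.
    exists (cyl 0 (fun=> setT)); split => //; exists 0%N, (fun=> setT).
    split=> // i; split; first exact: openT.
    by [].
  move=> _ _ [[n [b [ob ->]]] bw] [[m [c [oc ->]]] cw].
  exists (cyl (maxn n m) (fun i => (if (i < n)%N then b i else setT) `&`
                                   (if (i < m)%N then c i else setT))).
    split; last first.
      move=> i _; split; first by case: ifP => // /bw.
      by case: ifP => // /cw.
    exists (maxn n m), (fun i => (if (i < n)%N then b i else setT) `&`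
                                   (if (i < m)%N then c i else setT)).
    split=> // i; split.
      by apply: openI; case: ifP => _; [exact: (ob i).1|exact: openT
        |exact: (oc i).1|exact: openT].
    move=> x y t [bx cx] [by_ cy] t0 t1; split.
      by case: ifP bx by_ => // _ bx by_; apply: (ob i).2.
    by case: ifP cx cy => // _ cx cy; apply: (oc i).2.
  move=> u cu; split=> i ni; have := cu i.
    by rewrite leq_max ni => /(_ isT)[].
  by rewrite leq_max ni orbT => /(_ isT)[].
apply/seqs_cvgP => i A /nbhs_convex_subset[C [cC oC Cw CA]].
exists (cyl i.+1 (fun j => if j == i then C else setT)); last first.
  by move=> u /(_ i (ltnSn i)); rewrite eqxx => /CA.
split; last by move=> j _; case: eqP => // ->.
exists i.+1, (fun j => if j == i then C else setT); split=> // j.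
by case: eqP => _; split=> //; exact: openT.
Qed.

HB.instance Definition _ := Uniform.copy (seqs E) {ptws nat -> E}.
HB.instance Definition _ :=
  PreTopologicalNmodule_isTopologicalNmodule.Build (seqs E) seqs_add.
HB.instance Definition _ :=
  TopologicalNmodule_isTopologicalLmodule.Build R (seqs E) seqs_scale.
HB.instance Definition _ := Uniform_isTvs.Build R (seqs E) seqs_convex.

Definition upd (w : seqs E) (i : nat) (v : E) : seqs E :=
  fun j => if j == i then v else w j.

Lemma cvg_upd (T : Type) (F : set_system T) (f : T -> seqs E) (g : T -> E)
    (w : seqs E) (v : E) i :
  Filter F -> f @ F --> w -> g @ F --> v ->
  upd (f x) i (g x) @[x --> F] --> upd w i v.
Proof.
move=> FF fw gv; apply: cvg_seqs => j; rewrite /upd; case: eqP => _ //.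
exact: (cvg_comp _ _ fw (@continuous_coord j w)).
Qed.

End Seqs.

(** * Iterated directional derivatives *)

Section IteratedDerivative.
Context {R : realType} {E F : tvsType R}.

Fixpoint iderive (f : E -> F) (k : nat) (x : E) (w : seqs E) : F :=
  if k is k'.+1 then tderive (fun y => iderive f k' y w) x (w k') else f x.

Lemma iderive_ext f k x (w w' : seqs E) :
  (forall i, (i < k)%N -> w i = w' i) -> iderive f k x w = iderive f k x w'.
Proof.
elim: k x => [//|k IH] x ww' /=.
rewrite ww'//; congr (tderive _ _ _); apply/funext => y.
by apply: IH => i ik; apply: ww'; rewrite ltnS ltnW.
Qed.

Lemma foldl_iderive f (s : seq E) x :
  foldl (fun g v x => tderive g x v) f s x = iderive f (size s) x (nth 0 s).
Proof.
elim/last_ind: s x => [//|s v IH] x.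
rewrite foldl_rcons size_rcons /= nth_rcons ltnn eqxx; congr (tderive _ _ _).
apply/funext => y; rewrite IH; apply: iderive_ext => i ik.
by rewrite nth_rcons ik.
Qed.

Definition ext_seqs (k : nat) (w : 'I_k -> E) : seqs E :=
  nth 0 [seq w i | i : 'I_k].

Definition restr_seqs (k : nat) (w : seqs E) : {ptws 'I_k -> E} :=
  fun i => w i.
Arguments restr_seqs k w : clear implicits.

Lemma ext_seqsE k (w : 'I_k -> E) (i : 'I_k) : ext_seqs w i = w i.
Proof.
rewrite /ext_seqs (nth_map i); last by rewrite size_enum_ord.
by rewrite nth_ord_enum.
Qed.

Lemma ext_seqs_out k (w : 'I_k -> E) (i : nat) : (k <= i)%N -> ext_seqs w i = 0.
Proof. by move=> ki; rewrite /ext_seqs nth_default// size_map size_enum_ord.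
  Qed.

Lemma diffn_iderive f k (p : E * {ptws 'I_k -> E}) :
  diffn f p = iderive f k p.1 (ext_seqs p.2).
Proof.
by rewrite /diffn foldl_iderive /ext_seqs size_map size_enum_ord.
Qed.

Lemma iderive_diffn f k x (w : seqs E) :
  iderive f k x w = diffn f (x, restr_seqs k w).
Proof.
rewrite diffn_iderive; apply: iderive_ext => i ik.
by rewrite (ext_seqsE (restr_seqs k w) (Ordinal ik)).
Qed.

Lemma continuous_ext_seqs k :
  continuous (@ext_seqs k : {ptws 'I_k -> E} -> seqs E).
Proof.
move=> w; apply: (@cvg_seqs R E {ptws 'I_k -> E} (nbhs w) _
  (ext_seqs w) _) => i.
have [ik|ki] := ltnP i k.
  rewrite (_ : (fun _ => _) = @proj _ (fun=> E) (Ordinal ik)); last first.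
    by apply/funext => u; rewrite (ext_seqsE u (Ordinal ik)).
  rewrite (ext_seqsE w (Ordinal ik)).
  exact: (@proj_continuous _ (fun=> E) (Ordinal ik)).
rewrite ext_seqs_out//; apply: cvg_near_cst; near=> u.
by rewrite ext_seqs_out.
Unshelve. all: by end_near. Qed.

Lemma cvg_ptws (I T : Type) (Q : set_system T) (g : T -> {ptws I -> E})
    (w : {ptws I -> E}) :
  Filter Q -> (forall i, g x i @[x --> Q] --> w i) -> g @ Q --> w.
Proof.
move=> FQ gw; rewrite cvg_sup => i.
rewrite cvg_image; last by rewrite eqEsubset; split=> v // _; exists (cst v).
move=> A /= nA; exists ((fun u : {ptws I -> E} => u i) @^-1` A).
  exact: gw.
by rewrite eqEsubset; split => [j [? + <-//]|j Wj]; exists (fun _ => j).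
Qed.

Lemma continuous_restr_seqs k : continuous (restr_seqs k).
Proof.
move=> w; apply: (@cvg_ptws _ _ (nbhs w)) => i.
exact: (@continuous_coord R E i w).
Qed.

End IteratedDerivative.
Arguments restr_seqs {R E} k w.

Section FromCsmooth.
Context {R : realType} {E F : tvsType R}.
Variables (f : E -> F) (U : set E).
Hypotheses (hF : hausdorff_space F) (oU : open U) (sf : Csmooth U f).

Let iderive_derivable k x w v : U x ->
  tderivable (fun y => iderive f k y w) x v.
Proof.
move=> Ux; rewrite (_ : (fun _ => _) = (fun y => diffn f (y, restr_seqs k w))).
  exact: (sf k.+1).1.
by apply/funext => y; exact: iderive_diffn.
Qed.

Let iderive_continuous k (p : E * seqs E) : U p.1 ->
  {for p, continuous (fun q : E * seqs E => iderive f k q.1 q.2)}.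
Proof.
move=> Up; have := (sf k).2 k (leqnn k).
rewrite continuous_open_subspace; last exact: openXT.
move=> /(_ (p.1, restr_seqs k p.2)); rewrite inE => /(_ (conj Up I)) c.
rewrite (_ : (fun q => _) = (fun p => diffn f p) \o
    (fun q : E * seqs E => (q.1, restr_seqs k q.2))); last first.
  by apply/funext => q; exact: iderive_diffn.
apply: continuous_comp; last exact: c.
have c2 : (fun q : E * seqs E => restr_seqs k q.2) @ p --> restr_seqs k p.2.
  exact: (@continuous_comp _ _ _ snd (restr_seqs k) p cvg_snd
    (@continuous_restr_seqs R E k p.2)).
have c1 : (fun q : E * seqs E => q.1) @ p --> p.1 by exact: cvg_fst.
exact: (cvg_pair c1 c2).
Qed.

Lemma upd_eq (w : seqs E) i v : upd w i v i = v.
Proof. by rewrite /upd eqxx. Qed.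

Lemma upd_neq (w : seqs E) i j v : j != i -> upd w i v j = w j.
Proof. by rewrite /upd => /negbTE ->. Qed.

Let iderive_upd k x w v : iderive f k x (upd w k v) = iderive f k x w.
Proof. by apply: iderive_ext => i ik; rewrite upd_neq// ltn_eqF. Qed.

Let iderive_ddir k x w v : U x ->
  ddir (fun y => iderive f k y w) x v (iderive f k.+1 x (upd w k v)).
Proof.
move=> Ux; rewrite /= upd_eq.
under [X in tderive X]eq_fun do rewrite iderive_upd.
exact/tderivableP/iderive_derivable.
Qed.

(** In the last direction this is the linearity of the derivative of a C^1
    map; in an earlier one it is inherited by the limit of the difference
    quotients. *)
Let iderive_lin k i x w (a : R) u v : U x -> (i < k)%N ->
  iderive f k x (upd w i (a *: u + v)) = a *: iderive f k x
    (upd w i u) + iderive f k x (upd w i v).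
Proof.
elim: k x => [//|k IH] x Ux; rewrite ltnS leq_eqVlt => /orP[/eqP->|ik].
  have cG (p : E * E) : U p.1 ->
      {for p, continuous (fun p => iderive f k.+1 p.1 (upd w k p.2))}.
    move=> Up; apply: (@continuous_comp _ _ _
      (fun p : E * E => (p.1, upd w k p.2) : E * seqs E)
      (fun q => iderive f k.+1 q.1 q.2)); last exact: iderive_continuous.
    have c2 : (fun p : E * E => upd w k p.2) @ p --> upd w k p.2.
      by apply: cvg_upd; [exact: cvg_cst|exact: cvg_snd].
    have c1 : (fun p : E * E => p.1) @ p --> p.1 by exact: cvg_fst.
    exact: (cvg_pair c1 c2).
  have dG y v' : U y -> ddir (fun y => iderive f k y w) y v'
      ((fun p => iderive f k.+1 p.1 (upd w k p.2)) (y, v')).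
    by move=> Uy; exact: iderive_ddir.
  have := ddirD (a *: u) v hF oU Ux dG cG => /= ->.
  congr (_ + _); apply: (ddir_unique hF (dG x _ Ux)).
  by apply: ddirZ; exact: dG.
have neq : k != i by rewrite gtn_eqF.
have D z : ddir (fun y => iderive f k y (upd w i z)) x (w k)
    (iderive f k.+1 x (upd w i z)).
  rewrite /= upd_neq//; apply/tderivableP/iderive_derivable => //.
apply: (ddir_unique hF (D _)); rewrite /ddir /=.
have ac : (fun=> a) @ (0 : R)^' --> (a : R) by exact: cvg_cst.
apply: cvg_trans (tcvgD (tcvgZ ac (D u)) (D v)); apply: near_eq_cvg; near=> h.
rewrite /= !IH//; last first.
  near: h; apply: (@cvg_line R E x (w k) U); exact: open_nbhs_nbhs.
rewrite scalerA mulrC -scalerA -scalerDr; congr (_ *: _).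
by rewrite scalerBr opprD addrACA.
Unshelve. all: by end_near. Qed.

(** The sequence w shifted by t k in its first j coordinates only; the passage
    from w to w + t k is cut into these single steps. *)
Definition shift_upto (w k : seqs E) (t : R) (j : nat) : seqs E :=
  fun l => if (l < j)%N then w l + t *: k l else w l.

Let iderive_shift m j x (w k : seqs E) (t : R) : U x -> (j <= m)%N ->
  iderive f m x (shift_upto w k t j) =
  iderive f m x w + t *: \sum_(i < j) iderive f m x (upd
    (shift_upto w k t i) i (k i)).
Proof.
move=> Ux; elim: j => [|j IH] jm.
  by rewrite big_ord0 scaler0 addr0; apply: iderive_ext.
rewrite big_ord_recr /= scalerDr addrA -IH; last exact: ltnW.
have -> : iderive f m x (shift_upto w k t j) = iderive f m x (upd
  (shift_upto w k t j) j (w j)).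
  by apply: iderive_ext => i _; rewrite /upd /shift_upto; case: eqP => // ->;
    rewrite ltnn.
rewrite addrC -iderive_lin//; apply: iderive_ext => i _.
rewrite /upd; case: eqP => [->|/eqP ij];
  first by rewrite /shift_upto ltnSn addrC.
by rewrite /shift_upto ltnS leq_eqVlt (negbTE ij).
Qed.

(** By multilinearity, the total derivative of (x, w) |-> d^m f(x).w at (x, w)
    in the direction (h, k) is d^(m+1) f(x).(w, h) plus the sum of the terms
    where k_i replaces w_i. *)
Let total_iderive m (q : (E * seqs E) * (E * seqs E)) : F :=
  iderive f m.+1 q.1.1 (upd q.1.2 m q.2.1) +
  \sum_(i < m) iderive f m q.1.1 (upd q.1.2 i (q.2.2 i)).

Lemma tcvg_sum (T : Type) (Q : set_system T) m (g : 'I_m -> T -> F)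
  (l : 'I_m -> F) :
  Filter Q -> (forall i, g i @ Q --> l i) ->
  \sum_(i < m) g i x @[x --> Q] --> \sum_(i < m) l i.
Proof.
move=> FQ; elim: m g l => [|m IH] g l gl.
  by rewrite big_ord0; under eq_fun do rewrite big_ord0; exact: cvg_cst.
rewrite big_ord_recr /=; under eq_fun do rewrite big_ord_recr /=.
by apply: tcvgD => //; apply: IH => i.
Qed.

Let ddir_iderive m (p v : E * seqs E) : U p.1 ->
  ddir (fun q : E * seqs E => iderive f m q.1 q.2) p v (total_iderive m (p, v)).
Proof.
case: p v => x w [h k] /= Ux.
have h1 := @iderive_ddir m x w h Ux.
have h2 : \sum_(i < m) iderive f m (x + t *: h) (upd (shift_upto w k t i) i
  (k i))
     @[t --> (0 : R)^'] --> \sum_(i < m) iderive f m x (upd w i (k i)).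
  apply: tcvg_sum => i.
  have c1 : (x + t *: h) @[t --> (0 : R)^'] --> x by exact: cvg_line.
  have c2 : upd (shift_upto w k t i) i (k i) @[t --> (0 : R)^'] --> upd w i
    (k i).
    apply: cvg_upd; last exact: cvg_cst.
    apply: cvg_seqs => j; rewrite /shift_upto; case: (j < i)%N;
      last exact: cvg_cst.
    exact: cvg_line.
  have c3 := @iderive_continuous m (x, upd w i (k i)) Ux.
  exact: (cvg_comp _ _ (cvg_pair c1 c2) c3).
rewrite /ddir /=; apply: cvg_trans (tcvgD h1 h2); apply: near_eq_cvg; near=> t.
have Ut : U (x + t *: h).
  by near: t; apply: (@cvg_line R E x h U); exact: open_nbhs_nbhs.
have -> : iderive f m (x + t *: h) (w + t *: k) =
    iderive f m (x + t *: h) (shift_upto w k t m).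
  by apply: iderive_ext => i im; rewrite /shift_upto im.
rewrite /= iderive_shift// [in RHS]addrAC [in RHS]scalerDr scalerA mulVf
  ?scale1r//.
by near: t; exact: nbhs_dnbhs_neq.
Unshelve. all: by end_near. Qed.

Lemma recCn_sum (E' : tvsType R) n m (V : set E') (g : 'I_m -> E' -> F) :
  open V ->
  (forall i, recCn n V (g i)) -> recCn n V (fun x => \sum_(i < m) g i x).
Proof.
move=> oV; elim: m g => [|m IH] g bg.
  apply: (@recCn_eq _ _ _ _ _ (fun=> 0)) => //; last exact: recCn_cst.
  by move=> x _; rewrite big_ord0.
apply: (@recCn_eq _ _ _ _ _
  (fun x => \sum_(i < m) g (widen_ord (leqnSn m) i) x + g ord_max x)) => //.
  by move=> x _; rewrite big_ord_recr.
by apply: recCn_add => //; apply: IH => i.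
Qed.

Lemma updD (a : R) (w w' : seqs E) i v v' :
  upd (a *: w + w') i (a *: v + v') = a *: upd w i v + upd w' i v'.
Proof.
apply/funext => j; transitivity (a *: upd w i v j + upd w' i v' j); last by [].
by rewrite /upd; case: eqP.
Qed.

Lemma clinear_upd i : clinear (fun q : (E * seqs E) * (E * seqs E) =>
  (q.1.1, upd q.1.2 i (q.2.2 i)) : E * seqs E).
Proof.
apply: clinear_pair.
  exact: (clinear_comp (clinear_fst _ _) (clinear_fst _ _)).
split=> [a p q|p].
  exact: updD.
apply: cvg_upd; first by apply: cvg_comp; [exact: cvg_fst|exact: cvg_snd].
apply: (@cvg_comp _ _ _ (fun q : (E * seqs E) * (E * seqs E) => q.2.2)
  (fun w => w i) _ (nbhs p.2.2)); last exact: continuous_coord.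
exact: (cvg_comp snd snd cvg_snd cvg_snd).
Qed.

Lemma clinear_upd1 i : clinear (fun q : (E * seqs E) * (E * seqs E) =>
  (q.1.1, upd q.1.2 i q.2.1) : E * seqs E).
Proof.
apply: clinear_pair.
  exact: (clinear_comp (clinear_fst _ _) (clinear_fst _ _)).
split=> [a p q|p].
  exact: updD.
apply: cvg_upd; first by apply: cvg_comp; [exact: cvg_fst|exact: cvg_snd].
exact: (cvg_comp snd fst cvg_snd cvg_fst).
Qed.

(** The formula for the total derivative consists of terms of the same kind,
    composed with continuous linear maps: one order of regularity is gained for
    all m at the same time. *)
Let recCn_iderive n m :
  recCn n (U `*` setT) (fun q : E * seqs E => iderive f m q.1 q.2).
Proof.
elim: n m => [|n IH] m.
  by split=> // p [Up _]; exact: iderive_continuous.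
have oU' := @openXT E (seqs E) U oU.
apply: (@recCn_intro _ _ _ _ _ _ (total_iderive m)) => //.
- by move=> p [Up _]; exact: iderive_continuous.
- by move=> p v [Up _]; exact: ddir_iderive.
have oU'' := @openXT (E * seqs E)%type (E * seqs E)%type _ oU'.
apply: recCn_add => //.
  have := recCn_comp_lin hF oU' (clinear_upd1 m) (IH m.+1).
  by apply: recCn_sub => q [[]].
apply: recCn_sum => // i.
have := recCn_comp_lin hF oU' (clinear_upd i) (IH m).
by apply: recCn_sub => q [[]].
Qed.

Lemma Csmooth_recCn n : recCn n U f.
Proof.
have cl : clinear (fun x : E => (x, 0) : E * seqs E).
  by apply: clinear_pair; [exact: clinear_id|exact: clinear_0].
have := recCn_comp_lin hF (@openXT E (seqs E) U oU) cl (recCn_iderive n 0).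
by apply: recCn_sub => x.
Qed.

End FromCsmooth.

Section ToCsmooth.
Context {R : realType} {E F : tvsType R}.

Lemma recCn_Csmooth (f : E -> F) (U : set E) : hausdorff_space F -> open U ->
  (forall n, recCn n U f) -> Csmooth U f.
Proof.
move=> hF oU bf.
have oU' := @openXT E (seqs E) U oU.
have ddE k x (w : seqs E) v :
    ddir (fun y => iderive f k y w) x v =
    ddir (fun q : E * seqs E => iderive f k q.1 q.2) (x, w) (v, 0).
  have e (h : R) : (x, w) + h *: (v, 0 : seqs E) = (x + h *: v, w).
    transitivity (x + h *: v, w + h *: (0 : seqs E)); first by [].
    by rewrite scaler0 addr0.
  rewrite /ddir; have -> :
    (fun h : R => h^-1 *: (iderive f k ((x, w) + h *: (v, 0 : seqs E)).1
      ((x, w) + h *: (v, 0 : seqs E)).2 - iderive f k x w)) =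
      (fun h : R => h^-1 *: (iderive f k (x + h *: v) w - iderive f k x w)).
    by apply/funext => h; rewrite e.
  by [].
have bdd k : forall n, recCn n (U `*` setT)
  (fun q : E * seqs E => iderive f k q.1 q.2).
  elim: k => [|k IH] n.
    have := recCn_comp_lin hF oU (@clinear_fst R E (seqs E)) (bf n).
    by apply: recCn_sub => x [].
  have cl : clinear (fun q : E * seqs E => (q, (q.2 k, 0)) :
      (E * seqs E) * (E * seqs E)).
    apply: clinear_pair; first exact: clinear_id.
    apply: clinear_pair; last exact: clinear_0.
    split=> // p; apply: (@cvg_comp _ _ _ snd (fun w : seqs E => w k) _
      (nbhs p.2)); [exact: cvg_snd|exact: continuous_coord].
  have := recCn_comp_lin hF (openXT oU') cl (recCn_deriv (IH n.+1)).
  move=> /recCn_sub -/(_ (U `*` setT)) h.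
  apply: (recCn_eq oU' _ (h _)); last by move=> x Ux; split.
  by move=> [x w] [/= Ux _]; rewrite /tderive ddE.
have dc k p : U p.1 ->
    {for p, continuous (fun q : E * seqs E => iderive f k q.1 q.2)}.
  by move=> Up; apply: (recCn_continuous (bdd k 0%N)).
move=> n; split=> [k kn x v w Ux|k kn].
  rewrite /tderivable (_ : (fun y => _) = (fun y => iderive f k y
    (ext_seqs w))).
    rewrite ddE; have [_ [h _]] := bdd k 1%N; exact: h.
  by apply/funext => y; rewrite diffn_iderive.
rewrite continuous_open_subspace; last exact: openXT.
move=> p; rewrite inE => -[Up _].
rewrite (_ : (fun p => _) = (fun q : E * seqs E => iderive f k q.1 q.2) \o
    (fun q : E * {ptws 'I_k -> E} => (q.1, ext_seqs q.2))); last first.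
  by apply/funext => q; rewrite /= diffn_iderive.
apply: continuous_comp; last exact: dc.
have c1 : (fun q : E * {ptws 'I_k -> E} => q.1) @ p --> p.1 by exact: cvg_fst.
have c2 : (fun q : E * {ptws 'I_k -> E} => ext_seqs q.2) @ p --> ext_seqs p.2.
  apply: (@cvg_comp _ _ _ snd (@ext_seqs R E k) (nbhs p) (nbhs p.2)).
    exact: (@cvg_snd E {ptws 'I_k -> E} (nbhs p.1) (nbhs p.2)).
  exact: (@continuous_ext_seqs R E k p.2).
exact: (cvg_pair c1 c2).
Qed.

End ToCsmooth.

(** * Plateau functions on the line *)

Section Flat.
Context {R : realType}.

(** For k = 0 the usual flat function exp(-1/t). The family is closed under
    differentiation, flat_k' = flat_(k+2) - k flat_(k+1), at 0 included, which
    turns its smoothness into an induction. *)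
Definition flat (k : nat) (t : R^o) : R^o :=
  if 0 < (t : R) then ((t : R)^-1) ^+ k * expR (- (t : R)^-1) else 0.

Lemma is_derive_ddir (f : R^o -> R^o) (t l : R) :
  is_derive (t : R^o) (1 : R^o) f l -> ddir f t 1 l.
Proof.
move=> [df <-]; rewrite /ddir /=; apply: cvg_trans df.
by apply: near_eq_cvg; near=> h; rewrite /= [t + _]addrC.
Unshelve. all: by end_near. Qed.

Lemma flat_ge0 k t : 0 <= (flat k t : R).
Proof.
rewrite /flat; case: ifP => // t0.
by rewrite mulr_ge0 ?expR_ge0// exprn_ge0// invr_ge0 ltW.
Qed.

(** From u^(k+1) / (k+1)! <= exp u with u = 1/t. *)
Lemma flat_bound k (t : R) : (flat k t : R) <= k.+1`!%:R * `|t|.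
Proof.
rewrite /flat; case: ifP => [t0|_]; last by rewrite mulr_ge0.
rewrite gtr0_norm// expRN ler_pdivrMr ?expR_gt0//.
have := @expR_ge1Dxn R t^-1 k; rewrite invr_ge0 (ltW t0) => /(_ isT) h.
have {}h : t^-1 ^+ k.+1 / k.+1`!%:R <= expR t^-1.
  by apply: le_trans h; rewrite lerDr.
rewrite ler_pdivrMr ?ltr0n ?fact_gt0// in h.
have := ler_wpM2r (ltW t0) h.
rewrite exprSr -mulrA mulVf ?gt_eqF// mulr1 => h'.
by apply: le_trans h' _; rewrite mulrC [expR _ * _]mulrC mulrA [t * _]mulrC.
Qed.

Lemma flat_cvg0 k : flat k t @[t --> (0 : R^o)] --> (0 : R^o).
Proof.
apply/cvgrPdist_lt => e e0; near=> t.
rewrite sub0r normrN ger0_norm ?flat_ge0//.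
apply: le_lt_trans (flat_bound k t) _.
rewrite -ltr_pdivlMl ?ltr0n ?fact_gt0//.
have : ball (0 : R^o) ((k.+1)`!%:R^-1 * e) t.
  near: t; apply/nbhs_ballP; exists (k.+1`!%:R^-1 * e) => //=.
  by rewrite mulr_gt0// invr_gt0 ltr0n fact_gt0.
by rewrite -ball_normE /= sub0r normrN.
Unshelve. all: by end_near. Qed.

Lemma ddir_flat k (t : R) :
  ddir (flat k) t 1 ((flat k.+2 t : R) - k%:R * (flat k.+1 t : R)).
Proof.
have [t0|t0|->] := ltgtP t 0.
- have oV : open [set t : R^o | (t : R) < 0] by exact: open_lt.
  have -> : (flat k.+2 t : R) - k%:R * (flat k.+1 t : R) = 0.
    by rewrite /flat (lt_gtF t0) mulr0 subrr.
  apply: (@ddir_local R R^o R^o _ (fun=> 0) _ _ _ oV) => //.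
    by move=> y /= y0; rewrite /flat (lt_gtF y0).
  rewrite /ddir /=; under eq_fun do rewrite subrr scaler0.
  exact: cvg_cst.
- have oV : open [set t : R^o | 0 < (t : R)] by exact: open_gt.
  apply: (@ddir_local R R^o R^o _
    (fun t : R^o => ((t : R)^-1) ^+ k * expR (- (t : R)^-1)) _ _ _ oV) => //.
    by move=> y /= y0; rewrite /flat y0.
  apply: is_derive_ddir.
  have t0' : t != 0 by rewrite gt_eqF.
  have dV : is_derive (t : R^o) (1 : R^o) (fun x : R^o => x^-1) (- t ^- 2).
    split; first exact: (@derivableV R R^o id).
    rewrite (@deriveV R R^o id)//.
    by rewrite derive_id [_ *: _]mulr1.
  have dE : is_derive (t : R^o) (1 : R^o) (fun x : R^o => expR (- x^-1))
      (t ^- 2 * expR (- t^-1)).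
    have := @is_derive1_comp R expR (fun x => - x^-1) t _ _
      (is_derive_expR _) (is_deriveN dV).
    by rewrite opprK mulrC.
  have -> : (fun t : R^o => (t : R)^-1 ^+ k * expR (- (t : R)^-1)) =
      ((fun x : R^o => x^-1) ^+ k * (fun x : R^o => expR (- x^-1)))%R.
    by apply/funext => x; rewrite [RHS]/= exprfctE.
  apply: (is_derive_eq (is_deriveM (is_deriveX k dV) dE)).
  rewrite exprfctE.
  rewrite /flat t0 /GRing.scale/=.
  set e := expR _; rewrite [X in X * (_ * e)](_ : _ = t^-1 ^+ k)//.
  case: k => [|k].
    by rewrite !mul0r mulr0 addr0 subr0 expr0 mul1r exprVn.
  rewrite /= !exprVn; set n := k.+1%:R.
  rewrite [X in n * X](_ : _ = t ^- k); last by rewrite -exprVn.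
  rewrite mulrN mulrN; congr (_ - _).
    by rewrite mulrA -invfM -exprD addnC.
  rewrite mulrC -!mulrA; congr (_ * _).
  by rewrite mulrA -invfM -exprD addn2.
have -> : (flat k.+2 0 : R) - k%:R * (flat k.+1 0 : R) = 0.
  by rewrite /flat ltxx mulr0 subrr.
rewrite /ddir /=.
have : flat k.+1 t @[t --> (0 : R)^'] --> (0 : R^o).
  by apply: cvg_trans (flat_cvg0 k.+1); apply: cvg_app; exact: cvg_within.
apply: cvg_trans; apply: near_eq_cvg; near=> h.
rewrite add0r [h *: _]mulr1 /flat ltxx subr0; case: ifP => [h0|_].
  by rewrite exprS -mulrA.
by rewrite scaler0.
Unshelve. all: by end_near. Qed.

Lemma continuous_flat k (t : R^o) : {for t, continuous (flat k)}.
Proof.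
have dt := @ddir_flat k t.
have /derivable1_diffP/differentiable_continuous :
    derivable (flat k : R^o -> R^o) t 1.
  apply/cvg_ex; eexists; apply: cvg_trans dt.
  by apply: near_eq_cvg; near=> h; rewrite /= [h *: _ + _]addrC.
exact.
Unshelve. all: by end_near. Qed.

Lemma recCn_flat n k : recCn n setT (flat k).
Proof.
have hR := @norm_hausdorff R R^o.
elim: n k => [|n IH] k; first by split=> // t _; exact: continuous_flat.
have cf := @continuous_flat k.
apply: (@recCn_intro _ _ _ _ _ _ (fun p : R^o * R^o =>
  (p.2 : R) *: (flat k.+2 p.1 + (- k%:R : R) *: flat k.+1 p.1))) => //.
- exact: openT.
- move=> t v _ /=; have := @ddirZ _ _ _ _ _ _ _ (v : R) (@ddir_flat k t).
  by rewrite [v *: 1]mulr1 -[X in _ - X]/(k%:R *: flat k.+1 t) -scaleNr.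
- have oTT : open ([set: R^o] `*` [set: R^o]) by exact/openXT/openT.
  have e : [set: R^o] `*` [set: R^o] = fst @^-1` setT.
    by apply/seteqP; split=> -[x v].
  have h j : recCn n ([set: R^o] `*` [set: R^o])
      (fun p : R^o * R^o => flat j p.1).
    rewrite e; apply: (@recCn_comp_lin _ n _ _ _ setT fst (flat j)) => //.
      exact: openT.
    exact: clinear_fst.
  apply: recCn_scale => //; first by apply: recCn_lin => //; exact: clinear_snd.
  apply: recCn_add => //; apply: recCn_scale => //.
  exact: recCn_cst.
Unshelve. all: by end_near. Qed.

Lemma flat0_le s t : s <= t -> (flat 0 s : R) <= flat 0 t.
Proof.
move=> st; rewrite /flat !expr0 !mul1r.
case: (ltP 0 s) => s0; last by case: ifP => // _; exact: expR_ge0.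
rewrite (lt_le_trans s0 st) ler_expR lerN2 lef_pV2//.
by rewrite posrE (lt_le_trans s0 st).
Qed.

Lemma flat0_gt0 t : 0 < t -> 0 < (flat 0 t : R).
Proof. by move=> t0; rewrite /flat t0 expr0 mul1r expR_gt0. Qed.

Lemma flat0_eq0 t : t <= 0 -> (flat 0 t : R) = 0.
Proof. by rewrite leNgt /flat => /negbTE ->. Qed.

(** The value is exactly constant for t <= 0 because the inner flat vanishes
    there, and exactly 0 for t >= 1 because the outer one vanishes on negative
    numbers. *)
Definition step (t : R^o) : R^o :=
  (flat 0 (flat 0 1))^-1 *: flat 0 ((flat 0 1 : R) - flat 0 t).

Let c0 : 0 < (flat 0 (flat 0 1) : R).
Proof. by do 2 apply: flat0_gt0. Qed.

Lemma step1 t : t <= 0 -> step t = 1.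
Proof.
move=> t0; rewrite /step (flat0_eq0 t0) subr0 /GRing.scale/= mulVf//.
by rewrite gt_eqF.
Qed.

Lemma step0 t : 1 <= t -> step t = 0.
Proof.
by move=> t1; rewrite /step [X in _ *: X]flat0_eq0 ?scaler0// subr_le0 flat0_le.
Qed.

Lemma step01 t : 0 <= (step t : R) <= 1.
Proof.
rewrite /step /GRing.scale/= mulr_ge0 ?flat_ge0 ?invr_ge0 ?(ltW c0)//=.
rewrite mulrC ler_pdivrMr// mul1r flat0_le// gerBl.
exact: flat_ge0.
Qed.

Lemma recCn_step n : recCn n setT step.
Proof.
have hR := @norm_hausdorff R R^o.
have oT := @openT R^o.
apply: recCn_scale => //; first exact: recCn_cst.
apply: (@recCn_comp _ n _ _ _ setT setT _ (flat 0)) => //;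
  first exact: recCn_flat.
apply: recCn_add => //; first exact: recCn_cst.
apply: (@recCn_eq _ _ _ _ _ (fun t => (-1 : R) *: flat 0 t)) => //.
  by move=> t _; rewrite scaleN1r.
by apply: recCn_scale => //; [exact: recCn_cst|exact: recCn_flat].
Qed.

End Flat.

(** * Smooth maps on arbitrary subsets *)

Section SmoothOn.
Context {R : realType}.
Implicit Types E F G : tvsType R.

Lemma smooth_on_recCn E F (A : set E) (f : E -> F) :
  hausdorff_space F ->
  smooth_on A f <-> forall x, A x -> exists (U : set E) (g : E -> F),
    [/\ open U, U x, (forall n, recCn n U g) & forall y, A y -> U y ->
      f y = g y].
Proof.
move=> hF; split=> h x Ax; have [U [g [oU Ux sg fg]]] := h x Ax;
  exists U, g; split => //.
- by move=> n; exact: Csmooth_recCn.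
- exact: recCn_Csmooth.
Qed.

Lemma recCn_smooth_on E F (A : set E) (f : E -> F) : hausdorff_space F ->
  (forall n, recCn n setT f) -> smooth_on A f.
Proof.
by move=> hF bf; apply/smooth_on_recCn => // x Ax; exists setT, f; split => //;
  exact: openT.
Qed.

Lemma smooth_on_sub E F (A B : set E) (f : E -> F) :
  B `<=` A -> smooth_on A f -> smooth_on B f.
Proof.
move=> BA sf x /BA Ax; have [U [g [oU Ux sg fg]]] := sf x Ax.
by exists U, g; split => // y /BA; exact: fg.
Qed.

Lemma smooth_on_eq E F (A : set E) (f g : E -> F) :
  (forall x, A x -> f x = g x) -> smooth_on A f -> smooth_on A g.
Proof.
move=> fg sf x Ax; have [U [h [oU Ux sh fh]]] := sf x Ax.
by exists U, h; split => // y Ay Uy; rewrite -fg// fh.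
Qed.

Lemma smooth_on_local E F (A : set E) (f : E -> F) :
  (forall x, A x -> exists2 W, open W /\ W x & smooth_on (A `&` W) f) ->
  smooth_on A f.
Proof.
move=> h x Ax; have [W [oW Wx] sf] := h x Ax.
have [U [g [oU Ux sg fg]]] := sf x (conj Ax Wx).
exists (U `&` W), g; split=> //; first exact: openI.
  apply/smooth_on_open; first exact: openI.
  by move=> y [Uy _]; exists U, g; split.
by move=> y Ay [Uy Wy]; apply: fg.
Qed.

Lemma smooth_on_comp E F G (A : set E) (B : set F) (f : E -> F) (g : F -> G) :
  hausdorff_space F -> hausdorff_space G ->
  (forall x, A x -> B (f x)) -> smooth_on B g -> smooth_on A f ->
  smooth_on A (g \o f).
Proof.
move=> hF hG AB sg sf; apply/smooth_on_recCn => // x Ax.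
have [U [f1 [oU Ux bf ff1]]] := (smooth_on_recCn A f hF).1 sf x Ax.
have [V [g1 [oV Vx bg gg1]]] := (smooth_on_recCn B g hG).1 sg _ (AB _ Ax).
have cf1 y : U y -> {for y, continuous f1}.
  by move=> Uy; exact: (recCn_continuous (bf 0%N)).
have oW : open (U `&` f1 @^-1` V).
  rewrite openE => y [Uy Vy]; apply: filterI; first exact: open_nbhs_nbhs.
  by apply: (cf1 _ Uy); exact: open_nbhs_nbhs.
exists (U `&` f1 @^-1` V), (g1 \o f1); split => //.
- by split => //=; rewrite -ff1.
- move=> n; apply: (@recCn_comp _ n _ _ _ _ V) => //; first by move=> y [].
  by apply: recCn_sub (bf n) => y [].
- by move=> y Ay [Uy Vy] /=; rewrite ff1// gg1 -?ff1//; [exact: AB|rewrite ff1].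
Qed.

Lemma smooth_on_pair E F G (A : set E) (f : E -> F) (g : E -> G) :
  hausdorff_space F -> hausdorff_space G ->
  smooth_on A f -> smooth_on A g -> smooth_on A (fun x => (f x, g x)).
Proof.
move=> hF hG sf sg; apply/smooth_on_recCn; first exact: hausdorff_prod.
move=> x Ax.
have [U [f1 [oU Ux bf ff1]]] := (smooth_on_recCn A f hF).1 sf x Ax.
have [V [g1 [oV Vx bg gg1]]] := (smooth_on_recCn A g hG).1 sg x Ax.
exists (U `&` V), (fun x => (f1 x, g1 x)); split => //; first exact: openI.
  move=> n; apply: recCn_pair => //; first exact: openI.
    by apply: recCn_sub (bf n) => y [].
  by apply: recCn_sub (bg n) => y [].
by move=> y Ay [Uy Vy]; rewrite ff1// gg1.
Qed.

Lemma smooth_on_add E F (A : set E) (f g : E -> F) : hausdorff_space F ->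
  smooth_on A f -> smooth_on A g -> smooth_on A (fun x => f x + g x).
Proof.
move=> hF sf sg; apply/smooth_on_recCn => // x Ax.
have [U [f1 [oU Ux bf ff1]]] := (smooth_on_recCn A f hF).1 sf x Ax.
have [V [g1 [oV Vx bg gg1]]] := (smooth_on_recCn A g hF).1 sg x Ax.
exists (U `&` V), (fun x => f1 x + g1 x); split => //; first exact: openI.
  move=> n; apply: recCn_add => //; first exact: openI.
    by apply: recCn_sub (bf n) => y [].
  by apply: recCn_sub (bg n) => y [].
by move=> y Ay [Uy Vy]; rewrite ff1// gg1.
Qed.

Lemma smooth_on_scale E F (A : set E) (k : E -> R^o) (f : E -> F) :
  hausdorff_space F -> smooth_on A k -> smooth_on A f ->
  smooth_on A (fun x => (k x : R) *: f x).
Proof.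
move=> hF sk sf; apply/smooth_on_recCn => // x Ax.
have hR := @norm_hausdorff R R^o.
have [U [f1 [oU Ux bf ff1]]] := (smooth_on_recCn A f hF).1 sf x Ax.
have [V [g1 [oV Vx bg gg1]]] := (smooth_on_recCn A k hR).1 sk x Ax.
exists (U `&` V), (fun x => (g1 x : R) *: f1 x); split => //;
  first exact: openI.
  move=> n; apply: recCn_scale => //; first exact: openI.
    by apply: recCn_sub (bg n) => y [].
  by apply: recCn_sub (bf n) => y [].
by move=> y Ay [Uy Vy]; rewrite ff1// gg1.
Qed.

Lemma smooth_on_cst E F (A : set E) (c : F) : hausdorff_space F ->
  smooth_on A (fun=> c).
Proof.
by move=> hF; apply: recCn_smooth_on => // n; apply: recCn_cst => //;
  exact: openT.
Qed.

Lemma smooth_on_lin E F (A : set E) (f : E -> F) : hausdorff_space F ->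
  clinear f -> smooth_on A f.
Proof.
move=> hF cf; apply: recCn_smooth_on => // n.
by apply: recCn_lin => //; exact: openT.
Qed.

End SmoothOn.

(** * Cut-off functions on R^d *)

Section Bump.
Context {R : realType} {d : nat}.
Implicit Types (a x y : 'rV[R]_d).

Definition sqdist a y : R^o := \sum_(i < d) (y ord0 i - a ord0 i) ^+ 2.

Lemma recCn_sqdist n a : recCn n setT (sqdist a).
Proof.
have hR := @norm_hausdorff R R^o.
apply: recCn_sum => //; first exact: openT.
move=> i; have h : recCn n setT (fun y : 'rV[R]_d => y ord0 i - a ord0 i : R^o).
  apply: recCn_add => //; first exact: openT.
    apply: recCn_lin => //; first exact: openT.
    split=> [c x y|]; first by rewrite !mxE.
    exact: coord_continuous.
  by apply: recCn_cst => //; exact: openT.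
by apply: recCn_scale => //; exact: openT.
Qed.

Lemma sqdist_coord a y i : (y ord0 i - a ord0 i) ^+ 2 <= sqdist a y.
Proof.
rewrite /sqdist (bigD1 i)//= lerDl sumr_ge0// => j _.
exact: sqr_ge0.
Qed.

Lemma sqdistxx a : sqdist a a = 0.
Proof.
by rewrite /sqdist big1// => i _; rewrite subrr expr0n.
Qed.

Lemma continuous_sqdist a : continuous (sqdist a).
Proof. by move=> y; exact: (recCn_continuous (recCn_sqdist 0 a)). Qed.

Lemma exists_bump a (W : set 'rV[R]_d) : open W -> W a ->
  exists (b : 'rV[R]_d -> R^o) (V B : set 'rV[R]_d),
    [/\ smooth_on setT b /\ continuous b, forall y, 0 <= (b y : R) <= 1,
        open V /\ V a, forall y, V y -> b y = 1 &
        [/\ compact B, B `<=` W & forall y, ~ B y -> b y = 0]].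
Proof.
move=> oW Wa; have hR := @norm_hausdorff R R^o.
have /nbhs_closedballP[e eW] : nbhs a W by exact: open_nbhs_nbhs.
pose r := e%:num / 2.
have r0 : 0 < r by rewrite divr_gt0.
have bb n : recCn n setT (fun y => step (r ^- 2 * sqdist a y - 1)).
  apply: (@recCn_comp _ n _ _ _ setT setT _ (@step R)) => //; try exact: openT.
    exact: recCn_step.
  apply: recCn_add => //; first exact: openT.
    apply: recCn_scale => //; first exact: openT.
      by apply: recCn_cst => //; exact: openT.
    exact: recCn_sqdist.
  by apply: recCn_cst => //; exact: openT.
exists (fun y => step (r ^- 2 * sqdist a y - 1)),
  [set y | sqdist a y < r ^+ 2], (closed_ball a e%:num).
split.
- split; first exact: recCn_smooth_on.
  by move=> y; exact: (recCn_continuous (bb 0%N)).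
- by move=> y; exact: step01.
- split; last by rewrite /= sqdistxx exprn_gt0.
  apply: (@open_comp _ _ (sqdist a) [set t : R^o | (t : R) < r ^+ 2]).
    by move=> y _; exact: continuous_sqdist.
  exact: open_lt.
- move=> y /= yr; apply: step1.
  by rewrite subr_le0 mulrC ler_pdivrMr ?exprn_gt0// mul1r ltW.
- split => //.
    apply: bounded_closed_compact; last exact: closed_ball_closed.
    rewrite closed_ballE//; exists (`|a| + e%:num); split;
      first exact: num_real.
    move=> M aM y /= ye.
    rewrite -[y](subrK a) addrC (le_trans (ler_normD _ _))// (le_trans _
      (ltW aM))//.
    by rewrite lerD2l distrC.
  move=> y yB; apply: step0; rewrite lerBrDr.
  rewrite leNgt; apply/negP => h; apply: yB; rewrite closed_ballE//=.
  have {}h : sqdist a y < 2 * r ^+ 2.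
    by rewrite -ltr_pdivrMr ?exprn_gt0// mulrC (_ : 2 = 1 + 1 :> R)//.
  have h2 : sqdist a y < e%:num ^+ 2.
    apply: lt_trans h _; rewrite /r expr_div_n mulrCA.
    rewrite gtr_pMr ?exprn_gt0//.
    by rewrite (_ : 2 ^+ 2 = 2 * 2)// invfM mulrA divff ?mul1r ?invf_lt1 ?ltr1n.
  rewrite /closed_ball_ /= [leLHS]/Num.Def.normr /= mx_normrE;
    apply/bigmax_leP; split => // -[i j] _ /=.
  rewrite !mxE ord1 distrC.
  have := le_lt_trans (sqdist_coord a y j) h2.
  by rewrite -(real_normK (num_real
    (y ord0 j - a ord0 j))) ltr_pXn2r ?nnegrE// => /ltW.
Qed.

End Bump.

(** * Smooth maps between manifolds *)

Section Topology.
Implicit Types X Y Z : topologicalType.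

Lemma within_open_continuousP X Y (U : set X) (f : X -> Y) : open U ->
  {within U, continuous f} <-> forall x, U x -> {for x, continuous f}.
Proof.
move=> oU; rewrite continuous_open_subspace//; split=> h x Ux.
  by apply: h; rewrite inE.
by apply: h; rewrite inE in Ux.
Qed.

Lemma within_open_preimage X Y (A : set X) (f : X -> Y) (O : set Y) x :
  {within A, continuous f} -> open O -> A x -> O (f x) ->
  exists W, [/\ open W, W x & forall z, A z -> W z -> O (f z)].
Proof.
move=> /subspace_continuousP cf oO Ax Ofx.
have := cf x Ax O (open_nbhs_nbhs (conj oO Ofx)).
rewrite /= /within /= nbhsE => -[W [oW Wx] WO].
by exists W; split=> // z Az Wz; exact: WO.
Qed.

Lemma open_preimage_in X Y (U : set X) (f : X -> Y) (O : set Y) :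
  open U -> (forall x, U x -> {for x, continuous f}) -> open O ->
  open (U `&` f @^-1` O).
Proof.
move=> oU cf oO; rewrite openE => x [Ux Ox]; apply: filterI.
  exact: open_nbhs_nbhs.
by apply: (cf _ Ux); exact: open_nbhs_nbhs.
Qed.

End Topology.

Record is_charts {X : topologicalType} {R : realType} {E : tvsType R}
    (C : set (pbij X E)) : Prop := {
  charts_phomeo : forall c, C c -> is_phomeo c;
  charts_open : forall c, C c -> open (dom c);
  charts_cover : forall x, exists2 c, C c & dom c x }.

Lemma atlas_charts (R : realType) (X : topologicalType) (E : tvsType R)
  (A : set E) (C : set (pbij X E)) : is_atlas A C -> is_charts C.
Proof.
by move=> aC; split; [exact: atlas_phomeo aC|exact: atlas_dom_open aC|
  exact: atlas_cover aC].
Qed.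

Section SmoothMaps.
Context {R : realType}.
Context {X Y Z : topologicalType} {E F G : tvsType R}.
Context {C : set (pbij X E)} {D : set (pbij Y F)} {D' : set (pbij Z G)}.
Hypotheses (hE : hausdorff_space E) (hF : hausdorff_space F)
  (hG : hausdorff_space G).

Lemma smooth_map_continuous U (f : X -> Y) x : open U ->
  smooth_map C D U f -> U x -> {for x, continuous f}.
Proof. by move=> oU [/within_open_continuousP cf _]; exact: cf. Qed.

Lemma smooth_map_sub U V (f : X -> Y) : V `<=` U ->
  smooth_map C D U f -> smooth_map C D V f.
Proof.
move=> VU [cf sf]; split; first exact: continuous_subspaceW cf.
move=> c d Cc Dd; apply: smooth_on_sub (sf c d Cc Dd).
by move=> y [/= iy [Vy dy]]; split => //; split => //; exact: VU.
Qed.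

Lemma smooth_map_eq U (f g : X -> Y) : open U -> (forall x, U x -> f x = g x) ->
  smooth_map C D U f -> smooth_map C D U g.
Proof.
move=> oU fg [/within_open_continuousP cf sf]; split.
  apply/within_open_continuousP => // x Ux.
  by apply: (open_eq_continuous oU Ux fg); exact: cf.
move=> c d Cc Dd; apply: (@smooth_on_eq _ _ _ _ (fwd d \o f \o bwd c)).
  by move=> y [/= iy [Uy _]]; rewrite fg.
apply: smooth_on_sub (sf c d Cc Dd).
by move=> y [/= iy [Uy dy]]; split => //; split => //=; rewrite fg.
Qed.

Lemma smooth_map_local U (f : X -> Y) : is_charts C -> open U ->
  (forall x, U x -> exists V, [/\ open V, V x & smooth_map C D V f]) ->
  smooth_map C D U f.
Proof.
move=> cC oU h; split.
  apply/within_open_continuousP => // x /h[V [oV Vx sf]].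
  exact: smooth_map_continuous sf Vx.
move=> c d Cc Dd; apply: smooth_on_local => y [/= iy [Uy dy]].
have [V [oV Vx [cf sf]]] := h _ Uy.
have [W [oW Wy WV]] := within_open_preimage
  (phomeo_bwd_continuous (charts_phomeo cC Cc)) oV iy Vx.
exists W => //; apply: smooth_on_sub (sf c d Cc Dd).
by move=> z [[/= iz [Uz dz]] Wz]; split => //; split => //; exact: WV.
Qed.

Lemma smooth_map_comp U V (f : X -> Y) (g : Y -> Z) :
  is_charts C -> is_charts D -> open U -> open V ->
  (forall x, U x -> V (f x)) -> (forall d', D' d' -> open (dom d')) ->
  smooth_map D D' V g -> smooth_map C D U f -> smooth_map C D' U (g \o f).
Proof.
move=> cC cD oU oV UV oD' sg sf.
have cg := iffLR (within_open_continuousP g oV) sg.1.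
have cf := smooth_map_continuous oU sf.
split.
  apply/within_open_continuousP => // x Ux.
  by apply: continuous_comp; [exact: cf|apply: cg; exact: UV].
move=> c d' Cc Dd'; apply: smooth_on_local => y [/= iy [Uy dy]].
have [d Dd dfx] := charts_cover cD (f (bwd c y)).
pose O := U `&` f @^-1` (dom d `&` (V `&` g @^-1` dom d')).
have oO : open O.
  apply: open_preimage_in => //; apply: openI; first exact: (charts_open cD).
  by apply: open_preimage_in => //; exact: oD'.
have Oy : O (bwd c y) by split => //; split => //; split => //; exact: UV.
have [W [oW Wy WO]] := within_open_preimage
  (phomeo_bwd_continuous (charts_phomeo cC Cc)) oO iy Oy.
exists W => //.
apply: (@smooth_on_eq _ _ _ _ ((fwd d' \o g \o bwd d) \o
  (fwd d \o f \o bwd c))).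
  move=> z [[/= iz _] Wz]; have [_ [dz _]] := WO z iz Wz.
  by rewrite (phomeo_fwdK (charts_phomeo cD Dd)).
apply: (smooth_on_comp hF hG _ (sg.2 d d' Dd Dd')).
  move=> z [[/= iz _] Wz]; have [_ [dz [Vz dz']]] := WO z iz Wz.
  split; first exact: (phomeo_fwd (charts_phomeo cD Dd)).
  by rewrite /= (phomeo_fwdK (charts_phomeo cD Dd)).
apply: smooth_on_sub (sf.2 c d Cc Dd).
move=> z [[/= iz _] Wz]; have [Uz [dz _]] := WO z iz Wz.
by split.
Qed.

Lemma smooth_map_pair U (f : X -> Y) (g : X -> Z) : open U ->
  smooth_map C D U f -> smooth_map C D' U g ->
  smooth_map C (prod_atlas D D') U (fun x => (f x, g x)).
Proof.
move=> oU sf sg; split.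
  apply/within_open_continuousP => // x Ux.
  exact: (cvg_pair (smooth_map_continuous oU sf Ux)
                   (iffLR (within_open_continuousP g oU) sg.1 x Ux)).
move=> c _ Cc [d Dd [d' Dd' <-]]; apply: smooth_on_pair => //.
  apply: smooth_on_sub (sf.2 c d Cc Dd).
  by move=> z [/= iz [Uz []]].
apply: smooth_on_sub (sg.2 c d' Cc Dd').
by move=> z [/= iz [Uz []]].
Qed.

Lemma prod_charts : is_charts C -> is_charts D -> is_charts (prod_atlas C D).
Proof.
move=> cC cD; split.
- move=> _ [c Cc [d Dd <-]].
  have pc := charts_phomeo cC Cc; have pd := charts_phomeo cD Dd.
  split=> /=.
  + by move=> x [/= ? ?]; split;
    [exact: phomeo_fwd pc _ _|exact: phomeo_fwd pd _ _].
  + by move=> x [/= ? ?]; split;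
    [exact: phomeo_bwd pc _ _|exact: phomeo_bwd pd _ _].
  + by move=> [x y] [/= ? ?]; rewrite (phomeo_fwdK pc)// (phomeo_fwdK pd).
  + by move=> [x y] [/= ? ?]; rewrite (phomeo_bwdK pc)// (phomeo_bwdK pd).
  + apply/subspace_continuousP => -[x y] [/= dx dy] S [[S1 S2] /= [xS1 yS2]
    S12].
    have [V1 [oV1 xV1 V1S]] := within_open_preimage
      (phomeo_fwd_continuous pc) (open_interior S1) dx xS1.
    have [V2 [oV2 xV2 V2S]] := within_open_preimage
      (phomeo_fwd_continuous pd) (open_interior S2) dy yS2.
    exists (V1, V2) => /=; first by split; exact: open_nbhs_nbhs.
    move=> [u v] [/= V1u V2v] [/= du dv]; apply: S12; split => /=.
      by apply: nbhs_singleton; exact: V1S.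
    by apply: nbhs_singleton; exact: V2S.
  + apply/subspace_continuousP => -[x y] [/= dx dy] S [[S1 S2] /= [xS1 yS2]
    S12].
    have [V1 [oV1 xV1 V1S]] := within_open_preimage
      (phomeo_bwd_continuous pc) (open_interior S1) dx xS1.
    have [V2 [oV2 xV2 V2S]] := within_open_preimage
      (phomeo_bwd_continuous pd) (open_interior S2) dy yS2.
    exists (V1, V2) => /=; first by split; exact: open_nbhs_nbhs.
    move=> [u v] [/= V1u V2v] [/= du dv]; apply: S12; split => /=.
      by apply: nbhs_singleton; exact: V1S.
    by apply: nbhs_singleton; exact: V2S.
- move=> _ [c Cc [d Dd <-]] /=.
  rewrite openE => -[x y] [/= dx dy]; exists (dom c, dom d) => //=.
  by split; apply: open_nbhs_nbhs; split => //;
    [exact: (charts_open cC)|exact: (charts_open cD)].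
- move=> [x y]; have [c Cc cx] := charts_cover cC x.
  have [d Dd dy] := charts_cover cD y.
  by exists (prod_pbij c d) => //; exists c => //; exists d.
Qed.

Lemma smooth_map_fst (A : set E) U : is_atlas A C ->
  smooth_map (prod_atlas C D) C U fst.
Proof.
move=> aC; split; first by apply: continuous_subspaceT => p; exact: cvg_fst.
move=> _ c' [c Cc [d Dd <-]] Cc' /=.
apply: (@smooth_on_comp _ _ _ _ _ (img c `&` bwd c @^-1` dom c') fst
  (fwd c' \o bwd c)) => //.
- by move=> [x y] [[/= ix iy] [_ dx]].
- exact: (atlas_compatible aC).
- by apply: smooth_on_lin => //; exact: clinear_fst.
Qed.

Lemma smooth_map_snd (B : set F) U : is_atlas B D ->
  smooth_map (prod_atlas C D) D U snd.
Proof.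
move=> aD; split; first by apply: continuous_subspaceT => p; exact: cvg_snd.
move=> _ d' [c Cc [d Dd <-]] Dd' /=.
apply: (@smooth_on_comp _ _ _ _ _ (img d `&` bwd d @^-1` dom d') snd
  (fwd d' \o bwd d)) => //.
- by move=> [x y] [[/= ix iy] [_ dx]].
- exact: (atlas_compatible aD).
- by apply: smooth_on_lin => //; exact: clinear_snd.
Qed.

(** Smoothness may be tested in one pair of charts around each point: the
    coordinate changes at both ends are smooth. *)
Lemma smooth_map_chart (A : set E) (B : set F) U (f : X -> Y) :
  is_atlas A C -> is_atlas B D -> open U ->
  (forall x, U x -> {for x, continuous f}) ->
  (forall x, U x -> exists c d O, [/\ C c, D d, open O /\ O x,
      O `<=` U `&` dom c `&` f @^-1` dom d &
      smooth_on (img c `&` bwd c @^-1` O) (fwd d \o f \o bwd c)]) ->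
  smooth_map C D U f.
Proof.
move=> aC aD oU cf h; split; first exact/within_open_continuousP.
move=> c' d' Cc' Dd'; apply: smooth_on_local => y [/= iy [Uy dy]].
have [c [d [ O [Cc Dd [oO Oy] OU sO]]]] := h _ Uy.
pose V := O `&` (U `&` f @^-1` dom d').
have oV : open V.
  apply: openI => //; apply: open_preimage_in => //.
  exact: (atlas_dom_open aD).
have pc' := atlas_phomeo aC Cc'.
have pc := atlas_phomeo aC Cc.
have pd := atlas_phomeo aD Dd.
have [W [oW Wy WV]] := within_open_preimage
  (phomeo_bwd_continuous pc') oV iy (conj Oy (conj Uy dy)).
exists W => //.
have inc z : img c' z -> W z -> dom c (bwd c' z) /\ dom d (f (bwd c' z)).
  by move=> iz Wz; have [Oz _] := WV z iz Wz; have [[_ cz] dz] := OU _ Oz.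
apply: (@smooth_on_eq _ _ _ _ ((fwd d' \o bwd d) \o
  ((fwd d \o f \o bwd c) \o (fwd c \o bwd c')))).
  move=> z [[/= iz _] Wz]; have [cz dz] := inc z iz Wz.
  by rewrite (phomeo_fwdK pc)// (phomeo_fwdK pd).
apply: (smooth_on_comp hF hF _ (atlas_compatible aD Dd Dd')).
  move=> z [[/= iz [_ dz']] Wz]; have [cz dz] := inc z iz Wz.
  rewrite (phomeo_fwdK pc)//; split; first exact: (phomeo_fwd pd).
  by rewrite /= (phomeo_fwdK pd).
apply: (smooth_on_comp hE hF _ sO).
  move=> z [[/= iz _] Wz]; have [cz dz] := inc z iz Wz.
  split; first exact: (phomeo_fwd pc).
  by rewrite /= (phomeo_fwdK pc)//; have [] := WV z iz Wz.
apply: smooth_on_sub (atlas_compatible aC Cc' Cc).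
by move=> z [[/= iz _] Wz]; have [cz dz] := inc z iz Wz.
Qed.

End SmoothMaps.

Section VectorValued.
Context {R : realType} {X Y : topologicalType} {E F : tvsType R}.
Context {C : set (pbij X E)} {D : set (pbij Y F)}.
Hypotheses (hE : hausdorff_space E) (hF : hausdorff_space F).

(** Maps into a locally convex space, which carries no atlas here. *)
Definition smoothE (C : set (pbij X E)) (U : set X) (psi : X -> F) : Prop :=
  forall c, C c -> smooth_on (img c `&` bwd c @^-1` U) (psi \o bwd c).

Lemma smoothE_sub U V psi : V `<=` U -> smoothE C U psi -> smoothE C V psi.
Proof.
move=> VU s c Cc; apply: smooth_on_sub (s c Cc) => y [/= iy Vy].
by split => //; exact: VU.
Qed.

Lemma smoothE_eq U psi psi' : (forall x, U x -> psi x = psi' x) ->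
  smoothE C U psi -> smoothE C U psi'.
Proof.
move=> e s c Cc; apply: smooth_on_eq (s c Cc) => y [/= iy Uy].
exact: e.
Qed.

Lemma smoothE_local U psi : is_charts C ->
  (forall x, U x -> exists V, [/\ open V, V x & smoothE C (U `&` V) psi]) ->
  smoothE C U psi.
Proof.
move=> cC h c Cc; apply: smooth_on_local => y [/= iy Uy].
have [V [oV Vx s]] := h _ Uy.
have [W [oW Wy WV]] := within_open_preimage
  (phomeo_bwd_continuous (charts_phomeo cC Cc)) oV iy Vx.
exists W => //; apply: smooth_on_sub (s c Cc) => z [[/= iz Uz] Wz].
by split => //; split => //; exact: WV.
Qed.

Lemma smooth_map_smoothE U (f : X -> Y) d : D d ->
  (forall x, U x -> dom d (f x)) -> smooth_map C D U f ->
  smoothE C U (fwd d \o f).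
Proof.
move=> Dd Ud [_ s] c Cc; apply: smooth_on_sub (s c d Cc Dd).
by move=> y [/= iy Uy]; split => //; split => //; exact: Ud.
Qed.

Lemma smoothE_smooth_map (A : set E) U psi d :
  is_atlas A C -> is_atlas [set: F] D -> D d -> open U ->
  (forall x, U x -> {for x, continuous psi}) ->
  (forall x, U x -> img d (psi x)) -> smoothE C U psi ->
  smooth_map C D U (bwd d \o psi).
Proof.
move=> aC aD Dd oU cpsi Ud s; have pd := atlas_phomeo aD Dd.
have oid : open (img d).
  by have [W oW ->] := atlas_img_open aD Dd; rewrite setTI.
apply: (smooth_map_chart hE hF aC aD) => //.
  move=> x Ux; apply: continuous_comp; first exact: cpsi.
  apply: (iffLR (within_open_continuousP _ oid)); last exact: Ud.
  exact: phomeo_bwd_continuous pd.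
move=> x Ux; have [c Cc cx] := atlas_cover aC x.
exists c, d, (U `&` dom c); split => //.
- by split => //; apply: openI => //; exact: (atlas_dom_open aC).
- by move=> z [Uz dz]; split => //; apply: (phomeo_bwd pd); exact: Ud.
- apply: (@smooth_on_eq _ _ _ _ (psi \o bwd c)).
    by move=> y [/= iy [Uy _]]; rewrite (phomeo_bwdK pd)//; exact: Ud.
  by apply: smooth_on_sub (s c Cc) => y [/= iy [Uy _]].
Qed.

Lemma smoothE_cst U (a : F) : smoothE C U (fun=> a).
Proof. by move=> c Cc; exact: smooth_on_cst. Qed.

Lemma smoothE_add U (f g : X -> F) : smoothE C U f -> smoothE C U g ->
  smoothE C U (fun x => f x + g x).
Proof.
move=> sf sg c Cc.
exact: (@smooth_on_add _ _ _ _ (f \o bwd c) (g \o bwd c) hF (sf c Cc)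
  (sg c Cc)).
Qed.

End VectorValued.

Lemma smoothE_scale (R : realType) (X : topologicalType) (E F : tvsType R)
  (C : set (pbij X E)) U (k : X -> R^o) (f : X -> F) : hausdorff_space F ->
  smoothE C U k -> smoothE C U f -> smoothE C U (fun x => (k x : R) *: f x).
Proof.
move=> hF sk sf c Cc.
exact: (@smooth_on_scale _ _ _ _ (k \o bwd c) (f \o bwd c) hF (sk c Cc)
  (sf c Cc)).
Qed.

(** * Finite subcovers *)

Section Compactness.
Context {X : topologicalType}.

(** The near-covering property is applied along the filter of the finite
    sequences of points of A, ordered by inclusion. *)
Lemma compact_cover_seq (A : set X) (N : X -> set X) : compact A ->
  (forall x, A x -> nbhs x (N x)) ->
  exists s : seq X, (forall x, x \in s -> A x) /\
    forall y, A y -> exists2 x, x \in s & N x y.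
Proof.
move=> cA nN; pose I := seq X.
pose Q : set_system I := [set S | exists2 s0 : seq X,
  (forall x, x \in s0 -> A x) & forall s : seq X,
    (forall x, x \in s -> A x) -> {subset s0 <= s} -> S s].
have FQ : Filter Q.
  split.
  - by exists [::].
  - move=> S T [s hs sS] [t ht tT]; exists (s ++ t).
      by move=> x; rewrite mem_cat => /orP[/hs|/ht].
    move=> u hu stu; split.
      by apply: sS => // x xs; apply: stu; rewrite mem_cat xs.
    by apply: tT => // x xt; apply: stu; rewrite mem_cat xt orbT.
  - by move=> S T ST [s hs sS]; exists s => // t ht /sS - /(_ ht)/ST.
have := (compact_near_coveringP A).1 cA I Q
  (fun s y => exists2 x, x \in s & N x y) FQ.
case=> [x Ax|s hs h].
  exists (N x, [set s : seq X | x \in s]) => /=.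
    split; first exact: nN.
    exists [:: x] => [y|s hs xs /=]; first by rewrite inE => /eqP->.
    by apply: xs; rewrite inE.
  by move=> [y s] [/= Ny xs]; exists x.
by exists s; split => // y Ay; exact: (h s hs _ y Ay).
Qed.

Lemma compact_bigcup_seq (s : seq X) (B : X -> set X) :
  (forall x, x \in s -> compact (B x)) ->
  compact [set y | exists2 x, x \in s & B x y].
Proof.
elim: s => [_|a s IH cB].
  rewrite (_ : mkset _ = set0); first exact: compact0.
  by apply/seteqP; split=> y // -[].
rewrite (_ : mkset _ = B a `|` [set y | exists2 x, x \in s & B x y]).
  apply: compactU; first by apply: cB; rewrite mem_head.
  by apply: IH => x xs; apply: cB; rewrite inE xs orbT.
apply/seteqP; split=> [y [x]|y [Ba|[x xs Bx]]].
- rewrite inE => /orP[/eqP->|xs Bx]; first by left.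
  by right; exists x.
- by exists a => //; rewrite mem_head.
- by exists x => //; rewrite inE xs orbT.
Qed.

End Compactness.

(** * Cut-off functions on a manifold with corners *)

Section CornerManifold.
Context {R : realType} {d : nat} (M : cornerManifold R d).

Let CM := cm_atlas M.
Let aM : is_atlas (@orthant R d) CM := cm_atlasP M.

Lemma closed_orthant : closed (@orthant R d).
Proof.
rewrite (_ : @orthant R d = \bigcap_(i in [set: 'I_d])
    ((fun x : 'rV[R]_d => x ord0 i) @^-1` [set t : R | 0 <= t])).
  apply: closed_bigI => i _; apply: closed_comp.
    by move=> x _; exact: coord_continuous.
  exact: closed_ge.
by apply/seteqP; split=> [x h i _|x h i]; [exact: h|exact: h i I].
Qed.

(** A cut-off function of R^d in a chart, extended by 0. Its support is compact
    in M because the orthant is closed, hence closed since M is Hausdorff, and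
    the extension by 0 is smooth. *)
Lemma exists_cutoff (x : M) (U : set M) : open U -> U x ->
  exists (chi : M -> R^o) (V B : set M),
    [/\ smoothE CM setT chi /\ continuous chi, forall y, 0 <= (chi y : R) <= 1,
        open V /\ V x, forall y, V y -> chi y = 1 &
        [/\ compact B, B `<=` U & forall y, ~ B y -> chi y = 0]].
Proof.
move=> oU Ux; have [c Cc cx] := atlas_cover aM x.
have hR := @norm_hausdorff R R^o.
have hV := @norm_hausdorff R 'rV[R]_d.
have pc := atlas_phomeo aM Cc; have oc := atlas_dom_open aM Cc.
have [W oW imgW] := atlas_img_open aM Cc.
have cfwd y : dom c y -> {for y, continuous (fwd c)}.
  by move: y; apply/within_open_continuousP => //;
    exact: phomeo_fwd_continuous pc.
have ix := phomeo_fwd pc cx.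
have bx : U (bwd c (fwd c x)) by rewrite (phomeo_fwdK pc).
have [W' [oW' W'x W'U]] := within_open_preimage
  (phomeo_bwd_continuous pc) oU ix bx.
have Wx : W (fwd c x) by move: ix; rewrite imgW => -[].
have [b [V0 [B0 [[sb cb] b01 [oV0 V0x] bV0 [cB0 B0W b0]]]]] :=
  exists_bump (openI oW oW') (conj Wx W'x).
pose chi y : R^o := if pselect (dom c y) then b (fwd c y) else 0.
pose B := bwd c @` (B0 `&` @orthant R d).
have BU : B `<=` U.
  by move=> _ [z [/B0W[Wz W'z] Az] <-]; apply: W'U => //; rewrite imgW.
have Bc : B `<=` dom c.
  by move=> _ [z [/B0W[Wz W'z] Az] <-]; apply: (phomeo_bwd pc); rewrite imgW.
have cB : compact B.
  apply: continuous_compact.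
    apply: continuous_subspaceW (phomeo_bwd_continuous pc).
    by move=> z [/B0W[Wz W'z] Az]; rewrite imgW.
  exact: compact_closedI cB0 closed_orthant.
have clB : closed B by apply: compact_closed => //; exact: cm_hausdorff.
have chi0 y : ~ B y -> chi y = 0.
  rewrite /chi; case: pselect => // cy nBy; apply: b0 => B0y; apply: nBy.
  exists (fwd c y); last exact: (phomeo_fwdK pc).
  by split=> //; have := phomeo_fwd pc cy; rewrite imgW => -[].
have chiE y : dom c y -> chi y = b (fwd c y).
  by rewrite /chi; case: pselect.
exists chi, (dom c `&` fwd c @^-1` V0), B; split.
- split.
    apply: (smoothE_local (atlas_charts aM)) => y _.
    have [cy|ncy] := pselect (dom c y).
      exists (dom c); split => // c' Cc'; rewrite setTI.
      apply: (@smooth_on_eq _ _ _ _ (b \o (fwd c \o bwd c'))).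
        by move=> z [/= _ cz]; rewrite chiE.
      apply: (smooth_on_comp hV hR _ sb) => //.
      exact: (atlas_compatible aM Cc' Cc).
    exists (~` B); split; first exact: closed_openC.
      by move/Bc.
    rewrite setTI; apply: (@smoothE_eq _ _ _ _ _ _ (fun=> 0)).
      by move=> z /chi0.
    exact: smoothE_cst.
  move=> y; have [cy|ncy] := pselect (dom c y).
    apply: (open_eq_continuous oc cy (f := b \o fwd c)).
      by move=> z /chiE.
    by apply: continuous_comp; [exact: cfwd|exact: cb].
  apply: (@open_eq_continuous _ _ (~` B) (fun=> 0)).
  + exact: closed_openC.
  + by move/Bc.
  + by move=> z /chi0.
  + exact: cvg_cst.
- move=> y; have [cy|ncy] := pselect (dom c y); first by rewrite chiE.
  by rewrite chi0 ?lexx ?ler01// => /Bc.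
- split; last by split.
  exact: open_preimage_in.
- by move=> y [cy Vy]; rewrite chiE// bV0.
- by split.
Qed.

(** * Smoothing vector-valued functions *)

Lemma exists_compact_nbhs (A U : set M) : compact A -> open U -> A `<=` U ->
  exists (V B : set M), [/\ open V, A `<=` V, V `<=` B, compact B & B `<=` U].
Proof.
move=> cA oU AU.
have h x : exists VB : set M * set M, A x ->
    [/\ open VB.1 /\ VB.1 x, VB.1 `<=` VB.2, compact VB.2 & VB.2 `<=` U].
  have [Ax|nA] := pselect (A x); last by exists (setT, setT).
  have [chi [V [B [_ _ oV chi1 [cB BU chi0]]]]] := exists_cutoff oU (AU _ Ax).
  exists (V, B) => _; split=> // y /= Vy; apply: contrapT => nBy.
  have := chi1 _ Vy; rewrite chi0// => /eqP.
  by rewrite eq_sym oner_eq0.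
have [VB hVB] := choice h.
have [|s [sA As]] := @compact_cover_seq M A (fun x => (VB x).1) cA.
  by move=> x /hVB[[oV Vx] _ _ _]; exact: open_nbhs_nbhs.
exists [set y | exists2 x, x \in s & (VB x).1 y],
  [set y | exists2 x, x \in s & (VB x).2 y]; split => //.
- rewrite openE => y [x xs Vy]; have [[oV _] _ _ _] := hVB x (sA _ xs).
  have := open_nbhs_nbhs (conj oV Vy); apply: filterS => z Vz.
  by exists x.
- move=> y [x xs Vy]; exists x => //.
  by have [_ VB' _ _] := hVB x (sA _ xs); exact: VB'.
- by apply: compact_bigcup_seq => x /sA/hVB[].
- by move=> y [x /sA/hVB[_ _ _ BU] /BU].
Qed.

(** Only finitely many constants are mixed in, over small neighbourhoods on
    which psi varies little. The invariant psi' - psi \in Q, for one convex Q,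
    survives each step, and Q is chosen so small that the graph of psi + Q over
    the relevant compact set lies in Om. *)
Lemma smoothing_vector (F : tvsType R) (U N C A : set M) (psi : M -> F)
    (Om : set (M * F)) :
  hausdorff_space F -> open U -> (forall x, U x -> {for x, continuous psi}) ->
  open N -> N `<=` U -> smoothE CM N psi ->
  closed C -> C `&` U `<=` N -> compact A -> A `<=` U ->
  open Om -> (forall x, U x -> Om (x, psi x)) ->
  exists (psi' : M -> F) (B W : set M),
  [/\ compact B /\ B `<=` U, forall x, C x \/ ~ B x -> psi' x = psi x,
      forall x, U x -> {for x, continuous psi'} /\ Om (x, psi' x),
      [/\ open W, A `<=` W, N `<=` W & W `<=` U] & smoothE CM W psi'].
Proof.
move=> hF oU cpsi oN NU sN clC CN cA AU oOm Ompsi.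
pose A1 := A `&` ~` N.
have cA1 : compact A1 by apply: compact_closedI => //; exact: open_closedC.
have A1U : A1 `<=` U `&` ~` C.
  by move=> x [Ax Nx]; split; [exact: AU|move=> Cx; apply/Nx/CN; split=> //;
    exact: AU].
have [V [B [oV A1V VB cB BU]]] :=
  exists_compact_nbhs cA1 (openI oU (closed_openC clC)) A1U.
(* A uniform amount by which psi may be moved without leaving Om over B. *)
have [Q [cQ oQ Q0 QOm]] : exists Q : set F, [/\ convex_subset Q, open Q, Q 0 &
    forall q, Q q -> forall x, B x -> Om (x, psi x + q)].
  have /nbhs_convex_subset[Q [cQ oQ Q0 QP]] : nbhs (0 : F)
      [set q | B `<=` fun x => Om (x, psi x + q)].
    apply: ((compact_near_coveringP B).1 cB F (nbhs 0)
      (fun q x => Om (x, psi x + q))) => x Bx.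
    have [Ux _] := BU _ Bx.
    have c2 : (p.1, psi p.1 + p.2) @[p --> (x, (0 : F))] --> (x, psi x + 0).
      have c1 : p.1 @[p --> (x, (0 : F))] --> x by exact: cvg_fst.
      apply: (cvg_pair c1); apply: tcvgD; last exact: cvg_snd.
      exact: (cvg_comp _ _ c1 (cpsi _ Ux)).
    have := c2 Om; apply; rewrite addr0; apply: open_nbhs_nbhs.
    by split => //; exact: Ompsi.
  by exists Q; split => // q Qq; exact: QP.
(* Over Ox x the constant psi x is an admissible replacement of psi. *)
pose Ox x := V `&` (U `&` (fun y => psi x - psi y) @^-1` Q).
have h x : exists t : (M -> R^o) * set M, A1 x ->
    [/\ smoothE CM setT t.1 /\ continuous t.1, forall y, 0 <= (t.1 y : R) <= 1,
        open t.2 /\ t.2 x, forall y, t.2 y -> t.1 y = 1 &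
        forall y, ~ Ox x y -> t.1 y = 0].
  have [Ax|nA] := pselect (A1 x); last by exists (fun=> 0, setT).
  have oO : open (Ox x).
    apply: openI => //; apply: open_preimage_in => // y Uy.
    by apply: tcvgB; [exact: cvg_cst|exact: cpsi].
  have Oxx : Ox x x.
    split; first exact: A1V.
    by split; [have [] := A1U _ Ax|rewrite /= subrr].
  have [chi [V' [B' [s1 s2 s3 s4 [_ B'O s5]]]]] := exists_cutoff oO Oxx.
  exists (chi, V') => _; split => // y nO; apply: s5 => /B'O.
  exact: nO.
have {h}[t ht] := choice h.
have [|s [sA As]] := @compact_cover_seq M A1 (fun x => (t x).2) cA1.
  by move=> x /ht[_ _ [oV' V'x] _ _]; exact: open_nbhs_nbhs.
have mix : forall l : seq M, (forall x, x \in l -> A1 x) ->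
    exists psi' : M -> F, [/\ forall y, ~ B y -> psi' y = psi y,
      forall y, U y -> {for y, continuous psi'},
      forall y, Q (psi' y - psi y) &
      smoothE CM (N `|` [set y | exists2 x, x \in l & (t x).2 y]) psi'].
  elim=> [_|x l IH lA].
    exists psi; split => // [y|]; first by rewrite subrr.
    by apply: smoothE_sub sN => y [//|[]].
  have [|psi1 [p1 p2 p3 p4]] := IH.
    by move=> y yl; apply: lA; rewrite inE yl orbT.
  have [[schi cchi] chi01 [oV' V'x] chi1 chi0] := ht x (lA x (mem_head _ _)).
  set chi := (t x).1 in schi cchi chi01 chi1 chi0.
  exists (fun y => (1 - chi y : R) *: psi1 y + (chi y : R) *: psi x); split.
  - move=> y nB; rewrite chi0; last by move=> [/VB].
    by rewrite subr0 scale1r scale0r addr0 p1.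
  - move=> y Uy; have cc : (chi z : R) @[z --> y] --> (chi y : R) := cchi y.
    apply: tcvgD; last by apply: tcvgZ; [exact: cc|exact: cvg_cst].
    apply: tcvgZ; last exact: p2.
    by apply: (@cvgB _ R^o); [exact: cvg_cst|exact: cc].
  - move=> y; have [[_ [Uy Qy]]|nO] := pselect (Ox x y); last first.
      by rewrite chi0// subr0 scale1r scale0r addr0.
    have /andP[c0 c1] := chi01 y.
    have := cQ _ _ (chi y) Qy (p3 y) c0 c1.
    rewrite !scalerBr addrACA -opprD -scalerDl [chi y + _]addrC subrK scale1r.
    by rewrite [X in Q (X - _)]addrC.
  - apply: (smoothE_local (atlas_charts aM)) => y Wy.
    (* Near the centre x the new map is constant; elsewhere it is a combination
       of maps that are smooth already. *)
    have [Vy|nVy] := pselect ((t x).2 y).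
      exists (t x).2; split => //.
      apply: (@smoothE_eq _ _ _ _ _ _ (fun=> psi x)).
        by move=> z [_ Vz]; rewrite chi1// subrr scale0r add0r scale1r.
      exact: smoothE_cst.
    have oW : open (N `|` [set y | exists2 x, x \in l & (t x).2 y]).
      apply: openU => //; rewrite openE => z [u ul tz].
      have [_ _ [ov _] _ _] := ht u (lA u (mem_behead (s := x :: l) ul)).
      have := open_nbhs_nbhs (conj ov tz); apply: filterS => w tw.
      by exists u.
    exists (N `|` [set y | exists2 x, x \in l & (t x).2 y]); split => //.
      case: Wy => [|[u]]; first by left.
      by rewrite inE => /orP[/eqP->//|ul tu]; right; exists u.
    set W := (W in smoothE _ W).
    have WW : W `<=` N `|` [set y | exists2 x, x \in l & (t x).2 y].
      by move=> z [].
    have sc : smoothE CM W chi by exact: smoothE_sub schi.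
    have hR := @norm_hausdorff R R^o.
    apply: smoothE_add => //; apply: smoothE_scale => //.
    + apply: smoothE_add => //; first exact: smoothE_cst.
      apply: (@smoothE_eq _ _ _ _ _ _ (fun y => (-1 : R) *: chi y)).
        by move=> z _; rewrite scaleN1r.
      by apply: smoothE_scale => //; exact: smoothE_cst.
    + exact: smoothE_sub p4.
    + exact: smoothE_cst.
have [psi' [p1 p2 p3 p4]] := mix s sA.
exists psi', B, (N `|` ([set y | exists2 x, x \in s & (t x).2 y] `&` U)); split.
- by split => // x /BU[].
- move=> x [Cx|]; last exact: p1.
  by apply: p1 => /BU[].
- move=> x Ux; split; first exact: p2.
  have [Bx|nB] := pselect (B x); last by rewrite p1//; exact: Ompsi.
  by rewrite -[psi' x](subrK (psi x)) addrC; exact: QOm.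
- split.
  + apply: openU => //; apply: openI => //; rewrite openE => z [u us tz].
    have [_ _ [ov _] _ _] := ht u (sA u us).
    have := open_nbhs_nbhs (conj ov tz); apply: filterS => w tw.
    by exists u.
  + move=> x Ax; have [Nx|nNx] := pselect (N x); first by left.
    right; split; last exact: AU.
    exact: As.
  + by move=> x; left.
  + by move=> x [/NU|[]].
- by apply: smoothE_sub p4 => x [|[]]; [left|right].
Qed.

End CornerManifold.

(** * Countable covers of connected paracompact spaces *)

Section CountableCover.
Context {X : topologicalType}.

Lemma locally_finite_compact (D : set (set X)) (A : set X) :
  locally_finite D -> compact A ->
  finite_set [set V | D V /\ V `&` A !=set0].
Proof.
move=> lD cA.
have h (x : X) : exists N :
  set X, nbhs x N /\ finite_set [set V | D V /\ V `&` N !=set0].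
  by have [N nN fN] := lD x; exists N.
have [N hN] := choice h.
have [|s [_ As]] := @compact_cover_seq X A N cA; first by move=> x _;
  exact: (hN x).1.
apply: (@sub_finite_set _ _ (\bigcup_(x in [set` s])
  [set V | D V /\ V `&` N x !=set0])).
  move=> V [DV [y [Vy /As[x xs Nxy]]]]; exists x => //; split => //.
  by exists y.
by apply: bigcup_finite => [|x _]; [exact: finite_seq|exact: (hN x).2].
Qed.

Lemma countable_enum (T : Type) (S : set T) (x0 : T) : countable S -> S x0 ->
  exists e : nat -> T, (forall n, S (e n)) /\ forall x, S x ->
    exists n, e n = x.
Proof.
move=> /countable_injP[f injf] Sx0.
exists (fun n => if pselect (exists x, S x /\ f x = n) is left h then projT1
  (cid h) else x0).
split=> [n|x Sx]; first by case: pselect => // h; case: (cid h) => x [].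
exists (f x); case: pselect => [h|[]]; last by exists x.
case: (cid h) => y [/= Sy fy]; apply: injf => //; exact/mem_set.
Qed.

(** Each compact set meets finitely many members of a locally finite cover, so
    that the members which a finite chain of intersections links to a given
    one are countably many; their union is open and closed. *)
Lemma countable_compact_cover (P : set X -> Prop) :
  connected [set: X] -> paracompact X -> P set0 ->
  (forall x : X, exists A : set X, [/\ compact A, nbhs x A & P A]) ->
  exists A : nat -> set X, (forall n, compact (A n) /\ P (A n)) /\
    forall x : X, exists n, nbhs x (A n).
Proof.
move=> conX pX P0 /choice[A hA].
have [[x0 _]|e] := pselect ([set: X] !=set0); last first.
  exists (fun=> set0); split => [n|x]; first by split => //; exact: compact0.
  by exfalso; apply: e; exists x.
have [|D [cD rD lD]] := pX [set interior (A x) | x in setT].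
  split; first by move=> _ [x _ <-]; exact: open_interior.
  by move=> x; exists (interior (A x)); [exists x|have [] := hA x].
have sub V : D V -> exists x, V `<=` A x.
  move=> /rD[_ [x _ <-] VA]; exists x; apply: subset_trans VA _.
  exact: interior_subset.
have [V0 DV0 V0x0] := cD.2 x0.
pose next V := [set V' | D V' /\ V' `&` V !=set0].
have fnext V : D V -> finite_set (next V).
  move=> /sub[x VA]; have [cA _ _] := hA x.
  apply: sub_finite_set (locally_finite_compact lD cA).
  by move=> V' [DV' [y [V'y Vy]]]; split => //; exists y; split => //;
    exact: VA.
pose G := fix G n := if n is n'.+1 then \bigcup_(V in G n') next V else [set
  V0].
have GD n : G n `<=` D by case: n => [|n] V; [move=> ->|move=> [V' _ []]].
have fG n : finite_set (G n).
  elim: n => [|n IH]; first exact: finite_set1.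
  by apply: bigcup_finite => // V /GD; exact: fnext.
pose S := \bigcup_n G n.
have SD V : S V -> D V by move=> [n _ /GD].
have cS : countable S.
  by apply: bigcup_countable => // n _; exact: finite_set_countable.
pose O := \bigcup_(V in S) V.
have oO : open O by apply: bigcup_open => V /SD; exact: cD.1.
have cO : closed O.
  rewrite -(setCK O); apply: open_closedC; rewrite openE => x nOx.
  have [V DV Vx] := cD.2 x.
  have := open_nbhs_nbhs (conj (cD.1 _ DV) Vx);
    apply: filterS => y Vy [V' [n _ GV'] V'y].
  apply: nOx; exists V => //; exists n.+1 => //; exists V' => //.
  by split => //; exists y.
have OT : O = setT.
  apply: conX.
  - by exists x0, V0 => //; exists 0%N.
  - by exists O => //; rewrite setTI.
  - by exists O => //; rewrite setTI.
have [e [eS eE]] : exists e : nat -> set X,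
    (forall n, S (e n)) /\ forall x, S x -> exists n, e n = x.
  by apply: (countable_enum (x0 := V0) cS); exists 0%N.
have /choice[g hg] : forall n, exists x, e n `<=` A x.
  by move=> n; exact/sub/SD.
exists (fun n => A (g n)); split=> [n|x]; first by have [] := hA (g n).
have : O x by rewrite OT.
move=> [V SV Vx]; have [n en] := eE V SV; exists n.
have oV : open V by apply/cD.1/SD.
have := open_nbhs_nbhs (conj oV Vx); apply: filterS; rewrite -en.
exact: hg.
Qed.

End CountableCover.

Section DependentChoice.

(** Dependent choice with an invariant I that depends on the stage. *)
Lemma dependent_choice_nat (S : Type) (I : nat -> S -> Prop)
    (Q : nat -> S -> S -> Prop) (s0 : S) :
  I 0%N s0 -> (forall n s, I n s -> exists s', I n.+1 s' /\ Q n s s') ->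
  exists u : nat -> S, [/\ u 0%N = s0, forall n, I n (u n) &
    forall n, Q n (u n) (u n.+1)].
Proof.
move=> I0 step.
have h (ns : nat * S) : exists s', I ns.1 ns.2 ->
    I ns.1.+1 s' /\ Q ns.1 ns.2 s'.
  have [Is|nI] := pselect (I ns.1 ns.2); last by exists s0.
  by have [s' hs'] := step _ _ Is; exists s'.
have [g hg] := choice h.
pose u := fix u n := if n is n'.+1 then g (n', u n') else s0.
have Iu n : I n (u n).
  by elim: n => // n IH; have [] := hg (n, u n) IH.
by exists u; split => // n; have [] := hg (n, u n) (Iu n).
Qed.

End DependentChoice.

(** * Maps into a Lie group *)

Section GroupValued.
Context {R : realType} {X : topologicalType} {F E : tvsType R}.
Context {C : set (pbij X F)} {K : lieGroup E}.
Hypotheses (hE : hausdorff_space E) (cC : is_charts C).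
Let CK := lg_atlas K.
Let aK : is_atlas [set: E] CK := lg_atlasP K.

Lemma smooth_mulK U (f g : X -> K) : open U ->
  smooth_map C CK U f -> smooth_map C CK U g ->
  smooth_map C CK U (fun x => (f x * g x)%g).
Proof.
move=> oU sf sg; have cK := atlas_charts aK.
apply: (@smooth_map_comp R X (K * K)%type K F (E * E)%type E C
  (prod_atlas CK CK) CK _ hE U setT (fun x => (f x, g x))
  (fun x => (x.1 * x.2)%g)) => //.
- exact: hausdorff_prod.
- exact: prod_charts.
- exact: openT.
- exact: (charts_open cK).
- exact: lg_mul_smooth.
- exact: smooth_map_pair.
Qed.

Lemma smooth_invK U (f : X -> K) : open U ->
  smooth_map C CK U f -> smooth_map C CK U (fun x => (f x)^-1%g).
Proof.
move=> oU sf; have cK := atlas_charts aK.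
apply: (@smooth_map_comp R X K K F E E C CK CK hE hE U setT f
  (fun x => x^-1%g)) => //.
- exact: openT.
- exact: (charts_open cK).
- exact: lg_inv_smooth.
Qed.

End GroupValued.

Section TopologicalGroup.
Context {R : realType} {E : tvsType R} {K : lieGroup E}.

Lemma continuous_mulK (p : K * K) :
  {for p, continuous (fun x : K * K => (x.1 * x.2)%g)}.
Proof.
have [/within_open_continuousP h _] := lg_mul_smooth K.
by apply: h => //; exact: openT.
Qed.

Lemma continuous_invK (x : K) : {for x, continuous (fun x : K => x^-1%g)}.
Proof.
have [/within_open_continuousP h _] := lg_inv_smooth K.
by apply: h => //; exact: openT.
Qed.

Lemma cvg_mulK (T : Type) (Q : set_system T) (f g : T -> K) a b : Filter Q ->
  f @ Q --> a -> g @ Q --> b -> (f x * g x)%g @[x --> Q] --> (a * b)%g.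
Proof.
by move=> FQ fa gb; exact: (cvg_comp _ _ (cvg_pair fa gb) (@continuous_mulK
  (a, b))).
Qed.

Lemma cvg_invK (T : Type) (Q : set_system T) (f : T -> K) a : Filter Q ->
  f @ Q --> a -> (f x)^-1%g @[x --> Q] --> a^-1%g.
Proof. by move=> FQ fa; exact: (cvg_comp _ _ fa (@continuous_invK a)). Qed.

End TopologicalGroup.

(** * Trivializations and vertical maps *)

Definition triv_of (K : preTopologicalGroupType) (M : topologicalType)
  (P : principalBundle K M) : Type := (set M * pbij P (M * K))%type.

Section Trivializations.
Context {R : realType} {E : tvsType R} {K : lieGroup E}.
Context {M : topologicalType}.
Implicit Types P : principalBundle K M.

Definition is_triv P (t : triv_of P) : Prop :=
  is_trivialization (@pb_act _ _ P) (@pb_proj _ _ P) t.1 t.2.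

Definition unit_section P (t : triv_of P) (x : M) : P := bwd t.2 (x, 1%g).
Definition fiber_coord P (t : triv_of P) (p : P) : K := (fwd t.2 p).2.

Section OneTrivialization.
Context {P : principalBundle K M} {t : triv_of P}.
Implicit Types p q : P.
Hypothesis ht : is_triv t.

Let ph := triv_phomeo ht.

Lemma triv_domP p : dom t.2 p <-> t.1 (pb_proj p).
Proof. by rewrite (triv_dom ht). Qed.

Lemma triv_imgP y : img t.2 y <-> t.1 y.1.
Proof. by rewrite (triv_img ht); split=> [[]|]. Qed.

Lemma unit_section_dom x : t.1 x -> dom t.2 (unit_section t x).
Proof. by move=> tx; apply: (phomeo_bwd ph); apply/triv_imgP. Qed.

Lemma proj_unit_section x : t.1 x -> pb_proj (unit_section t x) = x.
Proof.
move=> tx; rewrite -(triv_fst ht (unit_section_dom tx)) /unit_section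
  (phomeo_bwdK ph)//.
exact/triv_imgP.
Qed.

Lemma fiber_coord_unit_section x : t.1 x ->
  fiber_coord t (unit_section t x) = 1%g.
Proof.
by move=> tx; rewrite /fiber_coord /unit_section (phomeo_bwdK ph)//;
  apply/triv_imgP.
Qed.

Lemma fiber_coord_act p k : t.1 (pb_proj p) ->
  fiber_coord t (pb_act p k) = (fiber_coord t p * k)%g.
Proof.
by move=> /triv_domP tp; rewrite /fiber_coord (triv_act ht k tp).2.
Qed.

Lemma proj_act_in p k : t.1 (pb_proj p) -> pb_proj (pb_act p k) = pb_proj p.
Proof.
move=> /triv_domP tp; have [dp e] := triv_act ht k tp.
by rewrite -(triv_fst ht dp) e /= (triv_fst ht tp).
Qed.

Lemma triv_inj p q : t.1 (pb_proj p) -> pb_proj p = pb_proj q ->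
  fiber_coord t p = fiber_coord t q -> p = q.
Proof.
move=> tp pq cpq; have tq : t.1 (pb_proj q) by rewrite -pq.
have dp := (triv_domP p).2 tp; have dq := (triv_domP q).2 tq.
rewrite -(phomeo_fwdK ph dp) -(phomeo_fwdK ph dq); congr (bwd _ _).
rewrite [LHS]surjective_pairing [RHS]surjective_pairing.
by rewrite (triv_fst ht dp) (triv_fst ht dq) pq -/(fiber_coord t p) cpq.
Qed.

Lemma unit_section_fiber_coord p : t.1 (pb_proj p) ->
  pb_act (unit_section t (pb_proj p)) (fiber_coord t p) = p.
Proof.
move=> tp; have ts : t.1 (pb_proj (unit_section t
  (pb_proj p))) by rewrite proj_unit_section.
apply: triv_inj; rewrite ?proj_act_in ?proj_unit_section//.
by rewrite fiber_coord_act// fiber_coord_unit_section// mul1g.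
Qed.

Lemma bwd_unit_section x k : t.1 x ->
  bwd t.2 (x, k) = pb_act (unit_section t x) k.
Proof.
move=> tx; have ix : img t.2 (x, k) by exact/triv_imgP.
have db := phomeo_bwd ph ix.
have pb : pb_proj (bwd t.2 (x, k)) = x.
  by rewrite -(triv_fst ht db) (phomeo_bwdK ph).
have ts : t.1 (pb_proj (unit_section t x)) by rewrite proj_unit_section.
apply: triv_inj; rewrite ?pb// ?proj_act_in ?proj_unit_section//.
by rewrite fiber_coord_act// fiber_coord_unit_section// mul1g /fiber_coord
  (phomeo_bwdK ph).
Qed.

Lemma open_triv_preimage : open (@pb_proj _ _ P @^-1` t.1).
Proof.
apply: open_comp; last exact: triv_open ht.
by move=> p _; exact: pb_proj_continuous.
Qed.

Lemma continuous_unit_section x : t.1 x -> {for x, continuous (unit_section t)}.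
Proof.
move=> tx; apply: (@continuous_comp _ _ _ (fun y => (y, 1%g : K)) (bwd t.2)).
  by apply: (cvg_pair (G := nbhs x)); [exact: cvg_id|exact: cvg_cst].
have oi : open (img t.2).
  by rewrite (triv_img ht); apply: openXT; exact: triv_open ht.
apply: (iffLR (within_open_continuousP _ oi)); last exact/triv_imgP.
exact: phomeo_bwd_continuous ph.
Qed.

Lemma continuous_fiber_coord p : t.1 (pb_proj p) ->
  {for p, continuous (fiber_coord t)}.
Proof.
move=> tp; apply: (@continuous_comp _ _ _ (fwd t.2) snd); last exact: cvg_snd.
have od : open (dom t.2) by rewrite (triv_dom ht); exact: open_triv_preimage.
apply: (iffLR (within_open_continuousP _ od)); last exact/triv_domP.
exact: phomeo_fwd_continuous ph.
Qed.

End OneTrivialization.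

Lemma exists_triv P (x : M) : exists t : triv_of P, is_triv t /\ t.1 x.
Proof.
have [T [hT cT]] := pb_locally_trivial P.
by have [t Tt tx] := cT x; exists t; split => //; exact: hT.
Qed.

Lemma proj_act P (p : P) k : pb_proj (pb_act p k) = pb_proj p.
Proof.
by have [t [ht tp]] := exists_triv P (pb_proj p); exact: (proj_act_in ht).
Qed.

Record vertical_map P P' (f : P -> P') : Prop := {
  vertical_map_continuous : continuous f;
  vertical_map_act : forall p k, f (pb_act p k) = pb_act (f p) k;
  vertical_map_proj : forall p, pb_proj (f p) = pb_proj p }.

Lemma vertical_map_id P : vertical_map (@id P).
Proof. by split => // p; exact: cvg_id. Qed.

(** The function with values in K that represents f over the overlap of two
    trivializations; for f = id it is a transition function. *)
Definition local_rep P P' (f : P -> P') (t : triv_of P) (t' : triv_of P')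
  (x : M) : K :=
  fiber_coord t' (f (unit_section t x)).

Section LocalRepresentation.
Context {P P' : principalBundle K M} {f : P -> P'}.
Implicit Types p q : P.
Hypothesis hf : vertical_map f.

Lemma vertical_map_unit_section t t' x : is_triv t -> is_triv t' -> t.1 x ->
  t'.1 x ->
  f (unit_section t x) = pb_act (unit_section t' x) (local_rep f t t' x).
Proof.
move=> ht ht' tx t'x;
  rewrite /local_rep -{1}(unit_section_fiber_coord ht' (p := f
    (unit_section t x))).
  by rewrite (vertical_map_proj hf) (proj_unit_section ht).
by rewrite (vertical_map_proj hf) (proj_unit_section ht).
Qed.

Lemma vertical_map_fiber_coord t t' p : is_triv t -> is_triv t' ->
  t.1 (pb_proj p) -> t'.1 (pb_proj p) ->
  f p = pb_act (unit_section t' (pb_proj p)) (local_rep f t t'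
    (pb_proj p) * fiber_coord t p)%g.
Proof.
move=> ht ht' tp t'p;
  rewrite -{1}(unit_section_fiber_coord ht tp) (vertical_map_act hf).
by rewrite (vertical_map_unit_section ht ht')// pb_actM.
Qed.

(** Two changes of trivializations act on the representing function by left and
    right multiplication with transition functions. *)
Lemma local_rep_change t t' t1 t1' x :
  is_triv t -> is_triv t' -> is_triv t1 -> is_triv t1' ->
  t.1 x -> t'.1 x -> t1.1 x -> t1'.1 x ->
  local_rep f t1 t1' x = (local_rep id t' t1' x *
    (local_rep f t t' x * local_rep id t1 t x))%g.
Proof.
move=> ht ht' ht1 ht1' tx t'x t1x t1'x.
have ps : pb_proj (unit_section t1 x) = x by rewrite (proj_unit_section ht1).
have := @vertical_map_fiber_coord t t' (unit_section t1 x) ht ht';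
  rewrite ps => /(_ tx t'x) e.
rewrite {1}/local_rep e (fiber_coord_act ht1') ?(proj_unit_section ht')//.
Qed.

Lemma continuous_local_rep t t' x : is_triv t -> is_triv t' -> t.1 x ->
  t'.1 x ->
  {for x, continuous (local_rep f t t')}.
Proof.
move=> ht ht' tx t'x.
apply: (@continuous_comp _ _ _ (f \o unit_section t) (fiber_coord t')).
  apply: continuous_comp; first exact: (continuous_unit_section ht).
  exact: vertical_map_continuous hf _.
by apply: (continuous_fiber_coord ht');
  rewrite /= (vertical_map_proj hf) (proj_unit_section ht).
Qed.

End LocalRepresentation.

End Trivializations.

(** * Smooth structures and smoothing in one chart *)

Section SmoothFamilies.
Context {R : realType} {d : nat} {E : tvsType R} {K : lieGroup E}.
Context {M : cornerManifold R d}.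
Hypothesis hE : hausdorff_space E.
Implicit Types P : principalBundle K M.

Let CM := cm_atlas M.
Let CK := lg_atlas K.
Let aM : is_atlas (@orthant R d) CM := cm_atlasP M.
Let cM := atlas_charts aM.
Let aK : is_atlas [set: E] CK := lg_atlasP K.

(** A smooth structure on the part of P over the union of the sets U of its
    members (U, Omega), which may be a neighbourhood of a compact set only. *)
Definition smooth_family P (T : set (triv_of P)) : Prop :=
  (forall t, T t -> is_triv t) /\
  forall t t', T t -> T t' ->
    smooth_map CM CK (t.1 `&` t'.1) (local_rep id t t').

Definition smooth_over P P' (T : set (triv_of P)) (T' : set (triv_of P'))
    (f : P -> P') (W : set M) : Prop :=
  forall t t', T t -> T' t' ->
    smooth_map CM CK (W `&` (t.1 `&` t'.1)) (local_rep f t t').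

Section TwoBundles.
Context {P P' : principalBundle K M}.
Context {T : set (triv_of P)} {T' : set (triv_of P')}.
Hypotheses (sT : smooth_family T) (sT' : smooth_family T').

(** One pair of trivializations suffices over V, because transition functions
    are smooth. *)
Lemma smooth_over_change (f : P -> P') (V : set M) t t' : vertical_map f ->
  open V ->
  T t -> T' t' -> V `<=` t.1 `&` t'.1 ->
    smooth_map CM CK V (local_rep f t t') ->
  smooth_over T T' f V.
Proof.
move=> hf oV Tt Tt' Vtt' s t1 t1' Tt1 Tt1'.
have ht := sT.1 _ Tt; have ht' := sT'.1 _ Tt'.
have ht1 := sT.1 _ Tt1; have ht1' := sT'.1 _ Tt1'.
have oW : open (V `&` (t1.1 `&` t1'.1)).
  apply: openI => //; apply: openI;
    [exact: triv_open ht1|exact: triv_open ht1'].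
apply: (@smooth_map_eq _ _ _ _ _ _ _ _
  (fun x => (local_rep id t' t1' x *
    (local_rep f t t' x * local_rep id t1 t x))%g) _ oW).
  move=> x [Vx [t1x t1'x]]; have [tx t'x] := Vtt' _ Vx.
  by rewrite -(local_rep_change hf).
apply: smooth_mulK => //.
  apply: smooth_map_sub (sT'.2 _ _ Tt' Tt1') => x [Vx [_ t1'x]].
  by have [] := Vtt' _ Vx.
apply: smooth_mulK => //; first by apply: smooth_map_sub s => x [].
apply: smooth_map_sub (sT.2 _ _ Tt1 Tt) => x [Vx [t1x _]].
by have [] := Vtt' _ Vx.
Qed.

Lemma smooth_over_local (f : P -> P') (W : set M) : open W ->
  (forall x, W x -> exists V, [/\ open V, V x & smooth_over T T' f V]) ->
  smooth_over T T' f W.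
Proof.
move=> oW h t t' Tt Tt'; have ht := sT.1 _ Tt; have ht' := sT'.1 _ Tt'.
have ott : open (t.1 `&` t'.1).
  by apply: openI; [exact: triv_open ht|exact: triv_open ht'].
apply: (smooth_map_local cM); first exact: openI.
move=> x [Wx ttx]; have [V [oV Vx s]] := h _ Wx.
exists (V `&` (t.1 `&` t'.1)); split => //; first exact: openI.
exact: s.
Qed.

Lemma smooth_over_eq (f g : P -> P') (W : set M) : open W ->
  (forall p, W (pb_proj p) -> f p = g p) ->
  smooth_over T T' f W -> smooth_over T T' g W.
Proof.
move=> oW fg s t t' Tt Tt'; have ht := sT.1 _ Tt; have ht' := sT'.1 _ Tt'.
have ott : open (t.1 `&` t'.1).
  by apply: openI; [exact: triv_open ht|exact: triv_open ht'].
apply: smooth_map_eq (s t t' Tt Tt'); first exact: openI.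
by move=> x [Wx [tx _]]; rewrite /local_rep fg// (proj_unit_section ht).
Qed.

Lemma smooth_over_sub (f : P -> P') (V W : set M) : V `<=` W ->
  smooth_over T T' f W -> smooth_over T T' f V.
Proof.
move=> VW s t t' Tt Tt'; apply: smooth_map_sub (s t t' Tt Tt').
by move=> x [Vx ?]; split => //; exact: VW.
Qed.

(** In the trivializations t and t' and the chart phi, f becomes a map psi into
    E over an open set U around A. The smoothed psi' differs from psi only over
    a compact subset of U, so that the new vertical map extends by f. The
    set Om, invariant under the diagonal action, is the prescribed
    neighbourhood of the graph of f. *)
Lemma smoothing_in_chart (f : P -> P') (W C A : set M) (Om : set
  (P * P')) t t' phi :
  T t -> T' t' -> CK phi -> vertical_map f -> open W -> smooth_over T T' f W ->
  closed C -> C `<=` W -> compact A -> A `<=` t.1 `&` t'.1 ->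
  (forall x, A x -> dom phi (local_rep f t t' x)) ->
  open Om -> (forall p q k, Om (p, q) -> Om (pb_act p k, pb_act q k)) ->
  (forall p, Om (p, f p)) ->
  exists (f' : P -> P') (W' : set M),
    [/\ vertical_map f', open W' /\ C `|` A `<=` W', smooth_over T T' f' W',
      forall p, C (pb_proj p) -> f' p = f p & forall p, Om (p, f' p)].
Proof.
move=> Tt Tt' Cphi hf oW sf clC CW cA Att Aphi oOm Omact Omf.
have ht := sT.1 _ Tt; have ht' := sT'.1 _ Tt'.
have ott : open (t.1 `&` t'.1).
  by apply: openI; [exact: triv_open ht|exact: triv_open ht'].
have pphi := atlas_phomeo aK Cphi.
have odphi := atlas_dom_open aK Cphi.
have oiphi : open (img phi).
  by have [V oV ->] := atlas_img_open aK Cphi; rewrite setTI.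
have cfwd := iffLR (within_open_continuousP _ odphi)
  (phomeo_fwd_continuous pphi).
have cbwd := iffLR (within_open_continuousP _ oiphi)
  (phomeo_bwd_continuous pphi).
pose U := (t.1 `&` t'.1) `&` local_rep f t t' @^-1` dom phi.
have ctr x : (t.1 `&` t'.1) x -> {for x, continuous (local_rep f t t')}.
  by move=> [tx t'x]; exact: continuous_local_rep.
have oU : open U by exact: open_preimage_in.
pose psi := fwd phi \o local_rep f t t'.
have cpsi x : U x -> {for x, continuous psi}.
  move=> [ttx dx]; apply: continuous_comp; first exact: ctr.
  exact: cfwd.
(* The pair (p, f p) for p in the unit section, as a function of the value v of
   psi; Om pulls back to an open set of M * E. *)
pose lift (z : M * E) := (unit_section t z.1, pb_act (unit_section t' z.1)
  (bwd phi z.2)).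
pose V := U `*` img phi.
have oV : open V.
  rewrite openE => -[x v] [Ux iv]; exists (U, img phi) => //=.
  by split; exact: open_nbhs_nbhs.
have clift z : V z -> {for z, continuous lift}.
  case: z => x v [/= [[tx t'x] _] iv].
  have c1 : (fun z : M * E => z.1) @ (x, v) --> x by exact: cvg_fst.
  have c2 : (fun z : M * E => z.2) @ (x, v) --> v by exact: cvg_snd.
  have c3 : (fun z : M * E => unit_section t z.1) @ (x, v) --> unit_section t x.
    exact: (cvg_comp _ _ c1 (continuous_unit_section ht tx)).
  have c4 : (fun z : M * E => unit_section t' z.1) @
    (x, v) --> unit_section t' x.
    exact: (cvg_comp _ _ c1 (continuous_unit_section ht' t'x)).
  have c5 : (fun z : M * E => bwd phi z.2) @ (x, v) --> bwd phi v.
    exact: (cvg_comp _ _ c2 (cbwd _ iv)).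
  apply: (cvg_pair c3).
  exact: (cvg_comp _ _ (cvg_pair c4 c5) (@pb_act_continuous _ _ P' (_, _))).
have oOm' : open (V `&` lift @^-1` Om) by exact: open_preimage_in.
have psiOm x : U x -> (V `&` lift @^-1` Om) (x, psi x).
  move=> Ux; have [[tx t'x] dx] := Ux; split.
    by split => //; exact: (phomeo_fwd pphi).
  change (Om (unit_section t x, pb_act (unit_section t' x) (bwd phi (fwd phi
    (local_rep f t t' x))))).
  by rewrite (phomeo_fwdK pphi)// -(vertical_map_unit_section hf).
have AU : A `<=` U by move=> x Ax; split; [exact: Att|exact: Aphi].
have sN : smoothE CM (W `&` U) psi.
  apply: (smooth_map_smoothE (D := CK) Cphi); first by move=> x [_ []].
  by apply: smooth_map_sub (sf t t' Tt Tt') => x [Wx []].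
have [psi' [B [W1 [[cB BU] psiE cpsi' [oW1 AW1 NW1 W1U] sW1]]]] :=
  smoothing_vector hE oU cpsi (openI oW oU) (@subIsetr _ W U) sN clC
    (setSI CW) cA AU oOm' psiOm.
have clB : closed B by apply: compact_closed => //; exact: cm_hausdorff.
pose ga x := bwd phi (psi' x).
have iga x : U x -> img phi (psi' x).
  by move=> Ux; have [_ [[]]] := cpsi' x Ux.
have cga x : U x -> {for x, continuous ga}.
  move=> Ux; apply: continuous_comp; first exact: (cpsi' x Ux).1.
  by apply: cbwd; exact: iga.
pose f' (p : P) : P' := if pselect (U (pb_proj p)) then
  pb_act (unit_section t' (pb_proj p)) (ga
    (pb_proj p) * fiber_coord t p)%g else f p.
have f'U p : U (pb_proj p) ->
    f' p = pb_act (unit_section t' (pb_proj p)) (ga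
      (pb_proj p) * fiber_coord t p)%g.
  by rewrite /f'; case: pselect.
have f'f p : C (pb_proj p) \/ ~ B (pb_proj p) -> f' p = f p.
  move=> CB; rewrite /f'; case: pselect => // -[[tp t'p] dp].
  rewrite /ga psiE// /psi /= (phomeo_fwdK pphi)//.
  by rewrite -(vertical_map_fiber_coord hf ht ht').
have hf' : vertical_map f'.
  split.
  - move=> p; have [Up|nUp] := pselect (U (pb_proj p)).
      have oUP : open (@pb_proj _ _ P @^-1` U).
        by apply: open_comp => // q _; exact: pb_proj_continuous.
      apply: (open_eq_continuous oUP Up (f := fun p =>
        pb_act (unit_section t' (pb_proj p)) (ga
          (pb_proj p) * fiber_coord t p)%g)).
        by move=> q /f'U.
      have [[tp t'p] _] := Up.
      have c1 : (@pb_proj _ _ P) @ p --> pb_proj p by exact: pb_proj_continuous.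
      have c2 : (fun q : P => unit_section t'
        (pb_proj q)) @ p --> unit_section t' (pb_proj p).
        exact: (cvg_comp _ _ c1 (continuous_unit_section ht' t'p)).
      have c3 : (fun q : P => ga (pb_proj q) * fiber_coord t q)%g @ p -->
          (ga (pb_proj p) * fiber_coord t p)%g.
        apply: cvg_mulK; last exact: (continuous_fiber_coord ht).
        exact: (cvg_comp _ _ c1 (cga _ Up)).
      exact: (cvg_comp _ _ (cvg_pair c2 c3) (@pb_act_continuous _ _ P' (_, _))).
    have oBP : open (@pb_proj _ _ P @^-1` (~` B)).
      apply: open_comp; last exact: closed_openC.
      by move=> q _; exact: pb_proj_continuous.
    apply: (open_eq_continuous oBP (f := f)).
    + by move=> /BU.
    + by move=> q /= nBq; rewrite f'f//; right.
    + exact: vertical_map_continuous hf _.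
  - move=> p k; have [Up|nUp] := pselect (U (pb_proj p)).
      have [[tp _] _] := Up.
      by rewrite !f'U ?proj_act// (fiber_coord_act ht)// mulgA !pb_actM.
    rewrite !f'f ?proj_act ?(vertical_map_act hf)//; right => /BU //.
  - move=> p; have [Up|nUp] := pselect (U (pb_proj p)).
      by have [[_ t'p] _] := Up; rewrite f'U// proj_act (proj_unit_section ht').
    by rewrite f'f ?(vertical_map_proj hf)//; right => /BU.
exists f', (W1 `|` (W `&` ~` B)); split => //.
- have oWB : open (W `&` ~` B) by apply: openI => //; exact: closed_openC.
  split; first exact: openU.
  move=> x [Cx|Ax]; last by left; exact: AW1.
  have [Ux|nUx] := pselect (U x); first by left; apply: NW1; split => //;
    exact: CW.
  by right; split; [exact: CW|move=> /BU].
- have oWB : open (W `&` ~` B) by apply: openI => //; exact: closed_openC.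
  apply: smooth_over_local; first exact: openU.
  move=> x [W1x|WBx].
    exists W1; split => //;
      apply: (smooth_over_change (t := t) (t' := t')) => //.
      by move=> y /W1U[].
    apply: (@smooth_map_eq _ _ _ _ _ _ _ _ (bwd phi \o psi') _ oW1).
      move=> y /W1U Uy; have [[ty t'y] _] := Uy.
      have py : pb_proj (unit_section t y) = y by rewrite
        (proj_unit_section ht).
      rewrite /local_rep f'U py//
        (fiber_coord_act ht') ?(proj_unit_section ht')//.
      by rewrite !fiber_coord_unit_section// mul1g mulg1.
    apply: (smoothE_smooth_map _ hE aM aK) => //.
    + by move=> y /W1U Uy; have [] := cpsi' y Uy.
    + by move=> y /W1U; exact: iga.
  exists (W `&` ~` B); split => //.
  apply: (@smooth_over_eq f) => //; last exact: smooth_over_sub sf.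
  by move=> p [_ nBp]; rewrite f'f//; right.
- by move=> p Cp; rewrite f'f//; left.
- move=> p; have [Up|nUp] := pselect (U (pb_proj p)); last first.
    by rewrite f'f//; right => /BU.
  have [[tp _] _] := Up.
  rewrite f'U// pb_actM -{1}(unit_section_fiber_coord ht tp); apply: Omact.
  by have [_ [_]] := cpsi' _ Up.
Qed.

End TwoBundles.
End SmoothFamilies.

(** * Smoothing near a compact set *)

Section CompactStep.
Context {R : realType} {d : nat} {E : tvsType R} {K : lieGroup E}.
Context {M : cornerManifold R d}.
Hypothesis hE : hausdorff_space E.
Context {P P' : principalBundle K M}.
Context {T : set (triv_of P)} {T' : set (triv_of P')}.
Hypotheses (sT : smooth_family T) (sT' : smooth_family T').

Let CM := cm_atlas M.
Let CK := lg_atlas K.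
Let aK : is_atlas [set: E] CK := lg_atlasP K.

(** The graph of f lies in this set if and only if, over B, the map which
    represents f in t and t' has values in the domain of phi. Written in terms
    of points of P * P', the condition is visibly open and invariant. *)
Definition chart_control (t : triv_of P) (t' : triv_of P') (phi : pbij K E)
    (B : set M) : set (P * P') :=
  [set z | ~ B (pb_proj z.1)] `|`
  [set z | [/\ t.1 (pb_proj z.1), t'.1 (pb_proj z.2) &
               dom phi (fiber_coord t' z.2 * (fiber_coord t z.1)^-1)%g]].

Lemma open_chart_control t t' phi B : T t -> T' t' -> CK phi -> compact B ->
  open (chart_control t t' phi B).
Proof.
move=> Tt Tt' Cphi cB; have ht := sT.1 _ Tt; have ht' := sT'.1 _ Tt'.
have c1 (z : P * P') : {for z, continuous (fun z : P * P' => pb_proj z.1 : M)}.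
  apply: (@continuous_comp _ _ _ fst (@pb_proj _ _ P)); first exact: cvg_fst.
  exact: pb_proj_continuous.
have c2 (z : P * P') : {for z, continuous (fun z : P * P' => pb_proj z.2 : M)}.
  apply: (@continuous_comp _ _ _ snd (@pb_proj _ _ P')); first exact: cvg_snd.
  exact: pb_proj_continuous.
apply: openU.
  apply: (@open_comp _ _ (fun z : P * P' => pb_proj z.1 : M) (~` B)).
    by move=> z _; exact: c1.
  by apply: closed_openC; apply: compact_closed => //; exact: cm_hausdorff.
have o1 : open ((fun z : P * P' => pb_proj z.1 : M) @^-1` t.1).
  by apply: open_comp => [z _|]; [exact: c1|exact: triv_open ht].
have o2 : open ((fun z : P * P' => pb_proj z.2 : M) @^-1` t'.1).
  by apply: open_comp => [z _|]; [exact: c2|exact: triv_open ht'].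
pose q (z : P * P') := (fiber_coord t' z.2 * (fiber_coord t z.1)^-1)%g.
have cq z : ((fun z : P * P' => pb_proj z.1 : M) @^-1` t.1 `&`
    (fun z : P * P' => pb_proj z.2 : M) @^-1` t'.1) z -> {for z, continuous q}.
  move=> [tz t'z]; apply: cvg_mulK.
    apply: (@continuous_comp _ _ _ snd (fiber_coord t')); first exact: cvg_snd.
    exact: (continuous_fiber_coord ht').
  apply: cvg_invK.
  apply: (@continuous_comp _ _ _ fst (fiber_coord t)); first exact: cvg_fst.
  exact: (continuous_fiber_coord ht).
have := open_preimage_in (openI o1 o2) cq (atlas_dom_open aK Cphi).
congr open; apply/seteqP; split=> z; first by move=> [[? ?] ?].
by move=> [? ? ?].
Qed.

Lemma chart_control_act t t' phi B p q k : T t -> T' t' ->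
  chart_control t t' phi B (p, q) ->
  chart_control t t' phi B (pb_act p k, pb_act q k).
Proof.
move=> Tt Tt'; have ht := sT.1 _ Tt; have ht' := sT'.1 _ Tt'.
case=> [nB|[/= tp t'q dp]]; first by left; rewrite /= proj_act.
right; split; rewrite /= ?proj_act//.
rewrite (fiber_coord_act ht)// (fiber_coord_act ht')// invgM mulgA.
by rewrite -[X in dom phi (X * _)%g]mulgA mulgV mulg1.
Qed.

Lemma chart_control_vertical_map t t' phi B (f : P -> P') : T t -> T' t' ->
  vertical_map f ->
  B `<=` t.1 `&` t'.1 ->
  (forall p, chart_control t t' phi B (p, f p)) <->
  (forall x, B x -> dom phi (local_rep f t t' x)).
Proof.
move=> Tt Tt' hf Btt; have ht := sT.1 _ Tt; have ht' := sT'.1 _ Tt'.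
split=> [h x Bx|h p].
  have [tx t'x] := Btt _ Bx; case: (h (unit_section t x)) => [|[/= _ _]].
    by rewrite /= (proj_unit_section ht).
  by rewrite (fiber_coord_unit_section ht)// invg1 mulg1.
have [Bp|nB] := pselect (B (pb_proj p)); last by left.
have [tp t'p] := Btt _ Bp; right; split; rewrite /= ?(vertical_map_proj hf)//.
rewrite (vertical_map_fiber_coord hf ht ht')//
  (fiber_coord_act ht') ?(proj_unit_section ht')//
    (fiber_coord_unit_section ht')//.
by rewrite mul1g mulgK; exact: h.
Qed.

(** Each of the finitely many pieces of A is sent into one chart by f; this is
    kept as a condition Om on the graph while the pieces are treated one after
    the other. *)
Lemma smoothing_near_compact (f : P -> P') (W C A : set M) :
  vertical_map f -> open W -> smooth_over T T' f W -> closed C -> C `<=` W ->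
  compact A ->
  (forall x, A x -> exists t t', [/\ T t, T' t', t.1 x & t'.1 x]) ->
  exists (f' : P -> P') (W' : set M),
    [/\ vertical_map f', open W' /\ C `|` A `<=` W', smooth_over T T' f' W' &
      forall p, C (pb_proj p) -> f' p = f p].
Proof.
move=> hf oW sf clC CW cA hA.
have hx x : exists u : (triv_of P * triv_of P') * (pbij K E * (set M * set M)),
    A x -> [/\ [/\ T u.1.1, T' u.1.2 & CK u.2.1],
      nbhs x u.2.2.2, compact u.2.2.2, u.2.2.2 `<=` u.1.1.1 `&` u.1.2.1 &
      forall y, u.2.2.2 y -> dom u.2.1 (local_rep f u.1.1 u.1.2 y)].
  have [Ax|nA] := pselect (A x); last first.
    have [t _] := exists_triv P x; have [t' _] := exists_triv P' x.
    have [phi _ _] := atlas_cover aK 1%g.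
    by exists ((t, t'), (phi, (set0, set0))).
  have [t [t' [Tt Tt' tx t'x]]] := hA _ Ax.
  have ht := sT.1 _ Tt; have ht' := sT'.1 _ Tt'.
  have [phi Cphi phix] := atlas_cover aK (local_rep f t t' x).
  have oU : open ((t.1 `&` t'.1) `&` local_rep f t t' @^-1` dom phi).
    apply: open_preimage_in.
    - by apply: openI; [exact: triv_open ht|exact: triv_open ht'].
    - by move=> y [ty t'y]; exact: continuous_local_rep.
    - exact: (atlas_dom_open aK Cphi).
  have [|V [B [oV xV VB cB BU]]] := exists_compact_nbhs (@compact_set1 M x) oU.
    by move=> _ ->.
  exists ((t, t'), (phi, (V, B))) => _; split => //=.
  - apply: filterS VB _; apply: open_nbhs_nbhs; split => //; exact: xV.
  - by move=> y /BU[].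
  - by move=> y /BU[].
have [u hu] := choice hx.
have [|s [sA As]] := @compact_cover_seq M A (fun x => (u x).2.2.2) cA.
  by move=> x /hu[].
pose ctl x := chart_control (u x).1.1 (u x).1.2 (u x).2.1 (u x).2.2.2.
pose Om : set (P * P') := [set z | forall x, x \in s -> ctl x z].
have oOm : open Om.
  suff : forall l : seq M, (forall x, x \in l -> A x) ->
      open [set z | forall x, x \in l -> ctl x z] by apply.
  elim=> [_|x l IH lA].
    rewrite (_ : mkset _ = setT); first exact: openT.
    by apply/seteqP; split.
  rewrite (_ : mkset _ = ctl x `&` [set z | forall x, x \in l -> ctl x z]).
    apply: openI; last by apply: IH => y yl; apply: lA; rewrite inE yl orbT.
    have [[h1 h2 h3] _ h4 _ _] := hu x (lA x (mem_head _ _)).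
    exact: open_chart_control.
  apply/seteqP; split=> [z h|z [h1 h2] y].
    by split=> [|y yl]; apply: h; rewrite inE ?eqxx ?yl ?orbT.
  by rewrite inE => /orP[/eqP->//|]; exact: h2.
have Omact p q k : Om (p, q) -> Om (pb_act p k, pb_act q k).
  move=> h x xs; have [[h1 h2 h3] _ _ _ _] := hu x (sA _ xs).
  by apply: chart_control_act => //; exact: h.
have Omf p : Om (p, f p).
  move=> x xs; have [[h1 h2 h3] _ _ h4 h5] := hu x (sA _ xs).
  exact: (chart_control_vertical_map _ h1 h2 hf h4).2.
have step : forall l : seq M, {subset l <= s} ->
    exists (f' : P -> P') (W' : set M),
    [/\ vertical_map f', open W' /\
        C `|` [set y | exists2 x, x \in l & (u x).2.2.2 y] `<=` W',
        smooth_over T T' f' W', forall p, C (pb_proj p) -> f' p = f p &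
        forall p, Om (p, f' p)].
  elim=> [_|x l IH ls].
    by exists f, W; split => //; split => // y [/CW//|[]].
  have [|f1 [W1 [hf1 [oW1 CW1] s1 f1f Om1]]] := IH.
    by move=> y yl; apply: ls; rewrite inE yl orbT.
  have lA y : y \in x :: l -> A y by move=> /ls; exact: sA.
  have [[h1 h2 h3] _ h4 h5 h6] := hu x (lA x (mem_head _ _)).
  have xs : x \in s by apply: ls; exact: mem_head.
  have clC1 : closed (C `|` [set y | exists2 x, x \in l & (u x).2.2.2 y]).
    apply: closedU => //; apply: compact_closed; first exact: cm_hausdorff.
    apply: compact_bigcup_seq => y yl.
    by have [] := hu y (lA y (mem_behead (s := x :: l) yl)).
  have B1 : forall y, (u x).2.2.2 y ->
    dom (u x).2.1 (local_rep f1 (u x).1.1 (u x).1.2 y).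
    by apply/(chart_control_vertical_map _ h1 h2 hf1 h5) => p; exact: Om1.
  have [f2 [W2 [hf2 [oW2 CW2] s2 f2f Om2]]] :=
    smoothing_in_chart hE sT sT' h1 h2 h3 hf1 oW1 s1 clC1 CW1 h4 h5 B1 oOm
      Omact Om1.
  exists f2, W2; split => //.
    split => // y [Cy|[z]]; first by apply: CW2; left; left.
    rewrite inE => /orP[/eqP->|zl uz]; first by move=> uy; apply: CW2; right.
    by apply: CW2; left; right; exists z.
  by move=> p Cp; rewrite f2f; [exact: f1f|left].
have [f' [W' [h1 [h2 h3] h4 h5 _]]] := step s (fun _ => id).
exists f', W'; split => //; split => // x [Cx|/As[y ys uy]]; apply: h3.
  by left.
by right; exists y.
Qed.

End CompactStep.

(** * Bundle equivalences *)

Section Equivalences.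
Context {R : realType} {E : tvsType R} {K : lieGroup E} {M : topologicalType}.
Context {P P' : principalBundle K M}.

(** Locally the map is (x, k) |-> (x, g(x) k), with inverse
    (x, k) |-> (x, g(x)^-1 k). *)
Lemma vertical_map_inverse (f : P -> P') : vertical_map f ->
  exists g : P' -> P, [/\ vertical_map g, cancel f g & cancel g f].
Proof.
move=> hf.
have injf : injective f.
  move=> p q fpq; have pq : pb_proj p = pb_proj q.
    by rewrite -(vertical_map_proj hf) fpq (vertical_map_proj hf).
  have [t [ht tp]] := exists_triv P (pb_proj p).
  have [t' [ht' t'p]] := exists_triv P' (pb_proj p).
  have tq : t.1 (pb_proj q) by rewrite -pq.
  have t'q : t'.1 (pb_proj q) by rewrite -pq.
  apply: (triv_inj ht tp pq).
  have := fpq; rewrite (vertical_map_fiber_coord hf ht ht' tp t'p)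
    (vertical_map_fiber_coord hf ht ht' tq t'q).
  move=> /(congr1 (fiber_coord t'));
    rewrite !(fiber_coord_act ht') ?(proj_unit_section ht')//.
  by rewrite -pq !(fiber_coord_unit_section ht')// !mul1g => /mulgI.
pose ginv (t : triv_of P) (t' : triv_of P') (q : P') : P :=
  pb_act (unit_section t (pb_proj q)) ((local_rep f t t'
    (pb_proj q))^-1 * fiber_coord t' q)%g.
have fginv t t' q : is_triv t -> is_triv t' -> t.1 (pb_proj q) ->
    t'.1 (pb_proj q) -> f (ginv t t' q) = q.
  move=> ht ht' tq t'q;
    rewrite /ginv (vertical_map_act hf) (vertical_map_unit_section hf ht ht')//.
  by rewrite -pb_actM mulgA mulgV mul1g (unit_section_fiber_coord ht').
have /choice[g hg] : forall q, exists p, f p = q.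
  move=> q; have [t [ht tq]] := exists_triv P (pb_proj q).
  have [t' [ht' t'q]] := exists_triv P' (pb_proj q).
  by exists (ginv t t' q); exact: fginv.
exists g; split => //; last by move=> p; apply: injf; rewrite hg.
split.
- move=> q; have [t [ht tq]] := exists_triv P (pb_proj q).
  have [t' [ht' t'q]] := exists_triv P' (pb_proj q).
  have oV : open (@pb_proj _ _ P' @^-1` (t.1 `&` t'.1)).
    apply: open_comp; first by move=> z _; exact: pb_proj_continuous.
    by apply: openI; [exact: triv_open ht|exact: triv_open ht'].
  apply: (open_eq_continuous oV (f := ginv t t')) => //.
    by move=> z [tz t'z]; apply: injf; rewrite fginv// hg.
  have c1 : (@pb_proj _ _ P') @ q --> pb_proj q by exact: pb_proj_continuous.
  have c2 : (fun z : P' => unit_section t (pb_proj z)) @ q --> unit_section t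
    (pb_proj q).
    exact: (cvg_comp _ _ c1 (continuous_unit_section ht tq)).
  have c3 : (fun z : P' => (local_rep f t t'
    (pb_proj z))^-1 * fiber_coord t' z)%g @ q -->
      ((local_rep f t t' (pb_proj q))^-1 * fiber_coord t' q)%g.
    apply: cvg_mulK; last exact: (continuous_fiber_coord ht').
    apply: cvg_invK.
    exact: (cvg_comp _ _ c1 (continuous_local_rep hf ht ht' tq t'q)).
  exact: (cvg_comp _ _ (cvg_pair c2 c3) (@pb_act_continuous _ _ P (_, _))).
- by move=> q k; apply: injf; rewrite (vertical_map_act hf) !hg.
- by move=> q; rewrite -(vertical_map_proj hf) hg.
Qed.

Lemma vertical_map_equivalence (f : P -> P') : vertical_map f ->
  is_bundle_equivalence f.
Proof.
move=> hf; have [g [hg fg gf]] := vertical_map_inverse hf.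
split; last exact: vertical_map_proj hf.
  by split; [exact: vertical_map_continuous hf|exact: vertical_map_act hf].
exists g => //; by split;
  [exact: vertical_map_continuous hg|exact: vertical_map_act hg].
Qed.

Lemma equivalence_vertical_map (f : P -> P') : is_bundle_equivalence f ->
  vertical_map f.
Proof. by move=> [[cf af] _ pf]. Qed.

End Equivalences.

(** * Smoothing over the whole base *)

Definition union_upto (X : Type) (A : nat -> set X) (n : nat) : set X :=
  [set x | exists2 i, (i < n)%N & A i x].

Section UnionUpto.
Context {X : topologicalType} (A : nat -> set X).

Lemma union_upto0 : union_upto A 0 = set0.
Proof. by apply/seteqP; split=> x // -[]. Qed.

Lemma union_uptoS n : union_upto A n.+1 = union_upto A n `|` A n.
Proof.
apply/seteqP; split=> [x [i]|x [[i ni Ax]|Ax]].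
- rewrite ltnS leq_eqVlt => /orP[/eqP->|ni] Ax; first by right.
  by left; exists i.
- by exists i => //; exact: ltnW.
- by exists n.
Qed.

Lemma union_upto_leq m n : (m <= n)%N -> union_upto A m `<=` union_upto A n.
Proof. by move=> mn x [i im Ax]; exists i => //; exact: leq_trans mn. Qed.

Lemma compact_union_upto n : (forall i, compact (A i)) ->
  compact (union_upto A n).
Proof.
move=> cA; elim: n => [|n IH]; first by rewrite union_upto0; exact: compact0.
by rewrite union_uptoS; exact: compactU.
Qed.

End UnionUpto.

Section Theorems.
Context {R : realType} {d : nat} {E : tvsType R} {K : lieGroup E}.
Context {M : cornerManifold R d}.
Hypotheses (hE : hausdorff_space E) (hM : connected [set: M]).

Let CM := cm_atlas M.
Let CK := lg_atlas K.
Let aM : is_atlas (@orthant R d) CM := cm_atlasP M.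
Let cM := atlas_charts aM.
Let aK : is_atlas [set: E] CK := lg_atlasP K.
Let cK := atlas_charts aK.

Lemma compact_exhaustion (Q : set M -> Prop) : Q set0 ->
  (forall x, exists U, [/\ open U, U x & forall A, A `<=` U -> Q A]) ->
  exists A : nat -> set M, (forall n, compact (A n) /\ Q (A n)) /\
    forall x : M, exists n, nbhs x (A n).
Proof.
move=> Q0 hQ; apply: countable_compact_cover => //; first exact: cm_paracompact.
move=> x; have [U [oU Ux QU]] := hQ x.
have [|V [B [oV xV VB cB BU]]] := exists_compact_nbhs (@compact_set1 M x) oU.
  by move=> _ ->.
exists B; split => //; last exact: QU.
by apply: filterS VB _; apply: open_nbhs_nbhs; split => //; exact: xV.
Qed.

Section Smoothing.
Context {P P' : principalBundle K M}.
Context {T : set (triv_of P)} {T' : set (triv_of P')}.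
Hypotheses (sT : smooth_family T) (sT' : smooth_family T').
Hypotheses (cT : forall x, exists2 t, T t & t.1 x)
  (cT' : forall x, exists2 t', T' t' & t'.1 x).

(** Stage n + 1 agrees with stage n over A_0 u ... u A_(n-1). The interiors of
    these unions cover M, so that the limit is locally one of the stages. *)
Lemma smoothing_vertical_map (f : P -> P') : vertical_map f ->
  exists f' : P -> P', vertical_map f' /\ smooth_over T T' f' setT.
Proof.
move=> hf.
have [A [hA cA]] : exists A : nat -> set M, (forall n, compact (A n) /\ True) /\
    forall x : M, exists n, nbhs x (A n).
  by apply: (compact_exhaustion (Q := fun=> True)) => // x; exists setT;
    split => //; exact: openT.
pose C := union_upto A.
have clC n : closed (C n).
  apply: compact_closed; first exact: cm_hausdorff.
  by apply: compact_union_upto => i; exact: (hA i).1.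
pose I n (s : (P -> P') * set M) :=
  [/\ vertical_map s.1, open s.2, C n `<=` s.2 & smooth_over T T' s.1 s.2].
pose Q n (s s' : (P -> P') * set M) :=
  forall p, C n (pb_proj p) -> s'.1 p = s.1 p.
have I0 : I 0%N (f, set0).
  split => //=; [exact: open0|by rewrite /C union_upto0|].
  apply: smooth_over_local => //; first exact: open0.
have [|u [u0 uI uQ]] := dependent_choice_nat I0 (Q := Q).
  move=> n [g W] [hg oW CW sg].
  have [|f' [W' [hf' [oW' CW'] sf' f'E]]] :=
    smoothing_near_compact hE sT sT' hg oW sg (clC n) CW (hA n).1.
    move=> x _; have [t Tt tx] := cT x; have [t' Tt' t'x] := cT' x.
    by exists t, t'.
  by exists (f', W'); split => //; split => //; rewrite /C union_uptoS.
have uE m n p : (m <= n)%N -> C m (pb_proj p) -> (u n).1 p = (u m).1 p.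
  move=> /subnK <-; elim: (n - m)%N => // k IH Cp.
  by rewrite uQ ?IH//; apply: union_upto_leq Cp; exact: leq_addl.
have /choice[N hN] : forall x : M, exists n, nbhs x (C n).
  move=> x; have [n nA] := cA x; exists n.+1.
  by apply: filterS nA => y Ay; exists n.
pose f' p := (u (N (pb_proj p))).1 p.
have f'E n p : C n (pb_proj p) -> f' p = (u n).1 p.
  move=> Cp; have CN : C (N (pb_proj p)) (pb_proj p).
    exact: nbhs_singleton (hN _).
  rewrite /f' -(uE _ (maxn n (N (pb_proj p))) _ (leq_maxr _ _) CN).
  by rewrite (uE n)// leq_maxl.
have oI n : open (interior (C n)) by exact: open_interior.
have f'I n p : interior (C n) (pb_proj p) -> (u n).1 p = f' p.
  by move=> /interior_subset/f'E ->.
exists f'; split; first split.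
- move=> p; pose n := N (pb_proj p).
  have oV : open (@pb_proj _ _ P @^-1` interior (C n)).
    by apply: open_comp => // q _; exact: pb_proj_continuous.
  apply: (open_eq_continuous oV (f := (u n).1)) => //.
  - exact: hN.
  - by move=> q /f'I.
  - by have [h _ _ _] := uI n; exact: vertical_map_continuous h _.
- move=> p k; rewrite /f' proj_act.
  by have [h _ _ _] := uI (N (pb_proj p)); exact: vertical_map_act h _ _.
- by move=> p; have [h _ _ _] := uI (N (pb_proj p));
  exact: vertical_map_proj h _.
- apply: smooth_over_local => //; first exact: openT.
  move=> x _; exists (interior (C (N x))); split => //; first exact: hN.
  have [h1 h2 h3 h4] := uI (N x).
  apply: (@smooth_over_eq _ _ _ _ _ _ _ _ _ sT sT' (u (N x)).1) => //.
    by move=> p /f'I.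
  by apply: smooth_over_sub h4 => y /interior_subset/h3.
Qed.

End Smoothing.

(** The transition function k_ij of a smooth bundle is the function that
    represents the identity in t_j and t_i. *)
Lemma smooth_bundle_family (P : smoothBundle K M) : smooth_family (sb_triv P).
Proof.
have [hT cT] := sb_trivP P; split => // t t' Tt Tt'.
have [k [kE sk]] := sb_smooth Tt' Tt.
have ht : is_triv t by exact: hT.
have ht' : is_triv t' by exact: hT.
rewrite setIC.
apply: smooth_map_eq sk.
  by apply: openI; [exact: triv_open ht'|exact: triv_open ht].
move=> x [t'x tx]; rewrite /local_rep /unit_section -(kE x (conj t'x tx)).
rewrite -/(unit_section t' x) (fiber_coord_act ht') ?(proj_unit_section ht')//.
by rewrite (fiber_coord_unit_section ht')// mul1g.
Qed.

(** In the charts of the total spaces, f is (x, k) |-> (x, g(x) k) with g the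
    function that represents f. *)
Lemma smooth_over_smooth_map (P P' : smoothBundle K M) (f : P -> P') :
  vertical_map f ->
  smooth_over (sb_triv P) (sb_triv P') f setT ->
  smooth_map (sb_atlas P) (sb_atlas P') setT f.
Proof.
move=> hf sf; split.
  by apply: continuous_subspaceT => p; exact: vertical_map_continuous hf _.
have hV := @norm_hausdorff R 'rV[R]_d.
have [sT _] := smooth_bundle_family P; have [sT' _] := smooth_bundle_family P'.
move=> _ _ [t Tt [c Cc <-]] [t' Tt' [c' Cc' <-]].
have ht := sT _ Tt; have ht' := sT' _ Tt'.
pose V := (t.1 `&` t'.1) `*` [set: K].
have ott : open (t.1 `&` t'.1).
  by apply: openI; [exact: triv_open ht|exact: triv_open ht'].
have oV : open V by exact: openXT.
pose F (z : M * K) : M * K := (z.1, (local_rep f t t' z.1 * z.2)%g).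
have cMK := prod_charts cM cK.
have sF : smooth_map (prod_atlas CM CK) (prod_atlas CM CK) V F.
  apply: smooth_map_pair => //; first exact: (smooth_map_fst hV _ aM).
  apply: smooth_mulK => //; last exact: (smooth_map_snd hE _ aK).
  apply: (@smooth_map_comp _ _ _ _ _ _ _ (prod_atlas CM CK) CM CK hV hE V
    (t.1 `&` t'.1) fst (local_rep f t t')) => //.
  - by move=> z [].
  - exact: (charts_open cK).
  - by have := sf t t' Tt Tt'; rewrite setTI.
  - exact: (smooth_map_fst hV _ aM).
have key z : img t.2 z -> dom t'.2 (f (bwd t.2 z)) ->
    V z /\ fwd t'.2 (f (bwd t.2 z)) = F z.
  case: z => x k /(triv_imgP ht) /= tx dz.
  have t'x : t'.1 x.
    have /(triv_domP ht') := dz.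
    by rewrite (vertical_map_proj hf) (bwd_unit_section ht)// proj_act
      (proj_unit_section ht).
  split; first by [].
  rewrite [LHS]surjective_pairing (triv_fst ht' dz) (vertical_map_proj hf).
  rewrite (bwd_unit_section ht)// proj_act (proj_unit_section ht)// /F /=;
    congr pair.
  rewrite -/(fiber_coord t' _) (vertical_map_act hf)
    (vertical_map_unit_section hf ht ht')// -pb_actM.
  by rewrite (fiber_coord_act ht') ?(proj_unit_section ht')//
    (fiber_coord_unit_section ht')// mul1g.
apply: (@smooth_on_eq _ _ _ _ (fwd c' \o F \o bwd c)).
  move=> y [/= [iy iyt] [_ [dy _]]].
  by have [_ ->] := key _ iyt dy.
apply: smooth_on_sub (sF.2 c c' Cc Cc').
move=> y [/= [iy iyt] [_ [dy d'y]]]; have [Vz e] := key _ iyt dy.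
by split => //; split => //=; rewrite -e.
Qed.

(** * Smooth structures on a continuous bundle *)

Section Restriction.
Context {P : principalBundle K M}.

Definition restr_triv (t : triv_of P) (U : set M) : triv_of P :=
  (t.1 `&` U, {| dom := @pb_proj _ _ P @^-1` (t.1 `&` U);
                 img := (t.1 `&` U) `*` setT;
                 fwd := fwd t.2; bwd := bwd t.2 |}).

Lemma restr_trivT t : is_triv t -> restr_triv t setT = t.
Proof.
move=> ht; rewrite /restr_triv !setIT -(triv_dom ht) -(triv_img ht).
by case: t {ht} => ? [].
Qed.

Lemma is_triv_restr t U : is_triv t -> open U -> is_triv (restr_triv t U).
Proof.
move=> ht oU; have ph := triv_phomeo ht.
have dsub : dom (restr_triv t U).2 `<=` dom t.2.
  by move=> p [tp _]; apply/(triv_domP ht).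
have isub : img (restr_triv t U).2 `<=` img t.2.
  by move=> y [[ty _] _]; apply/(triv_imgP ht).
split => //=.
- by apply: openI => //; exact: triv_open ht.
- split => /=.
  + by move=> p [tp Up]; rewrite (triv_fst ht)//; apply/(triv_domP ht).
  + move=> [x k] [/= [tx Ux] _].
    by rewrite (bwd_unit_section ht)// proj_act (proj_unit_section ht).
  + by move=> p /dsub dp; exact: (phomeo_fwdK ph dp).
  + by move=> y /isub iy; exact: (phomeo_bwdK ph iy).
  + exact: continuous_subspaceW dsub (phomeo_fwd_continuous ph).
  + exact: continuous_subspaceW isub (phomeo_bwd_continuous ph).
- by move=> p [tp _]; apply: (triv_fst ht); apply/(triv_domP ht).
- move=> p k [tp Up]; rewrite proj_act; split => //.
  by apply: (triv_act ht k _).2; apply/(triv_domP ht).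
Qed.

(** The trivialization t transported by the automorphism f, with inverse g. *)
Definition comp_triv (t : triv_of P) (f g : P -> P) : triv_of P :=
  (t.1, {| dom := @pb_proj _ _ P @^-1` t.1; img := t.1 `*` setT;
           fwd := fwd t.2 \o g; bwd := f \o bwd t.2 |}).

Lemma is_triv_comp t (f g : P -> P) : is_triv t -> vertical_map f ->
  vertical_map g ->
  cancel f g -> cancel g f -> is_triv (comp_triv t f g).
Proof.
move=> ht hf hg fg gf; have ph := triv_phomeo ht.
have dg p : t.1 (pb_proj p) -> dom t.2 (g p).
  by move=> tp; apply/(triv_domP ht); rewrite (vertical_map_proj hg).
have od : open (@pb_proj _ _ P @^-1` t.1) by exact: (open_triv_preimage ht).
have oi : open (t.1 `*` [set: K]) by apply: openXT; exact: triv_open ht.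
split => //=.
- exact: triv_open ht.
- split => /=.
  + by move=> p /= tp; rewrite (triv_fst ht) ?(vertical_map_proj hg)//;
    exact: dg.
  + move=> [x k] [/= tx _].
    by rewrite (vertical_map_proj hf) (bwd_unit_section ht)// proj_act
      (proj_unit_section ht).
  + by move=> p /= tp; rewrite (phomeo_fwdK ph) ?gf//; exact: dg.
  + move=> [x k] [/= tx _]; rewrite fg (phomeo_bwdK ph)//.
    exact/(triv_imgP ht).
  + apply/within_open_continuousP => // p tp.
    apply: continuous_comp; first exact: vertical_map_continuous hg _.
    have oD : open (dom t.2) by rewrite (triv_dom ht).
    apply: (iffLR (within_open_continuousP _ oD)); last exact: dg.
    exact: phomeo_fwd_continuous ph.
  + apply/within_open_continuousP => // z [tz _].
    apply: continuous_comp; last exact: vertical_map_continuous hf _.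
    have oI : open (img t.2) by rewrite (triv_img ht).
    apply: (iffLR (within_open_continuousP _ oI)); last exact/(triv_imgP ht).
    exact: phomeo_bwd_continuous ph.
- by move=> p /= tp; rewrite (triv_fst ht) ?(vertical_map_proj hg)//; exact: dg.
- move=> p k /= tp; rewrite proj_act (vertical_map_act hg); split => //.
  by rewrite (triv_act ht k (dg _ tp)).2.
Qed.

Lemma local_rep_inv (t t' : triv_of P) x : is_triv t -> is_triv t' ->
  t.1 x -> t'.1 x -> local_rep id t' t x = (local_rep id t t' x)^-1%g.
Proof.
move=> ht ht' tx t'x.
suff e : (local_rep id t t' x * local_rep id t' t x = 1)%g.
  by rewrite -[LHS]mul1g -(mulVg (local_rep id t t' x)) -mulgA e mulg1.
rewrite /local_rep -(fiber_coord_act ht') ?(proj_unit_section ht)//.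
have -> : pb_act (unit_section t x) (fiber_coord t
  (unit_section t' x)) = unit_section t' x.
  by rewrite -[in RHS](unit_section_fiber_coord ht
    (p := unit_section t' x)) ?(proj_unit_section ht').
exact: (fiber_coord_unit_section ht').
Qed.

Lemma smooth_local_rep_inv (t t' : triv_of P) U : is_triv t -> is_triv t' ->
  open U -> U `<=` t.1 `&` t'.1 ->
  smooth_map CM CK U (local_rep id t t') ->
    smooth_map CM CK U (local_rep id t' t).
Proof.
move=> ht ht' oU Utt s.
apply: (@smooth_map_eq _ _ _ _ _ _ _ _ (fun x =>
  (local_rep id t t' x)^-1%g) _ oU).
  by move=> x /Utt[tx t'x]; rewrite (local_rep_inv ht ht').
exact: smooth_invK.
Qed.

(** The old trivializations are kept over U and the transported t is used over
    V. The automorphism f makes t and the old structure compatible over a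
    neighbourhood W of C and B only, where B is a compact neighbourhood of A;
    so U leaves out the part of B outside W, and V is contained in B. *)
Lemma smooth_family_extend (T : set (triv_of P)) (C A : set M) (t : triv_of P) :
  smooth_family T -> compact C ->
    (forall x, C x -> exists2 t', T t' & t'.1 x) ->
  is_triv t -> compact A -> A `<=` t.1 ->
  exists (T' : set (triv_of P)), [/\ smooth_family T',
    forall x, (C `|` A) x -> exists2 t', T' t' & t'.1 x &
    exists U, [/\ open U, C `<=` U & forall t', T t' -> T' (restr_triv t' U)]].
Proof.
move=> sT cC CT ht cA At; have ot := triv_open ht.
have [V [B [oV AV VB cB Bt]]] := exists_compact_nbhs cA ot At.
have clB : closed B by apply: compact_closed => //; exact: cm_hausdorff.
pose T1 : set (triv_of P) := [set t].
have sT1 : smooth_family T1.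
  split=> [_ ->//|_ _ -> ->]; rewrite setIid.
  apply: (@smooth_map_eq _ _ _ _ _ _ _ _ (fun=> 1%g) _ ot).
    by move=> x tx; rewrite /local_rep /= (fiber_coord_unit_section ht).
  split; first by apply: continuous_subspaceT => x; exact: cvg_cst.
  by move=> c e Cc Ce; exact: smooth_on_cst.
have s0 : smooth_over T1 T id set0.
  by apply: smooth_over_local => //; exact: open0.
have [|f [W [hf [oW CW] sf _]]] := smoothing_near_compact hE sT1 sT
  (vertical_map_id P)
    open0 s0 closed0 (@subset_refl _ set0) (compact_closedI cC clB).
  move=> x [Cx Bx]; have [t' Tt' t'x] := CT _ Cx.
  by exists t, t'; split => //; exact: Bt.
have {}CW : C `&` B `<=` W by move=> x CBx; apply: CW; right.
have [g [hg fg gf]] := vertical_map_inverse hf.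
pose U := ~` (B `&` ~` W).
have oU : open U.
  by apply: closed_openC; apply: closedI => //; exact: open_closedC.
have UB x : U x -> B x -> W x by move=> Ux Bx; apply: contrapT => nW; exact: Ux.
pose tf := comp_triv t f g.
have htf : is_triv tf by exact: is_triv_comp.
pose new := restr_triv tf V.
have hnew : is_triv new by exact: is_triv_restr.
pose T' := [set restr_triv t' U | t' in T] `|` [set new].
have old t' : T t' -> is_triv (restr_triv t' U).
  by move=> Tt'; apply: is_triv_restr => //; exact: sT.1.
have snew t' : T t' -> smooth_map CM CK (new.1 `&` (restr_triv t' U).1)
    (local_rep id new (restr_triv t' U)).
  move=> Tt'; have := sf t t' erefl Tt'; apply: smooth_map_sub.
  by move=> x [[tx Vx] [t'x Ux]]; split => //; apply: UB => //; exact: VB.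
exists T'; split.
- split; first by move=> _ [[t' Tt' <-]|->] //; exact: old.
  have oI (t1 t2 : triv_of P) : is_triv t1 -> is_triv t2 ->
    open (t1.1 `&` t2.1).
    by move=> h1 h2; apply: openI; [exact: triv_open h1|exact: triv_open h2].
  move=> _ _ [[t1 Tt1 <-]|->] [[t2 Tt2 <-]|->].
  + apply: smooth_map_sub (sT.2 _ _ Tt1 Tt2).
    by move=> x [[t1x _] [t2x _]].
  + apply: smooth_local_rep_inv => //.
    * exact: old.
    * by apply: oI => //; exact: old.
    * by move=> x [].
    * by rewrite setIC; exact: snew.
  + exact: snew.
  + apply: (@smooth_map_eq _ _ _ _ _ _ _ _ (fun=> 1%g)); first exact: oI.
      by move=> x [nx _]; rewrite /local_rep /= (fiber_coord_unit_section hnew).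
    split; first by apply: continuous_subspaceT => x; exact: cvg_cst.
    by move=> c e Cc Ce; exact: smooth_on_cst.
- move=> x [Cx|Ax]; last by exists new; [right|split; [exact: At|exact: AV]].
  have [t' Tt' t'x] := CT _ Cx; exists (restr_triv t' U).
    by left; exists t'.
  by split => //; move=> [Bx nWx]; apply/nWx/CW.
- exists U; split => //.
    by move=> x Cx [Bx nWx]; apply/nWx/CW.
  by move=> t' Tt'; left; exists t'.
Qed.

(** Passing to stage n + 1 shrinks the old trivializations, but to an open set
    that still contains A_0 u ... u A_(n-1). Restricted to the interior of this
    union, the trivializations of stage n therefore belong to all the later
    stages, up to restriction, and are compatible with them. *)
Lemma exists_smooth_family : exists T : set (triv_of P), smooth_family T /\
  forall x, exists2 t, T t & t.1 x.
Proof.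
pose Q (A : set M) := A = set0 \/ exists t : triv_of P, is_triv t /\ A `<=` t.1.
have [A [hA cA]] : exists A : nat ->
  set M, (forall n, compact (A n) /\ Q (A n)) /\
    forall x : M, exists n, nbhs x (A n).
  apply: compact_exhaustion; first by left.
  move=> x; have [t [ht tx]] := exists_triv P x; exists t.1; split => //.
    exact: triv_open ht.
  by move=> B Bt; right; exists t.
pose C := union_upto A.
have cC n : compact (C n) by apply: compact_union_upto => i; exact: (hA i).1.
pose I n (T : set (triv_of P)) := smooth_family T /\
  forall x, C n x -> exists2 t', T t' & t'.1 x.
pose S n (T T' : set (triv_of P)) :=
  exists U, [/\ open U, C n `<=` U & forall t', T t' -> T' (restr_triv t' U)].
have I0 : I 0%N set0.
  by split; [split|rewrite /C union_upto0].
have [|u [_ uI uS]] := dependent_choice_nat I0 (Q := S).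
  move=> n T [sT CT]; have [cAn [A0|[t [ht At]]]] := hA n.
    exists T; split.
      by split => //; rewrite /C union_uptoS A0 setU0.
    exists setT; split => //; first exact: openT.
    by move=> t' Tt'; rewrite restr_trivT//; exact: sT.1.
  have [T' [sT' CT' CU]] := smooth_family_extend sT (cC n) CT ht cAn At.
  by exists T'; split => //; split => //; rewrite /C union_uptoS.
have uE m n : (m <= n)%N -> S m (u m) (u n).
  move=> /subnK <-; elim: (n - m)%N => [|k [U [oU CU h]]].
    exists setT; split => //; first exact: openT.
    by move=> t' Tt'; rewrite restr_trivT//; exact: (uI m).1.1.
  have [U' [oU' CU' h']] := uS (k + m)%N.
  exists (U `&` U'); split; first exact: openI.
    move=> x Cx; split; first exact: CU.
    by apply: CU'; apply: union_upto_leq Cx; exact: leq_addl.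
  move=> t' /h/h'; congr (u _ _); rewrite /restr_triv /=.
  by rewrite setIA.
pose T := [set t | exists n t', u n t' /\ t = restr_triv t' (interior (C n))].
have hT n t' : u n t' -> is_triv (restr_triv t' (interior (C n))).
  move=> ut'; apply: is_triv_restr; last exact: open_interior.
  exact: (uI n).1.1.
have main m n t t' : (m <= n)%N -> u m t -> u n t' ->
    smooth_map CM CK (t.1 `&` interior (C m) `&` (t'.1 `&` interior (C n)))
      (local_rep id t t') /\
    smooth_map CM CK (t'.1 `&` interior (C n) `&` (t.1 `&` interior (C m)))
      (local_rep id t' t).
  move=> mn ut ut'; have [U [oU CU h]] := uE _ _ mn.
  split.
    apply: smooth_map_sub ((uI n).1.2 _ _ (h _ ut) ut').
    move=> x [[tx /interior_subset Cx] [t'x _]]; split => //; split => //.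
    exact: CU.
  apply: smooth_map_sub ((uI n).1.2 _ _ ut' (h _ ut)).
  move=> x [[t'x _] [tx /interior_subset Cx]]; split => //; split => //.
  exact: CU.
exists T; split.
  split; first by move=> _ [n [t' [ut' ->]]]; exact: hT.
  move=> _ _ [m [t [ut ->]]] [n [t' [ut' ->]]].
  have [mn|/ltnW nm] := leqP m n; first exact: (main m n t t' mn ut ut').1.
  exact: (main n m t' t nm ut' ut).2.
move=> x; have [n nA] := cA x.
have iC : interior (C n.+1) x.
  by apply: filterS nA => y Ay; exists n.
have [t ut tx] := (uI n.+1).2 x (interior_subset iC).
by exists (restr_triv t (interior (C n.+1))); [exists n.+1, t|split].
Qed.

End Restriction.

End Theorems.

Theorem corollary2p13 (R : realType) (E : tvsType R) (hE : hausdorff_space E)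
    (K : lieGroup E) (d : nat) (M : cornerManifold R d)
    (hM : connected [set: M]) :
  (forall P : principalBundle K M,
     exists P' : smoothBundle K M, continuously_equivalent P P') /\
  (forall P P' : smoothBundle K M,
     smoothly_equivalent P P' <-> continuously_equivalent P P').
Proof.
split=> [P|P P'].
  have [T [[hT sT] cT]] := @exists_smooth_family R d E K M hE hM P.
  have smooth_transitions ti tj : T ti -> T tj ->
      exists k : M -> K, is_transition ti tj k /\
        smooth_map (cm_atlas M) (lg_atlas K) (ti.1 `&` tj.1) k.
    move=> Ti Tj; exists (local_rep id tj ti); split; last by rewrite setIC;
      exact: sT.
    move=> x [tix tjx].
    exact/esym/(vertical_map_unit_section (vertical_map_id P) (hT _ Tj)
      (hT _ Ti)).
  exists (SmoothBundle (conj hT cT) smooth_transitions).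
  by exists id; exact/vertical_map_equivalence/vertical_map_id.
split=> [[f [ef _]]|[f /equivalence_vertical_map hf]]; first by exists f.
have [f' [hf' sf']] := smoothing_vertical_map hE hM
  (smooth_bundle_family P) (smooth_bundle_family P')
  (sb_trivP P).2 (sb_trivP P').2 hf.
exists f'; split; first exact: vertical_map_equivalence.
exact: smooth_over_smooth_map.
Qed.
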